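(* Let $M$ be a smooth, Hausdorff, second countable, connected manifold of dimension at least $1$, fix a divergence $\mathrm{div}$ on $M$, and let $\mathcal{C}$ be the associated conjugation automorphism of $\mathcal{D}(M)$. A linear map $\Phi:\mathcal{D}(M)\to\mathcal{D}(M)$ is an automorphism of the Lie algebra $\mathcal{D}(M)$ of linear differential operators on $C^\infty(M)$ if and only if it can be written in the form $$\Phi=\phi_*\circ\mathcal{C}^a\circ e^{\overline{\omega}},$$ where $\phi$ is a diffeomorphism of $M$, $a\in\{0,1\}$, $\mathcal{C}^0=\mathrm{id}$ and $\mathcal{C}^1=\mathcal{C}$, and $\omega$ is a closed $1$-form on $M$. All the objects $\phi,a,\omega$ are uniquely determined by $\Phi$.
   Context: $\mathcal{D}(M)$ is the real associative algebra of all (finite order) linear differential operators $C^\infty(M)\to C^\infty(M)$, regarded as a Lie algebra with the commutator bracket; $\mathcal{D}^i(M)$ denotes the operators of order at most $i$. For a diffeomorphism $\phi$ of $M$, $\phi_*$ is the automorphism of $\mathcal{D}(M)$ given by $(\phi_*(D))(f)=(D(f\circ\phi))\circ\phi^{-1}$. For a closed $1$-form $\omega$, $\overline{\omega}:\mathcal{D}(M)\to\mathcal{D}(M)$ is the linear map determined by $\overline{\omega}(D)|_U=[D|_U,f_U]$ for every open $U\subset M$ and $f_U\in C^\infty(U)$ with $\omega|_U=df_U$. It is a derivation of $\mathcal{D}(M)$ mapping $\mathcal{D}^i(M)$ into $\mathcal{D}^{i-1}(M)$, hence locally nilpotent, and $e^{\overline{\omega}}=\sum_{k\ge 0}\frac{1}{k!}\overline{\omega}^k$.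 Divergence: let $\rho_0$ be a nowhere vanishing smooth $1$-density on $M$, and define $\mathrm{div}_{\rho_0}:\mathrm{Vect}(M)\to C^\infty(M)$ by $L_X\rho_0=(\mathrm{div}_{\rho_0}X)\rho_0$. A divergence is any map $X\mapsto \mathrm{div}_{\rho_0}X+X(h)$ with $h\in C^\infty(M)$ (i.e. any cocycle of $\mathrm{Vect}(M)$ with values in $C^\infty(M)$ cohomologous to $\mathrm{div}_{\rho_0}$); one divergence $\mathrm{div}$ is fixed. $\mathcal{C}$ is the unique Lie algebra automorphism of $\mathcal{D}(M)$ such that $\mathcal{C}(f)=-f$, $\mathcal{C}(X)=X+\mathrm{div}X$, $\mathcal{C}(D\circ f)=f\circ\mathcal{C}(D)$ and $\mathcal{C}(D\circ X)=-\mathcal{C}(X)\circ\mathcal{C}(D)$ for all $f\in C^\infty(M)$, $X\in\mathrm{Vect}(M)$, $D\in\mathcal{D}(M)$ (functions are identified with multiplication operators). *)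

(* Defs.v *)
From HB Require Import structures.
From mathcomp Require Import all_boot all_order all_algebra.
From mathcomp Require Import all_classical all_reals all_analysis.

Set Implicit Arguments.
Unset Strict Implicit.
Unset Printing Implicit Defensive.
Import Order.TTheory GRing.Theory Num.Theory.
Import numFieldNormedType.Exports.

Local Open Scope classical_set_scope.
Local Open Scope ring_scope.

(* For finite-dimensional V and U open, [Ck k U f] says that f is of class C^k
   on U (the derivatives of f in all fixed directions are of class C^(k-1)). *)
Fixpoint Ck (R : realType) (V W : normedModType R) (k : nat)
    (U : set V) (f : V -> W) : Prop :=
  match k with
  | 0 => forall x, U x -> {for x, continuous f}
  | k'.+1 => (forall x, U x -> differentiable f x) /\
             (forall v : V, Ck k' U (fun x => 'D_v f x))
  end.

Definition smooth_on (R : realType) (V W : normedModType R)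
  (U : set V) (f : V -> W) : Prop := forall k, Ck k U f.

Definition partial (R : realType) (n : nat) (W : normedModType R) (l : 'I_n)
  (f : 'rV[R]_n -> W) (x : 'rV[R]_n) : W := 'D_(delta_mx 0 l) f x.

(* [partials [:: i1; ...; im] f] is the iterated derivative of f with respect
   to the coordinates i1, ..., im. *)
Definition partials (R : realType) (n : nat) (s : seq 'I_n)
  (f : 'rV[R]_n -> R) : 'rV[R]_n -> R := foldr (fun l g => partial l g) f s.

Section SmoothTheory.
Context {R : realType}.

Lemma near_eq_differentiable (V W : normedModType R) (f g : V -> W) (x : V) :
  (\forall y \near x, f y = g y) -> differentiable f x -> differentiable g x.
Proof.
move=> fg df; pose e := g - f.
have e0 : \forall y \near x, e y = 0.
  by apply: filterS fg => y fgy; rewrite /e !fctE fgy subrr.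
have cl0 : continuous (\0 : V -> W) by move=> y; exact: cst_continuous.
have E : e \o shift x = cst (e x) + \0 +o_ 0 id.
  have e0' : \forall h \near (0 : V), e (h + x) = 0.
    by move: e0; rewrite (near_shift 0) subr0.
  apply/eqaddoP => _/posnumP[eps]; near=> h.
  rewrite (nbhs_singleton e0).
  have -> : (e \o shift x - (cst 0 + \0)) h = e (h + x).
    by rewrite /= !fctE /= addr0 subr0.
  by rewrite (near e0' h)// normr0 mulr_ge0.
have de : differentiable e x.
  apply/diff_locallyP.
  have -> : 'd e x = \0 :> (V -> W) by exact: diff_unique.
  by split.
have -> : g = f + e by rewrite /e addrC subrK.
exact: differentiableD.
Unshelve. all: by end_near. Qed.

Lemma Ck_local (V W : normedModType R) k (U : set V) (f : V -> W) :
  (forall x, U x -> exists2 A, A x & Ck k A f) -> Ck k U f.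
Proof.
elim: k f => [|k IH] f H /=.
  by move=> x Ux; have [A Ox] := H _ Ux; apply.
split=> [x Ux|v]; first by have [A Ox [d _]] := H _ Ux; exact: d.
by apply: IH => x Ux; have [A Ox [_ d]] := H _ Ux; exists A => //; exact: d.
Qed.

Lemma Ck_sub (V W : normedModType R) k (U A : set V) (f : V -> W) :
  A `<=` U -> Ck k U f -> Ck k A f.
Proof. by move=> OU fU; apply: Ck_local => x Ox; exists U => //; exact: OU. Qed.

Lemma Ck_ext (V W : normedModType R) k (U : set V) (f g : V -> W) :
  open U -> (forall x, U x -> f x = g x) -> Ck k U f -> Ck k U g.
Proof.
move=> oU; elim: k f g => [|k IH] f g fg /=.
  move=> cf x Ux; have nfg : (\forall y \near x, f y = g y).
    by apply: filterS (open_nbhs_nbhs (conj oU Ux)); exact: fg.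
  rewrite /prop_for /continuous_at -(nbhs_singleton nfg).
  exact: cvg_trans (near_eq_cvg nfg) (cf _ Ux).
case=> df Df; split=> [x Ux|v].
  apply: near_eq_differentiable (df _ Ux).
  by apply: filterS (open_nbhs_nbhs (conj oU Ux)); exact: fg.
apply: IH (Df v) => x Ux; apply: near_eq_derive.
by apply: filterS (open_nbhs_nbhs (conj oU Ux)); exact: fg.
Qed.

Lemma CkS (V W : normedModType R) k (U : set V) (f : V -> W) :
  Ck k.+1 U f -> Ck k U f.
Proof.
elim: k f => [|k IH] f [df Df] /=.
  by move=> x Ux; exact/differentiable_continuous/df.
by split=> // v; exact: (IH _ (Df v)).
Qed.

Lemma Ck_cst (V W : normedModType R) k (U : set V) (c : W) :
  Ck k U (fun _ => c).
Proof.
elim: k c => [|k IH] c /=; first by move=> x _; exact: cst_continuous.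
split=> [x _|v]; first exact: differentiable_cst.
suff -> : (fun x : V => 'D_v (fun _ : V => c) x) = (fun _ => 0) by exact: IH.
by apply/funext => x; exact: derive_cst.
Qed.

Lemma CkD (V W : normedModType R) k (U : set V) (f g : V -> W) : open U ->
  Ck k U f -> Ck k U g -> Ck k U (fun x => f x + g x).
Proof.
move=> oU; elim: k f g => [|k IH] f g /=.
  by move=> cf cg x Ux; apply: continuousD; [exact: cf|exact: cg].
move=> [df Df] [dg Dg]; split=> [x Ux|v].
  by apply: differentiableD; [exact: df|exact: dg].
apply: Ck_ext (IH _ _ (Df v) (Dg v)) => // x Ux.
by rewrite -deriveD//; apply: diff_derivable; [exact: df|exact: dg].
Qed.

Lemma CkZ (V W : normedModType R) k (U : set V) (c : R) (f : V -> W) : open U ->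
  Ck k U f -> Ck k U (fun x => c *: f x).
Proof.
move=> oU; elim: k f => [|k IH] f /=.
  by move=> cf x Ux; apply: continuousZr; exact: cf.
move=> [df Df]; split=> [x Ux|v].
  by apply: differentiableZ; exact: df.
apply: Ck_ext (IH _ (Df v)) => // x Ux.
by rewrite -deriveZ//; apply: diff_derivable; exact: df.
Qed.

Lemma CkM (V : normedModType R) k (U : set V) (f g : V -> R) : open U ->
  Ck k U f -> Ck k U g -> Ck k U (fun x => f x * g x).
Proof.
move=> oU; elim: k f g => [|k IH] f g.
  by move=> cf cg x Ux; apply: continuousM; [exact: cf|exact: cg].
move=> Cf Cg; have [df Df] := Cf; have [dg Dg] := Cg; split=> [x Ux|v].
  by apply: differentiableM; [exact: df|exact: dg].
apply: Ck_ext (CkD oU (IH _ _ (CkS Cf) (Dg v)) (IH _ _ (CkS Cg) (Df v))) => //.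
move=> x Ux; rewrite deriveM//; apply: diff_derivable; [exact: df|exact: dg].
Qed.

Lemma Ck_sum (V W : normedModType R) k (U : set V) (I : Type) (r : seq I)
    (F : I -> V -> W) : open U ->
  (forall i, Ck k U (F i)) -> Ck k U (fun x => \sum_(i <- r) F i x).
Proof.
move=> oU CF; elim: r => [|i r IH].
  by apply: Ck_ext (@Ck_cst _ _ k U 0) => // x _; rewrite big_nil.
by apply: Ck_ext (CkD oU (CF i) IH) => // x _; rewrite big_cons.
Qed.

Lemma Ck_coord (V : normedModType R) n k (U : set V) (f : V -> 'rV[R]_n) l :
  open U -> Ck k U f -> Ck k U (fun x => f x 0 l).
Proof.
move=> oU; elim: k f => [|k IH] f.
  move=> cf x Ux; apply: (continuous_comp (g := fun M : 'rV[R]_n => M 0 l)).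
    exact: cf.
  exact: coord_continuous.
move=> [df Df]; split=> [x Ux|v].
  apply: (differentiable_comp (g := fun M : 'rV[R]_n => M 0 l)); first exact: df.
  exact: differentiable_coord.
apply: Ck_ext (IH _ (Df v)) => // x Ux.
by rewrite derive_mx ?mxE//; apply: diff_derivable; exact: df.
Qed.

Lemma derive_comp_partial (V : normedModType R) n (s : V -> 'rV[R]_n)
    (g : 'rV[R]_n -> R) x v : differentiable s x -> differentiable g (s x) ->
  'D_v (fun y => g (s y)) x = \sum_l 'D_v (fun y => s y 0 l) x * partial l g (s x).
Proof.
move=> ds dg; rewrite deriveE; last exact: (differentiable_comp ds dg).
rewrite (diff_comp ds dg)/= -(deriveE _ ds).
rewrite [in LHS](row_sum_delta ('D_v s x)) raddf_sum; apply: eq_bigr => l _.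
transitivity (('D_v s x) 0 l *: 'd g (s x) (delta_mx 0 l)).
  exact: linearZ_LR.
rewrite /partial (deriveE _ dg); congr (_ * _).
by rewrite derive_mx ?mxE//; exact: diff_derivable.
Qed.

Lemma Ck_comp (V : normedModType R) n k (U : set V) (A : set 'rV[R]_n)
    (s : V -> 'rV[R]_n) (g : 'rV[R]_n -> R) :
  open U -> (forall x, U x -> A (s x)) -> Ck k U s -> Ck k A g ->
  Ck k U (fun x => g (s x)).
Proof.
move=> oU sUO; elim: k g => [|k IH] g.
  by move=> cs cg x Ux; apply: continuous_comp; [exact: cs|exact/cg/sUO].
move=> Cs [dg Dg]; have [ds Ds] := Cs; split=> [x Ux|v].
  by apply: (differentiable_comp (f := s)); [exact: ds|exact/dg/sUO].
apply: (@Ck_ext _ _ _ _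
  (fun x => \sum_l 'D_v (fun y => s y 0 l) x * partial l g (s x))) => //.
  by move=> x Ux; rewrite derive_comp_partial//; [exact: ds|exact/dg/sUO].
apply: Ck_sum => // l; apply: CkM => //; last exact: IH (CkS Cs) (Dg _).
apply: Ck_ext (Ck_coord l oU (Ds v)) => // x Ux.
by rewrite derive_mx ?mxE//; apply: diff_derivable; exact: ds.
Qed.

Lemma smooth_partial n (U : set 'rV[R]_n) (W : normedModType R) l
  (f : 'rV[R]_n -> W) : smooth_on U f -> smooth_on U (partial l f).
Proof. by move=> sf k; have [_] := sf k.+1; apply. Qed.

Lemma smooth_partials n (U : set 'rV[R]_n) s (f : 'rV[R]_n -> R) :
  smooth_on U f -> smooth_on U (partials s f).
Proof. by move=> sf; elim: s => //= l s IH; exact: smooth_partial. Qed.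

Lemma smooth_id (V : normedModType R) (U : set V) : smooth_on U (@id V).
Proof.
case=> [x _|k]; first exact: cvg_id.
split=> [x _|v]; first exact: (@ex_diff _ _ _ _ _ _ _ (is_diff_id x)).
suff -> : (fun x : V => 'D_v (@id V) x) = (fun _ => v) by exact: Ck_cst.
by apply/funext => x; exact: derive_id.
Qed.

Lemma smooth_differentiable (V W : normedModType R) (U : set V) (f : V -> W) x :
  smooth_on U f -> U x -> differentiable f x.
Proof. by move=> sf Ux; have [df _] := sf 1; exact: df. Qed.

End SmoothTheory.

(* A manifold of dimension n, given by a (not necessarily maximal) atlas: the
   chart i is a homeomorphism of dom i onto rng i with inverse param i; chart i
   and param i are irrelevant off dom i and rng i. *)
Record manifold (R : realType) (n : nat) := Manifold {
  pt :> topologicalType;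
  pt_hausdorff : hausdorff_space pt;
  pt_second_countable : @second_countable pt;
  idx : Type;
  dom : idx -> set pt;
  rng : idx -> set 'rV[R]_n;
  chart : idx -> pt -> 'rV[R]_n;
  param : idx -> 'rV[R]_n -> pt;
  dom_open : forall i, open (dom i);
  rng_open : forall i, open (rng i);
  dom_cover : forall p, exists i, dom i p;
  chart_rng : forall i p, dom i p -> rng i (chart i p);
  param_dom : forall i x, rng i x -> dom i (param i x);
  chartK : forall i p, dom i p -> param i (chart i p) = p;
  paramK : forall i x, rng i x -> chart i (param i x) = x;
  chart_continuous : forall i p, dom i p -> {for p, continuous (chart i)};
  param_continuous : forall i x, rng i x -> {for x, continuous (param i)};
  chart_compat : forall i j,
    smooth_on (rng i `&` param i @^-1` dom j) (chart j \o param i)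
}.

Section Functions.
Context {R : realType} {n : nat} (M : manifold R n).

(* f is of class C^infinity on the open set U; its values off U are irrelevant *)
Definition smooth_fun (U : set M) (f : M -> R) : Prop :=
  forall i, smooth_on (rng i `&` param i @^-1` U) (f \o param i).

Definition smooth_map (phi : M -> M) : Prop :=
  continuous phi /\
  forall i j, smooth_on (rng i `&` (phi \o param i) @^-1` dom j)
                        (chart j \o phi \o param i).

Lemma preimage_param_open i (U : set M) : open U ->
  open (rng i `&` param i @^-1` U).
Proof.
move=> oU; rewrite openE => x [rx Ux]; apply: filterI.
  by apply: open_nbhs_nbhs; split; [exact: rng_open|].
by apply: (param_continuous rx); apply: open_nbhs_nbhs.
Qed.

Lemma preimage_chart_open i (A : set 'rV[R]_n) : open A ->
  open (dom (m := M) i `&` chart i @^-1` A).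
Proof.
move=> oA; rewrite openE => p [dp Ap]; apply: filterI.
  by apply: open_nbhs_nbhs; split; [exact: dom_open|].
by apply: (chart_continuous dp); apply: open_nbhs_nbhs.
Qed.

Definition cinf_pred : {pred M -> R} := [pred f | `[< smooth_fun setT f >]].

Lemma cinf_predP (f : M -> R) : reflect (smooth_fun setT f) (f \in cinf_pred).
Proof. exact: asboolP. Qed.

Lemma cinf_subring : subring_closed cinf_pred.
Proof.
split=> [|f g|f g].
- apply/cinf_predP => i k; exact: Ck_cst.
- move=> /cinf_predP sf /cinf_predP sg; apply/cinf_predP => i k.
  have oU := (@preimage_param_open i _ openT).
  apply: Ck_ext (CkD oU (sf i k) (CkZ (-1) oU (sg i k))) => // x _.
  by rewrite /= scaleN1r.
- move=> /cinf_predP sf /cinf_predP sg; apply/cinf_predP => i k.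
  have oU := (@preimage_param_open i _ openT).
  exact: CkM oU (sf i k) (sg i k).
Qed.

Lemma cinf_scale : GRing.scaler_closed cinf_pred.
Proof.
move=> c f /cinf_predP sf; apply/cinf_predP => i k.
exact: CkZ (@preimage_param_open i _ openT) (sf i k).
Qed.

HB.instance Definition _ :=
  GRing.isSubringClosed.Build (M -> R) cinf_pred cinf_subring.
HB.instance Definition _ :=
  GRing.isScaleClosed.Build R (M -> R) cinf_pred cinf_scale.

Record cinf := Cinf { cfun :> M -> R; _ : cfun \in cinf_pred }.

HB.instance Definition _ := [isSub for cfun].
HB.instance Definition _ := [Choice of cinf by <:].
HB.instance Definition _ :=
  GRing.SubChoice_isSubComPzRing.Build (M -> R) cinf_pred cinf cinf_subring.
HB.instance Definition _ := [SubZmodule_isSubLmodule of cinf by <:].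

Record diffeo := Diffeo {
  dfun :> M -> M;
  dinv : M -> M;
  dfunK : cancel dfun dinv;
  dinvK : cancel dinv dfun;
  dfun_smooth : smooth_map dfun;
  dinv_smooth : smooth_map dinv
}.

Definition diffeo_inv (phi : diffeo) : diffeo :=
  Diffeo (dinvK phi) (dfunK phi) (dinv_smooth phi) (dfun_smooth phi).

Lemma cinfP (f : cinf) i : smooth_on (rng i) (f \o param i).
Proof.
case: f => f /= /cinf_predP sf k.
by apply: Ck_sub (sf i k) => x.
Qed.

Lemma cinf_ext (f g : cinf) : f =1 g -> f = g.
Proof. by move=> fg; apply/val_inj/funext. Qed.

Lemma preimage_map_open (phi : M -> M) i j : continuous phi ->
  open (rng i `&` (phi \o param i) @^-1` dom j).
Proof.
move=> cphi; apply: (@preimage_param_open i (phi @^-1` dom j)).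
by apply: open_comp (dom_open j) => p _; exact: cphi.
Qed.

Lemma cinf_precomp_subproof (phi : diffeo) (f : cinf) :
  (fun p => f (phi p)) \in cinf_pred.
Proof.
apply/cinf_predP => i k; have [cphi sphi] := dfun_smooth phi.
apply: Ck_local => x [rx _]; have [j dj] := dom_cover (phi (param i x)).
have oA := @preimage_map_open phi i j cphi.
exists (rng i `&` (phi \o param i) @^-1` dom j) => //.
apply: Ck_ext (Ck_comp oA _ (sphi i j k) (cinfP f j k)) => //.
  by move=> y [_ dy] /=; rewrite chartK.
by move=> y [_ dy] /=; exact: chart_rng.
Qed.

Definition precomp (phi : diffeo) (f : cinf) : cinf :=
  Cinf (cinf_precomp_subproof phi f).

End Functions.

Section DifferentialOperators.
Context {R : realType} {n : nat} (M : manifold R n).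
Local Notation term := (('rV[R]_n -> R) * seq 'I_n)%type.

(* The local expression sum_(a, [:: i1; ...; im]) a * d_i1 ... d_im g, evaluated
   at x. *)
Definition local_expr (L : seq term) (g : 'rV[R]_n -> R) (x : 'rV[R]_n) : R :=
  \sum_(t <- L) t.1 x * partials t.2 g x.

Definition local_terms (k : nat) (U : set 'rV[R]_n) (L : seq term) : Prop :=
  forall t, t \in L -> smooth_on U t.1 /\ (size t.2 <= k)%N.

(* D is a differential operator of order at most k *)
Definition diff_order (k : nat) (D : cinf M -> cinf M) : Prop :=
  linear D /\
  forall i x, rng i x -> exists U L,
    [/\ open U, U x, U `<=` rng i, local_terms k U L &
        forall (f : cinf M) y, U y ->
          D f (param i y) = local_expr L (f \o param i) y].

Definition dop_pred : {pred cinf M -> cinf M} :=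
  [pred D | `[< exists k, diff_order k D >]].

Lemma dop_predP (D : cinf M -> cinf M) :
  reflect (exists k, diff_order k D) (D \in dop_pred).
Proof. exact: asboolP. Qed.

Lemma local_terms_sub k k' (U U' : set 'rV[R]_n) L : (k <= k')%N -> U' `<=` U ->
  local_terms k U L -> local_terms k' U' L.
Proof.
move=> kk' UU' TL t /TL[st sz]; split; last exact: leq_trans kk'.
by move=> m; exact: Ck_sub (st m).
Qed.

Lemma local_terms_cat k (U : set 'rV[R]_n) L L' :
  local_terms k U L -> local_terms k U L' -> local_terms k U (L ++ L').
Proof. by move=> TL TL' t; rewrite mem_cat => /orP[/TL|/TL']. Qed.

Let expr_along (s : 'rV[R]_n -> 'rV[R]_n) (L : seq term) g x :=
  \sum_(t <- L) t.1 x * partials t.2 g (s x).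

Lemma expr_along_smooth s (U U' : set 'rV[R]_n) k L g : open U ->
  smooth_on U s -> (forall x, U x -> U' (s x)) -> local_terms k U L ->
  smooth_on U' g -> smooth_on U (expr_along s L g).
Proof.
move=> oU ss sU TL sg; elim: L TL => [|t L IH] TL.
  move=> m; apply: Ck_ext (@Ck_cst _ _ _ m U 0) => // x _.
  by rewrite /expr_along big_nil.
have {}IH : smooth_on U (expr_along s L g).
  by apply: IH => u uL; apply: TL; rewrite inE uL orbT.
have [st _] := TL t (mem_head _ _).
move=> m.
have C : Ck m U (fun x => partials t.2 g (s x)).
  exact: (Ck_comp oU sU (ss m) (@smooth_partials _ _ _ t.2 _ sg m)).
apply: Ck_ext (CkD oU (CkM oU (st m) C) (IH m)) => // x _.
by rewrite /expr_along big_cons.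
Qed.

Lemma partial_expr_along s (U U' : set 'rV[R]_n) k L l : open U ->
  smooth_on U s -> (forall x, U x -> U' (s x)) -> local_terms k U L ->
  exists2 L', local_terms k.+1 U L' & forall g x, smooth_on U' g -> U x ->
    partial l (expr_along s L g) x = expr_along s L' g x.
Proof.
move=> oU ss sU; elim: L => [|t L IH] TL.
  exists nil => // g x _ Ux; rewrite /partial.
  have -> : expr_along s [::] g = cst 0.
    by apply/funext => z; rewrite /expr_along big_nil.
  exact: derive_cst.
have TL' : local_terms k U L by move=> u uL; apply: TL; rewrite inE uL orbT.
have [L' T' E'] := IH TL'.
have [st sz] := TL t (mem_head _ _).
exists ((partial l t.1, t.2) ::
  [seq (fun z => t.1 z * partial l (fun y => s y 0 m) z, m :: t.2)
     | m <- index_enum 'I_n] ++ L').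
  move=> u; rewrite inE mem_cat => /orP[/eqP->|/orP[/mapP[m _ ->]|/T']//] /=.
    by split; [exact: smooth_partial|exact: leqW].
  split=> // j; apply: CkM => //.
  have sc : smooth_on U (fun y => s y 0 m) by move=> i; apply: Ck_coord.
  exact: (smooth_partial l sc).
move=> g x sg Ux.
have dp : differentiable (partials t.2 g) (s x).
  by apply: smooth_differentiable (sU _ Ux); exact: smooth_partials.
have ds : differentiable s x by exact: smooth_differentiable ss Ux.
have dc : differentiable (fun y => partials t.2 g (s y)) x.
  exact: (differentiable_comp ds dp).
have dt : differentiable t.1 x by exact: smooth_differentiable st Ux.
have dL : differentiable (expr_along s L g) x.
  by exact: smooth_differentiable (expr_along_smooth oU ss sU TL' sg) Ux.
rewrite /partial.
rewrite (_ : expr_along s (t :: L) g =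
    t.1 * (fun y => partials t.2 g (s y)) + expr_along s L g); last first.
  by apply/funext => z; rewrite /expr_along big_cons.
have D1 : derivable (t.1 : _ -> R) x (delta_mx 0 l) by exact: diff_derivable.
have D2 : derivable (fun y => partials t.2 g (s y)) x (delta_mx 0 l).
  exact: diff_derivable.
rewrite deriveD; [|exact: derivableM|exact: diff_derivable].
rewrite deriveM// [X in _ + X](E' g x)//.
rewrite /expr_along big_cons big_cat big_map/= addrA; congr (_ + _).
rewrite (derive_comp_partial _ ds dp) addrC /GRing.scale/=.
congr (_ + _); last by rewrite mulrC.
rewrite mulr_sumr; apply: eq_bigr => m _.
by rewrite mulrA.
Qed.

Lemma partials_expr_along s (U U' : set 'rV[R]_n) k L w : open U ->
  smooth_on U s -> (forall x, U x -> U' (s x)) -> local_terms k U L ->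
  exists2 L', local_terms (k + size w) U L' & forall g x, smooth_on U' g ->
    U x -> partials w (expr_along s L g) x = expr_along s L' g x.
Proof.
move=> oU ss sU TL; elim: w => [|l w [L' T' E']] /=.
  by exists L => //; rewrite addn0.
have [L'' T'' E''] := partial_expr_along l oU ss sU T'.
exists L'' => [|g x sg Ux]; first by rewrite addnS.
rewrite -E''//; apply: near_eq_derive.
by apply: filterS (open_nbhs_nbhs (conj oU Ux)) => y Uy; exact: E'.
Qed.

Lemma partials_ext w (U : set 'rV[R]_n) (f g : 'rV[R]_n -> R) x : open U ->
  (forall y, U y -> f y = g y) -> U x -> partials w f x = partials w g x.
Proof.
move=> oU fg; elim: w x => [|l w IH] x Ux /=; first exact: fg.
apply: near_eq_derive.
by apply: filterS (open_nbhs_nbhs (conj oU Ux)) => y Uy; exact: IH.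
Qed.

Lemma diff_order_comb k k' c D E : diff_order k D -> diff_order k' E ->
  diff_order (maxn k k') (fun f => D f + c *: E f).
Proof.
move=> [lD hD] [lE hE]; split.
  by move=> a f g; rewrite lD lE !scalerDr !scalerA mulrC addrACA.
move=> i x rx.
have [U [L [oU Ux Ur TL eL]]] := hD i x rx.
have [U' [L' [oU' Ux' Ur' TL' eL']]] := hE i x rx.
exists (U `&` U'), (L ++ [seq (fun z => c * t.1 z, t.2) | t <- L']); split.
- exact: openI.
- by [].
- by move=> y [/Ur].
- apply: local_terms_cat.
    by apply: local_terms_sub TL; [exact: leq_maxl|move=> y []].
  have {}TL' : local_terms (maxn k k') (U `&` U') L'.
    by apply: local_terms_sub TL'; [exact: leq_maxr|move=> y []].
  move=> _ /mapP[t /TL'[st sz] ->]; split=> // m.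
  exact: (CkZ c (openI oU oU') (st m)).
- move=> f y [Uy Uy']; rewrite /local_expr big_cat/= big_map.
  transitivity (D f (param i y) + c * E f (param i y)) => //.
  rewrite eL// eL'//; congr (_ + _); rewrite mulr_sumr.
  by apply: eq_bigr => t _; rewrite /= mulrA.
Qed.

Lemma diff_order0 (h : cinf M) : diff_order 0 (fun f => h * f).
Proof.
split=> [a f g|i x rx].
  by rewrite mulrDr; congr (_ + _); apply: cinf_ext => p; exact: mulrCA.
exists (rng i), [:: (h \o param i, [::])]; split=> //.
- exact: rng_open.
- by move=> t; rewrite inE => /eqP-> /=; split=> //; exact: cinfP.
- by move=> f y ry; rewrite /local_expr big_seq1.
Qed.

Lemma diff_order_comp k k' D E : diff_order k D -> diff_order k' E ->
  diff_order (k' + k) (fun f => D (E f)).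
Proof.
move=> [lD hD] [lE hE]; split; first by move=> a f g; rewrite lE lD.
move=> i x rx.
have [U1 [L1 [oU1 Ux1 Ur1 TL1 eL1]]] := hD i x rx.
have [U2 [L2 [oU2 Ux2 Ur2 TL2 eL2]]] := hE i x rx.
pose U := U1 `&` U2; have oU : open U by exact: openI.
have {}TL1 : local_terms k U L1.
  by apply: local_terms_sub TL1 => // y [].
have {}TL2 : local_terms k' U L2.
  by apply: local_terms_sub TL2 => // y [].
have [L TL eL] : exists2 L, local_terms (k' + k) U L & forall g y, smooth_on U g ->
    U y -> local_expr L1 (local_expr L2 g) y = local_expr L g y.
  elim: L1 TL1 {eL1} => [|t L1 IH] TL1.
    by exists nil => // g y _ _; rewrite /local_expr !big_nil.
  have [|L T' E'] := IH; first by move=> u uL; apply: TL1; rewrite inE uL orbT.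
  have [st sz] := TL1 t (mem_head _ _).
  have [Lt Tt Et] := partials_expr_along t.2 oU (@smooth_id _ _ U)
    (fun x Ux => Ux) TL2.
  exists ([seq (fun z => t.1 z * u.1 z, u.2) | u <- Lt] ++ L).
    apply: local_terms_cat => // _ /mapP[u /Tt[su szu] ->]; split.
      by move=> m; apply: CkM.
    by apply: leq_trans szu _; rewrite leq_add2l.
  move=> g y sg Uy; rewrite /local_expr big_cons big_cat/= big_map.
  congr (_ + _); last exact: E'.
  rewrite [X in _ * X](Et g y)// mulr_sumr.
  by apply: eq_bigr => u _; rewrite /= mulrA.
exists U, L; split=> //; first by move=> y [/Ur1].
move=> f y Uy; rewrite eL1; last by case: Uy.
rewrite -eL//; last by move=> m; apply: Ck_sub (@cinfP _ _ _ f i m) => z [/Ur1].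
apply: eq_bigr => t _; congr (_ * _); apply: partials_ext Uy => // z [_ Uz].
exact: eL2.
Qed.

Lemma diff_order_push (phi : diffeo M) k D : diff_order k D ->
  diff_order k (fun f => precomp (diffeo_inv phi) (D (precomp phi f))).
Proof.
move=> [lD hD]; split.
  move=> a f g; apply: cinf_ext => p /=.
  rewrite (_ : precomp phi _ = a *: precomp phi f + precomp phi g) ?lD//.
  exact: cinf_ext.
have [cphi sphi] := dfun_smooth phi; have [cpsi spsi] := dinv_smooth phi.
move=> j x rx; pose psi := dinv phi.
have [i di] := dom_cover (psi (param j x)).
pose s' := chart i \o psi \o param j; pose s := chart j \o phi \o param i.
have [U0 [L0 [oU0 Ux0 Ur0 TL0 eL0]]] := hD i (s' x) (chart_rng di).
pose U1 := U0 `&` (rng i `&` (phi \o param i) @^-1` dom j).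
have oU1 : open U1 by apply: openI => //; exact: preimage_map_open.
have ss : smooth_on U1 s by move=> m; apply: Ck_sub (sphi i j m) => y [].
have sU y : U1 y -> rng j (s y) by move=> [_ [_ dy]]; exact: chart_rng.
have {}TL0 : local_terms k U1 L0 by apply: local_terms_sub TL0 => // y [].
pose U := (rng j `&` (psi \o param j) @^-1` dom i) `&` s' @^-1` U1.
have oU : open U.
  have -> : U = rng j `&` param j @^-1` (psi @^-1` (dom i `&` chart i @^-1` U1)).
    by apply/seteqP; split=> y [] => [[? ?] ?|? [? ?]].
  apply: preimage_param_open; apply: open_comp; first by move=> p _; exact: cpsi.
  exact: preimage_chart_open.
have ss' : smooth_on U s' by move=> m; apply: Ck_sub (spsi j i m) => y [].
have s'K y : U y -> s (s' y) = y.
  by move=> [[ry dy] _]; rewrite /s /s' /= chartK// dinvK paramK.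
have s'U y : U y -> U1 (s' y) by case.
have cmp (h : 'rV[R]_n -> R) : smooth_on U1 h -> smooth_on U (h \o s').
  by move=> sh m; exact: (Ck_comp oU s'U (ss' m) (sh m)).
pose one_term : seq term := [:: (cst 1, [::])].
have T1 : local_terms 0 U1 one_term.
  by move=> t; rewrite inE => /eqP->; split=> // m; exact: Ck_cst.
have E1 g : expr_along s one_term g = g \o s.
  by apply/funext => z; rewrite /expr_along big_seq1 mul1r.
have [L TL eL] : exists2 L, local_terms k U L & forall g y,
    smooth_on (rng j) g -> U y -> local_expr L0 (g \o s) (s' y) = local_expr L g y.
  elim: L0 TL0 {eL0} => [|t L0 IH] TL0.
    by exists nil => // g y _ _; rewrite /local_expr !big_nil.
  have [|L T' E'] := IH; first by move=> u uL; apply: TL0; rewrite inE uL orbT.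
  have [st sz] := TL0 t (mem_head _ _).
  have [Lt Tt Et] := partials_expr_along t.2 oU1 ss sU T1.
  exists ([seq (fun z => t.1 (s' z) * u.1 (s' z), u.2) | u <- Lt] ++ L).
    apply: local_terms_cat => // _ /mapP[u /Tt[su szu] ->]; split.
      by move=> m; apply: CkM => //; [exact: cmp st m|exact: cmp su m].
    exact: leq_trans szu sz.
  move=> g y sg Uy; rewrite /local_expr big_cons big_cat/= big_map.
  congr (_ + _); last exact: E'.
  rewrite -E1 [X in _ * X](Et g (s' y))//; last exact: s'U.
  rewrite mulr_sumr; apply: eq_bigr => u _.
  by rewrite /= mulrA s'K.
exists U, L; split=> //.
- split; first by split.
  split=> //; split; first exact: chart_rng.
  by rewrite /s' /= chartK// dinvK; exact: param_dom.
- by move=> y [[]].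
move=> f y Uy; rewrite -eL//; last exact: cinfP.
have Us := s'U _ Uy; have [[ry dy] _] := Uy.
have -> : precomp (diffeo_inv phi) (D (precomp phi f)) (param j y) =
          D (precomp phi f) (param i (s' y)) by rewrite /= /s' /= chartK.
rewrite eL0; last by case: Us.
apply: eq_bigr => t _; congr (_ * _); apply: partials_ext Us => // z [_ [_ dz]].
by rewrite /s /= chartK.
Qed.

Lemma dop_zmod : zmod_closed dop_pred.
Proof.
split=> [|D E].
  by apply/dop_predP; exists 0; have := diff_order0 0; congr diff_order;
    apply/funext => f; rewrite mul0r.
move=> /dop_predP[k hD] /dop_predP[k' hE]; apply/dop_predP; exists (maxn k k').
have := diff_order_comb (-1) hD hE; congr diff_order.
by apply/funext => f; rewrite scaleN1r.
Qed.

Lemma dop_scale : GRing.scaler_closed dop_pred.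
Proof.
move=> c D /dop_predP[k hD]; apply/dop_predP; exists (maxn 0 k).
have := diff_order_comb c (diff_order0 0) hD; congr diff_order.
by apply/funext => f; rewrite mul0r add0r.
Qed.

HB.instance Definition _ :=
  GRing.isZmodClosed.Build (cinf M -> cinf M) dop_pred dop_zmod.
HB.instance Definition _ :=
  GRing.isScaleClosed.Build R (cinf M -> cinf M) dop_pred dop_scale.

(* The algebra of differential operators: pointwise linear structure, and
   composition as product. *)
Record Dop := MkDop { dop_fun :> cinf M -> cinf M; _ : dop_fun \in dop_pred }.

HB.instance Definition _ := [isSub for dop_fun].
HB.instance Definition _ := [Choice of Dop by <:].
HB.instance Definition _ := [SubChoice_isSubZmodule of Dop by <:].
HB.instance Definition _ := [SubZmodule_isSubLmodule of Dop by <:].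

Lemma dop_ext (D E : Dop) : D =1 E -> D = E.
Proof. by move=> DE; apply/val_inj/funext. Qed.

Lemma dop_linear (D : Dop) : linear D.
Proof. by case: D => D /= /dop_predP[k []]. Qed.

Lemma mulop_subproof (h : cinf M) : (fun f => h * f) \in dop_pred.
Proof. by apply/dop_predP; exists 0; exact: diff_order0. Qed.

Definition mulop (h : cinf M) : Dop := MkDop (mulop_subproof h).

Lemma dop_id_subproof : (fun f : cinf M => f) \in dop_pred.
Proof.
apply/dop_predP; exists 0; have := diff_order0 1; congr diff_order.
by apply/funext => f; rewrite mul1r.
Qed.

Lemma dop_comp_subproof (D E : Dop) : (fun f => D (E f)) \in dop_pred.
Proof.
case: D E => D /= /dop_predP[k hD] [E /= /dop_predP[k' hE]].
by apply/dop_predP; exists (k' + k)%N; exact: diff_order_comp.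
Qed.

Definition dop_comp (D E : Dop) : Dop := MkDop (dop_comp_subproof D E).

Lemma dop_compA : associative dop_comp.
Proof. by move=> D E F; exact: dop_ext. Qed.
Lemma dop_comp1l : left_id (MkDop dop_id_subproof) dop_comp.
Proof. by move=> D; exact: dop_ext. Qed.
Lemma dop_comp1r : right_id (MkDop dop_id_subproof) dop_comp.
Proof. by move=> D; exact: dop_ext. Qed.
Lemma dop_compDl : left_distributive dop_comp +%R.
Proof. by move=> D E F; exact: dop_ext. Qed.
Lemma dop_compDr : right_distributive dop_comp +%R.
Proof.
move=> D E F; apply: dop_ext => f /=.
by have := dop_linear D 1 (E f) (F f); rewrite !scale1r.
Qed.

HB.instance Definition _ := GRing.Zmodule_isPzRing.Build Dop
  dop_compA dop_comp1l dop_comp1r dop_compDl dop_compDr.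

Definition lie (D E : Dop) : Dop := D * E - E * D.

Definition lie_automorphism (F : {linear Dop -> Dop}) : Prop :=
  bijective F /\ forall D E, F (lie D E) = lie (F D) (F E).

Lemma push_subproof (phi : diffeo M) (D : Dop) :
  (fun f => precomp (diffeo_inv phi) (D (precomp phi f))) \in dop_pred.
Proof.
case: D => D /= /dop_predP[k hD].
by apply/dop_predP; exists k; exact: diff_order_push.
Qed.

Definition push (phi : diffeo M) (D : Dop) : Dop := MkDop (push_subproof phi D).

End DifferentialOperators.
Arguments Dop {R n} M.

Section Geometry.
Context {R : realType} {n : nat} (M : manifold R n).

(* Vector fields are identified with the operators they define on cinf M.
   xi is the coordinate expression of X in the chart i: X = xi^l d_l there *)
Definition vect_coords (X : Dop M) (i : idx M) (xi : 'rV[R]_n -> 'rV[R]_n) :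
    Prop :=
  smooth_on (rng i) xi /\
  forall (f : cinf M) x, rng i x ->
    X f (param i x) = \sum_l xi x 0 l * partial l (f \o param i) x.

Record vect := Vect {
  vop :> Dop M;
  _ : forall i, exists xi, vect_coords vop i xi
}.

Definition transition (i j : idx M) : 'rV[R]_n -> 'rV[R]_n :=
  chart j \o param i.

(* The density is dens i * |dx| in the chart i; in [jacobian f x], rows are
   indexed by the variables and columns by the components of f. *)
Record density := Density {
  dens :> idx M -> 'rV[R]_n -> R;
  dens_smooth : forall i, smooth_on (rng i) (dens i);
  dens_compat : forall i j x, rng i x -> dom j (param i x) ->
    dens i x =
    dens j (transition i j x) * `|\det (jacobian (transition i j) x)|
}.

Definition nowhere_vanishing (rho : density) : Prop :=
  forall i x, rng i x -> rho i x != 0.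

(* theta (t, y), defined for (t, y) in the neighborhood A of (0, x), is a local
   flow around x of the vector field with coordinates xi. *)
Definition local_flow (i : idx M) (xi : 'rV[R]_n -> 'rV[R]_n) (x : 'rV[R]_n)
    (theta : R * 'rV[R]_n -> 'rV[R]_n) : Prop :=
  exists A : set (R * 'rV[R]_n),
    [/\ open A, A (0, x), smooth_on A theta,
        forall t y, A (t, y) -> rng i (theta (t, y)) &
        (forall y, A (0, y) -> theta (0, y) = y) /\
        (forall t y, A (t, y) ->
           is_derive t 1 (fun u : R => theta (u, y)) (xi (theta (t, y))))].

(* L_X rho = g rho, where L_X rho is d/dt at t = 0 of the pullback of rho along
   the flow of X. *)
Definition lie_derivative_density (X : vect) (rho : density) (g : cinf M) :
    Prop :=
  forall i xi x, vect_coords X i xi -> rng i x ->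
  exists2 theta, local_flow i xi x theta &
    is_derive (0 : R) 1
      (fun t : R => rho i (theta (t, x)) *
                    `|\det (jacobian (fun y => theta (t, y)) x)|)
      (g (param i x) * rho i x).

Definition divergence (div : vect -> cinf M) : Prop :=
  exists (rho0 : density) (div0 : vect -> cinf M) (h : cinf M),
    [/\ nowhere_vanishing rho0,
        forall X, lie_derivative_density X rho0 (div0 X) &
        forall X : vect, div X = div0 X + X h].

Definition conjugation (div : vect -> cinf M) (C : {linear Dop M -> Dop M}) :
    Prop :=
  [/\ lie_automorphism C,
      forall f, C (mulop f) = - mulop f,
      forall X : vect, C X = (X : Dop M) + mulop (div X),
      forall D f, C (D * mulop f) = mulop f * C D &
      forall D (X : vect), C (D * (X : Dop M)) = - (C X * C D)].

(* the 1-form is (form i _ l) dx^l in the chart i *)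
Record closed_form := ClosedForm {
  form :> idx M -> 'rV[R]_n -> 'cV[R]_n;
  form_smooth : forall i, smooth_on (rng i) (form i);
  form_compat : forall i j x, rng i x -> dom j (param i x) ->
    form i x = jacobian (transition i j) x *m form j (transition i j x);
  form_closed : forall i k l x, rng i x ->
    partial k (fun y => form i y l 0) x = partial l (fun y => form i y k 0) x
}.

Definition form_eq (w w' : closed_form) : Prop :=
  forall i x, rng i x -> w i x = w' i x.

Definition is_primitive (w : closed_form) (U : set M) (f : M -> R) : Prop :=
  forall i x, rng i x -> U (param i x) ->
    forall l, w i x l 0 = partial l (f \o param i) x.

(* (D|_U g)(p) for p in an open set U and g smooth on U: by locality of D it is
   the value at p of D applied to any global smooth function that coincides
   with g near p. *)
Definition restr (D : Dop M) (g : M -> R) (p : M) : R :=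
  D (xget 0 [set h : cinf M | \forall q \near p, h q = g q]) p.

(* E|_U = [D|_U, f_U] whenever f_U is a primitive of w on U *)
Definition is_omega_bar (w : closed_form) (D E : Dop M) : Prop :=
  forall (U : set M) (f : M -> R), open U -> smooth_fun U f ->
    is_primitive w U f ->
  forall (g : M -> R) p, smooth_fun U g -> U p ->
    restr E g p = restr D (f \* g) p - f p * restr D g p.

Definition omega_bar (w : closed_form) (D : Dop M) : Dop M :=
  xget 0 [set E | is_omega_bar w D E].

(* The sum is over the finitely many k with a nonzero k-th term. *)
Definition exp_omega_bar (w : closed_form) (D : Dop M) : Dop M :=
  \sum_(k \in [set: nat]) (k`!%:R^-1 : R) *: iter k (omega_bar w) D.

End Geometry.

(* Main.v *)
Require Import Defs.
From HB Require Import structures.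
From mathcomp Require Import all_boot all_order all_algebra.
From mathcomp Require Import all_classical all_reals all_analysis.
From mathcomp Require Import zify ring lra.
Import Order.TTheory GRing.Theory Num.Theory.
Import numFieldNormedType.Exports.

Set Implicit Arguments.
Unset Strict Implicit.
Unset Printing Implicit Defensive.

Local Open Scope classical_set_scope.
Local Open Scope ring_scope.

(** A differential operator is locally ad-nilpotent only if it is multiplication
by a function: otherwise the leading coefficients, at a point, of its iterated
brackets with f are the coefficients of a nonconstant ring morphism from smooth
functions to real polynomials, but the invertible functions 1 + f^2 have constant
images.
Hence Phi maps functions to functions, by a linear bijection U, and it maps vector
fields to operators X' + c(X) with X' a vector field. Conjugating multiplications
by U, one finds operators which remain derivations after composition with
derivations; as finitely many X g generate the unit ideal, these operators are
multiplications, and U is a constant k times an automorphism of the algebra of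
smooth functions. By Milnor's argument, with a proper function, the latter is the
pullback by a diffeomorphism. Removing it, Phi multiplies functions by k, and
comparing the images of the operators X u X gives k^2 = 1; composing with C if
k = -1, we may assume k = 1. Then c is linear over functions and a cocycle, so it
is a closed 1-form w, and exp(-w) Phi fixes functions and vector fields, hence by
induction on the order all operators. *)

(** * Order and brackets *)

(** The algebraic part sees the manifold only through a few facts: operators have finite algebraic
    order, 1 + f^2 is invertible, functions killed by all derivations are constant, and the
    properties [full] and [framed]. The recurrent obstacle is to show that an additive quantity (a
    conjugated multiplication, the cocycle c, the error of an induction step) is linear over
    functions, while brackets only relate its values at different arguments. Polarizing such
    relations shows that the defect vanishes on multiples of some power (X g)^N, and [full] extends
    this to all arguments; N is whatever the computation costs. The operators X u X decide the sign
    because their brackets with v X + X v are again of this form up to a function, by a formula in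
    which X enters only through its brackets with functions. So it also holds for F X; comparing the
    two formulas, the function term is scaled by k in one and by k^-1 in the other. *)

Section Algebra.
Context {R : realType} {n : nat} (M : manifold R n).
Local Notation A := (cinf M).
Local Notation L := (Dop M).
Implicit Types (f g h u v : A) (D E F : L).

HB.instance Definition _ (D : L) :=
  GRing.isLinear.Build R A A *:%R D (dop_linear D).

Lemma dopE : (forall D E f, (D + E) f = D f + E f) *
  (forall D f, (- D) f = - D f) * (forall D E f, (D * E) f = D (E f)) *
  (forall (c : R) D f, (c *: D) f = c *: D f) *
  (forall g f, mulop g f = g * f) * (forall f, (0 : L) f = 0) *
  (forall f, (1 : L) f = f).
Proof. by do !split. Qed.

Lemma cinfE (p : M) : (forall f g, (f + g) p = f p + g p) *
  (forall f, (- f) p = - f p) * (forall f g, (f * g) p = f p * g p) *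
  (forall (c : R) f, (c *: f) p = c * f p) * ((0 : A) p = 0) *
  ((1 : A) p = 1).
Proof. by do !split. Qed.

Lemma cinfX (p : M) f k : (f ^+ k) p = f p ^+ k.
Proof. by elim: k => [|k IH]; rewrite ?expr0 // !exprS cinfE IH. Qed.

Lemma dop_sum (I : Type) (r : seq I) (D : I -> L) f :
  (\sum_(i <- r) D i) f = \sum_(i <- r) D i f.
Proof. by elim/big_rec2: _ => // i y D' _ <-. Qed.

Lemma cinf_sum (I : Type) (r : seq I) (f : I -> A) (p : M) :
  (\sum_(i <- r) f i) p = \sum_(i <- r) f i p.
Proof. by elim/big_rec2: _ => // i y g _ <-. Qed.

Lemma scaler_mull (c : R) f g : (c *: f) * g = c *: (f * g).
Proof. by apply: cinf_ext => p; rewrite !cinfE mulrA. Qed.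

Lemma scaler_mulr (c : R) f g : f * (c *: g) = c *: (f * g).
Proof. by rewrite mulrC scaler_mull mulrC. Qed.

Lemma dop_scale_mull (c : R) D E : (c *: D) * E = c *: (D * E).
Proof. exact: dop_ext. Qed.

Lemma dop_scale_mulr (c : R) D E : D * (c *: E) = c *: (D * E).
Proof. by apply: dop_ext => f; rewrite !dopE linearZ. Qed.

Lemma mulopD f g : mulop (f + g) = mulop f + mulop g.
Proof. by apply: dop_ext => h; rewrite !dopE mulrDl. Qed.

Lemma mulopN f : mulop (- f) = - mulop f.
Proof. by apply: dop_ext => h; rewrite !dopE mulNr. Qed.

Lemma mulopB f g : mulop (f - g) = mulop f - mulop g.
Proof. by rewrite mulopD mulopN. Qed.

Lemma mulopM f g : mulop (f * g) = mulop f * mulop g.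
Proof. by apply: dop_ext => h; rewrite !dopE mulrA. Qed.

Lemma mulop1 : mulop (1 : A) = 1.
Proof. by apply: dop_ext => h; rewrite !dopE mul1r. Qed.

Lemma mulop0 : mulop (0 : A) = 0.
Proof. by apply: dop_ext => h; rewrite !dopE mul0r. Qed.

Lemma mulopZ (c : R) f : mulop (c *: f) = c *: mulop f.
Proof. by apply: dop_ext => h; rewrite !dopE scaler_mull. Qed.

Lemma mulop_inj : injective (@mulop R n M).
Proof.
by move=> f g /(congr1 (fun D : L => D 1)); rewrite !dopE !mulr1.
Qed.

Lemma mulopC f g : mulop f * mulop g = mulop g * mulop f.
Proof. by rewrite -!mulopM mulrC. Qed.

Lemma lieDl D E F : lie (D + E) F = lie D F + lie E F.
Proof. by rewrite /lie mulrDl mulrDr opprD addrACA. Qed.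

Lemma lieNl D F : lie (- D) F = - lie D F.
Proof. by rewrite /lie mulNr mulrN opprB opprK addrC. Qed.

Lemma lieC D E : lie D E = - lie E D.
Proof. by rewrite /lie opprB. Qed.

Lemma lieDr D E F : lie F (D + E) = lie F D + lie F E.
Proof. by rewrite lieC lieDl opprD -!lieC. Qed.

Lemma lieBl D E F : lie (D - E) F = lie D F - lie E F.
Proof. by rewrite lieDl lieNl. Qed.

Lemma lieZl (c : R) D F : lie (c *: D) F = c *: lie D F.
Proof. by rewrite /lie dop_scale_mull dop_scale_mulr scalerBr. Qed.

Lemma lieZr (c : R) D F : lie F (c *: D) = c *: lie F D.
Proof. by rewrite lieC lieZl -scalerN -lieC. Qed.

Lemma lie0l F : lie 0 F = 0.
Proof. by rewrite /lie mulr0 mul0r subr0. Qed.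

Lemma lie0r F : lie F 0 = 0.
Proof. by rewrite lieC lie0l oppr0. Qed.

Lemma lie_mull D E F : lie (D * E) F = D * lie E F + lie D F * E.
Proof. by rewrite /lie mulrBr mulrBl !mulrA addrA subrK. Qed.

Lemma lie_mulr D E F : lie F (D * E) = D * lie F E + lie F D * E.
Proof. by rewrite lieC lie_mull opprD -mulrN -mulNr -!lieC. Qed.

(** Applied to f, composites of operators become atoms in the commutative ring of functions, where
    [ring] decides the identity; most operator identities below are checked in this way. *)
Lemma lie_jacobi D E F : lie (lie D E) F = lie D (lie E F) + lie (lie D F) E.
Proof.
apply: dop_ext => f; rewrite /lie.
rewrite ?(mulrBr, mulrBl) !dopE !raddfB /=; ring.
Qed.

Lemma lie_mulop_comm f g : lie (mulop f) (mulop g) = 0.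
Proof. by rewrite /lie mulopC subrr. Qed.

Definition derivation (X : A -> A) := forall f g, X (f * g) = X f * g + f * X g.

Lemma derivation1 D : derivation D -> D 1 = 0.
Proof.
by move=> /(_ 1 1); rewrite !mulr1 mul1r => /eqP; rewrite -subr_eq0 opprD addNKr
    oppr_eq0 => /eqP.
Qed.

Lemma lie_deriv D f : derivation D -> lie D (mulop f) = mulop (D f).
Proof. by move=> dD; apply: dop_ext => g; rewrite !dopE dD; ring. Qed.

Lemma derivation_mull f D : derivation D -> derivation (mulop f * D).
Proof. by move=> dD g h; rewrite !dopE dD; ring. Qed.

Lemma derivationD D E : derivation D -> derivation E -> derivation (D + E).
Proof. by move=> dD dE g h; rewrite !dopE dD dE; ring. Qed.

Lemma derivationN D : derivation D -> derivation (- D).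
Proof. by move=> dD g h; rewrite !dopE dD; ring. Qed.

Lemma derivation0 : derivation (0 : L).
Proof. by move=> g h; rewrite !dopE; ring. Qed.

Lemma derivation_lie D E : derivation D -> derivation E -> derivation (lie D E).
Proof.
by move=> dD dE g h; rewrite /lie !dopE dE dD !raddfD /= !dD !dE; ring.
Qed.

Lemma derivation_sum (I : Type) (r : seq I) (X : I -> L) :
  (forall i, derivation (X i)) -> derivation (\sum_(i <- r) X i).
Proof. by move=> dX; elim/big_ind: _ => //; [exact: derivation0|exact: derivationD]. Qed.

(* order < k in Grothendieck's algebraic sense *)
Fixpoint ordlt (k : nat) (D : L) : Prop :=
  if k is k'.+1 then forall f, ordlt k' (lie D (mulop f)) else D = 0.

Lemma ordlt0 k : ordlt k 0.
Proof. by elim: k => //= k IH f; rewrite lie0l. Qed.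

Lemma ordltD k D E : ordlt k D -> ordlt k E -> ordlt k (D + E).
Proof.
elim: k D E => [|k IH] D E /=; first by move=> -> ->; rewrite addr0.
by move=> oD oE f; rewrite lieDl; exact: IH.
Qed.

Lemma ordltN k D : ordlt k D -> ordlt k (- D).
Proof.
elim: k D => [|k IH] D /=; first by move=> ->; rewrite oppr0.
by move=> oD f; rewrite lieNl; exact: IH.
Qed.

Lemma ordltB k D E : ordlt k D -> ordlt k E -> ordlt k (D - E).
Proof. by move=> oD oE; apply: ordltD => //; exact: ordltN. Qed.

Lemma ordltZ k (c : R) D : ordlt k D -> ordlt k (c *: D).
Proof.
elim: k D => [|k IH] D /=; first by move=> ->; rewrite scaler0.
by move=> oD f; rewrite lieZl; exact: IH.
Qed.

Lemma ordlt_sum k (I : Type) (r : seq I) (D : I -> L) :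
  (forall i, ordlt k (D i)) -> ordlt k (\sum_(i <- r) D i).
Proof. by move=> oD; elim/big_ind: _ => //; [exact: ordlt0|exact: ordltD]. Qed.

Lemma ordltS k D : ordlt k D -> ordlt k.+1 D.
Proof.
elim: k D => [|k IH] D /=; first by move=> -> f; rewrite lie0l.
by move=> oD f; apply: IH; exact: oD.
Qed.

Lemma ordltW k l D : (k <= l)%N -> ordlt k D -> ordlt l D.
Proof.
by move=> /subnK <-; elim: (l - k)%N => //= d IH /IH; exact: ordltS.
Qed.

Lemma ordlt1P D : ordlt 1 D <-> D = mulop (D 1).
Proof.
split=> [/= oD|-> f]; last exact: lie_mulop_comm.
apply: dop_ext => f; have /(congr1 (fun E : L => E 1)) := oD f.
by rewrite !dopE !mulr1 => /subr0_eq ->; rewrite mulrC.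
Qed.

Lemma ordlt_mulop f : ordlt 1 (mulop f).
Proof. by move=> g /=; exact: lie_mulop_comm. Qed.

Lemma ordlt_deriv D : derivation D -> ordlt 2 D.
Proof. by move=> dD f; rewrite lie_deriv//; exact: ordlt_mulop. Qed.

Lemma ordlt2_deriv D : ordlt 2 D -> derivation (D - mulop (D 1)).
Proof.
move=> oD f g; have /ordlt1P := oD f.
move=> /(congr1 (fun E : L => E g)); rewrite /lie !dopE !mulr1 => e.
have {e} -> : D (f * g) = f * D g + (D f - f * D 1) * g.
  by rewrite -e mulrC; ring.
ring.
Qed.

(** Bounds are strict, so orders at most k - 1 and l - 1 add up to less than k + l - 1. The
    induction is on k + l, as each term of the Leibniz rule lowers the order of one factor and keeps
    the other. *)
Lemma ordltM k l D E : ordlt k D -> ordlt l E -> ordlt (k + l).-1 (D * E).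
Proof.
move: {2}(k + l)%N (leqnn (k + l)) => N.
elim: N k l D E => [|N IH] [|k] [|l] D E //= kl.
- by move=> -> _; rewrite mul0r.
- by move=> -> _; rewrite mul0r.
- by move=> -> _; rewrite mul0r; exact: ordlt0.
- by move=> _ ->; rewrite mulr0; exact: ordlt0.
move=> oD oE; rewrite addnS /= => f; rewrite lie_mull; apply: ordltD.
  by have := IH k.+1 l D _ _ oD (oE f); apply; lia.
have := IH k l.+1 _ E _ (oD f) oE; rewrite addnS; apply.
by move: kl; rewrite addSn addnS; lia.
Qed.

Lemma ordlt_lie k l D E : ordlt k D -> ordlt l E -> ordlt (k + l).-2 (lie D E).
Proof.
move: {2}(k + l)%N (leqnn (k + l)) => N.
elim: N k l D E => [|N IH] [|k] [|l] D E //= kl.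
- by move=> -> _; rewrite lie0l.
- by move=> -> _; rewrite lie0l.
- by move=> -> _; rewrite lie0l; exact: ordlt0.
- by move=> _ ->; rewrite lie0r; exact: ordlt0.
move=> oD oE; rewrite addnS /=.
(* The subtraction of 2 is truncated, so factors of order 0 are treated apart: for them one term of
   the Jacobi identity vanishes because functions commute. *)
case: k l => [|k] [|l] in kl oD oE *.
- by have /ordlt1P -> := oD; have /ordlt1P -> := oE; exact: lie_mulop_comm.
- move=> f /=; rewrite lie_jacobi (_ : lie D (mulop f) = 0) ?lie0l ?addr0; last exact: oD.
  by have := IH 1%N l.+1 D _ _ oD (oE f); apply; lia.
- move=> f /=; rewrite lie_jacobi (_ : lie E (mulop f) = 0) ?lie0r ?add0r; last exact: oE.
  by have := IH k.+1 1%N _ E _ (oD f) oE; rewrite !addn1 addn0; apply; lia.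
rewrite addSn => f /=; rewrite lie_jacobi; apply: ordltD.
  have := IH k.+2 l.+1 D _ _ oD (oE f).
  by rewrite (_ : (k.+2 + l.+1).-2 = (k + l.+1)%N) //; apply; lia.
have := IH k.+1 l.+2 _ E _ (oD f) oE.
by rewrite (_ : (k.+1 + l.+2).-2 = (k + l.+1)%N); [apply|]; lia.
Qed.

Lemma ordlt_mull k f D : ordlt k D -> ordlt k (mulop f * D).
Proof. by move=> oD; exact: (ordltM (ordlt_mulop f) oD). Qed.

Lemma ordlt_mulr k f D : ordlt k D -> ordlt k (D * mulop f).
Proof. by move=> oD; have := ordltM oD (ordlt_mulop f); rewrite addn1. Qed.

Lemma ordlt_derivl k D E : derivation D -> ordlt k E -> ordlt k.+1 (D * E).
Proof. by move=> dD oE; exact: (ordltM (ordlt_deriv dD) oE). Qed.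

Definition adf (f : A) (D : L) : L := lie D (mulop f).

Lemma adf_comm f g D : adf f (adf g D) = adf g (adf f D).
Proof. by rewrite /adf lie_jacobi lie_mulop_comm lie0r add0r. Qed.

Lemma ordlt_adf k f D : ordlt k D -> ordlt k.-1 (adf f D).
Proof. by case: k => [/= ->|k oD]; [rewrite /adf lie0l|exact: oD]. Qed.

Lemma ordlt_iter_adf k r f D : ordlt k D -> ordlt (k - r) (iter r (adf f) D).
Proof.
by elim: r => [|r IH] oD; rewrite ?subn0// subnS; exact/ordlt_adf/IH.
Qed.

Lemma iter_adf_zero k r f D : (k <= r)%N -> ordlt k D -> iter r (adf f) D = 0.
Proof.
by move=> kr /(ordlt_iter_adf r f); rewrite (eqP (_ : k - r == 0)%N)// subn_eq0.
Qed.

Lemma iter_adf_comm r f g D : iter r (adf f) (adf g D) = adf g (iter r (adf f) D).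
Proof. by elim: r => //= r ->; exact: adf_comm. Qed.

(** A nonzero polynomial p would have the size p distinct roots 0, ..., size p - 1, more than its
    degree. *)
Lemma poly_fun_eq0 k (a : 'I_k -> R) :
  (forall t : R, \sum_(i < k) a i * t ^+ i = 0) -> forall i, a i = 0.
Proof.
move=> a0 i; pose p : {poly R} := \poly_(j < k) (if insub j is Some l then a l else 0).
have pE t : p.[t] = 0.
  rewrite horner_poly -[RHS](a0 t); apply: eq_bigr => j _; congr (_ * _).
  by rewrite valK.
have p0 : p = 0.
  apply/eqP; apply: contraT => pn0.
  have := max_poly_roots pn0 (rs := [seq j%:R | j <- iota 0 (size p)]).
  rewrite size_map size_iota ltnn => ->//.
    by apply/allP => _ /mapP[j _ ->]; rewrite /root pE.
  by rewrite map_inj_uniq ?iota_uniq// => x y /eqP; rewrite eqr_nat => /eqP.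
have := congr1 (fun q : {poly R} => q`_i) p0.
by rewrite coef_poly coef0 ltn_ord valK.
Qed.

Lemma adfD f D E : adf f (D + E) = adf f D + adf f E.
Proof. exact: lieDl. Qed.

Lemma adfZ f (c : R) D : adf f (c *: D) = c *: adf f D.
Proof. exact: lieZl. Qed.

Lemma adf0 f : adf f 0 = 0.
Proof. exact: lie0l. Qed.

Lemma adfDf f g D : adf (f + g) D = adf f D + adf g D.
Proof. by rewrite /adf mulopD lieDr. Qed.

Lemma adfZf (c : R) f D : adf (c *: f) D = c *: adf f D.
Proof. by rewrite /adf mulopZ lieZr. Qed.

Lemma adf_sum f (I : Type) (r : seq I) (D : I -> L) :
  adf f (\sum_(i <- r) D i) = \sum_(i <- r) adf f (D i).
Proof. exact: (big_morph _ (adfD f) (adf0 f)). Qed.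

Lemma iter_adf_expand r f g E : exists c : nat -> L,
  [/\ forall t : R, iter r (adf (f + t *: g)) E = \sum_(i < r.+1) t ^+ i *: c i,
      c 0%N = iter r (adf f) E, c 1%N = r%:R *: adf g (iter r.-1 (adf f) E) &
      forall i, (r < i)%N -> c i = 0].
Proof.
elim: r => [|r [c [cE c0 c1 cr]]].
  exists (fun i => if i is 0%N then E else 0); split=> //.
  - by move=> t; rewrite big_ord1 expr0 scale1r.
  - by rewrite scale0r.
  - by case.
exists (fun i => adf f (c i) + (if i is j.+1 then adf g (c j) else 0)); split.
- move=> t; rewrite iterS cE adfDf adfZf !adf_sum.
  under [RHS]eq_bigr do rewrite /= scalerDr.
  rewrite [RHS]big_split/=; congr (_ + _).
    rewrite [RHS]big_ord_recr /= cr// adf0 scaler0 addr0.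
    by apply: eq_bigr => i _; rewrite adfZ.
  rewrite [RHS]big_ord_recl /= scaler0 add0r scaler_sumr.
  by apply: eq_bigr => i _; rewrite adfZ scalerA -exprS.
- by rewrite addr0 c0.
- rewrite c1 c0 adfZ /=; case: r {cE c0 c1 cr} => [|r].
    by rewrite scale0r add0r scale1r.
  rewrite [adf f (adf g _)]adf_comm /= -[X in _ + X]scale1r -scalerDl.
  by rewrite -[in RHS]addn1 natrD.
- move=> [|i] //= ri; rewrite !cr ?adf0 ?addr0//; exact: ltnW.
Qed.

(** Polarization: the iterated brackets of E with functions are symmetric and multilinear, hence
    determined by the diagonal. The coefficient of t in the brackets with f + t g is isolated by
    evaluating at a function and a point, which leaves a real polynomial in t. *)
Lemma ordlt_polar r E : ordlt r.+1 E ->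
  (forall f, iter r (adf f) E = 0) -> ordlt r E.
Proof.
elim: r E => [|r IH] E oE E0; first exact: (E0 0).
move=> g; apply: IH (oE g) _ => f; rewrite -/(adf g E) iter_adf_comm.
have [c [cE _ c1 _]] := iter_adf_expand r.+1 f g E.
have {c1} -> : adf g (iter r (adf f) E) = r.+1%:R^-1 *: c 1%N.
  by rewrite c1 scalerA mulVf ?scale1r// pnatr_eq0.
suff -> : c 1%N = 0 by rewrite scaler0.
apply: dop_ext => h; apply: cinf_ext => p.
have H := @poly_fun_eq0 r.+2 (fun i => c i h p) _ (Ordinal (isT : 1 < r.+2)%N).
apply: H => t; have := congr1 (fun D : L => D h p) (cE t); rewrite E0 => e.
rewrite -[RHS]/((0 : L) h p) e dop_sum cinf_sum.
by apply: eq_bigr => i _; rewrite mulrC.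
Qed.

(** Stated for any biadditive [op], to serve for [adf] and [lie D] on products and for [omega_bar]
    on Lie brackets. *)
Lemma iter_leibniz (V : zmodType) (op : V -> V -> V) (d : V -> V) r x y :
  (forall x y z, op (x + y) z = op x z + op y z) ->
  (forall x y z, op z (x + y) = op z x + op z y) ->
  (forall x y, d (x + y) = d x + d y) ->
  (forall x y, d (op x y) = op (d x) y + op x (d y)) ->
  iter r d (op x y) =
  \sum_(i < r.+1) (op (iter i d x) (iter (r - i) d y)) *+ 'C(r, i).
Proof.
move=> opl opr dD dop.
have d0 : d 0 = 0 by apply: (addrI (d 0)); rewrite -dD !addr0.
have dMn z k : d (z *+ k) = d z *+ k.
  by elim: k => [|k IH]; rewrite ?mulr0n// !mulrS dD IH.
elim: r => [|r IH]; first by rewrite big_ord1 bin0 mulr1n subn0.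
rewrite iterS IH (big_morph d dD d0).
under eq_bigr => i _ do rewrite dMn dop mulrnDl.
rewrite big_split/= addrC.
have E1 : \sum_(i < r.+1) op (iter i d x) (d (iter (r - i) d y)) *+ 'C(r, i) =
  \sum_(i < r.+2) op (iter i d x) (iter (r.+1 - i) d y) *+ 'C(r, i).
  rewrite [RHS]big_ord_recr/= bin_small// mulr0n addr0.
  by apply: eq_bigr => i _; rewrite subSn// -ltnS.
have E2 : \sum_(i < r.+1) op (d (iter i d x)) (iter (r - i) d y) *+ 'C(r, i) =
  \sum_(i < r.+2) op (iter i d x) (iter (r.+1 - i) d y) *+
     (if (i : nat) is j.+1 then 'C(r, j) else 0).
  rewrite [RHS]big_ord_recl/= mulr0n add0r.
  by apply: eq_bigr => i _; rewrite subSS.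
rewrite E1 E2 -big_split/=; apply: eq_bigr => -[[|i] ilt] _ /=.
  by rewrite mulr0n addr0 !bin0.
by rewrite -mulrnDr binS addnC.
Qed.

End Algebra.

(** * Locally ad-nilpotent operators *)

Section Nil.
Context {R : realType} {n : nat} (M : manifold R n).
Local Notation A := (cinf M).
Local Notation L := (Dop M).
Implicit Types (f g h u v : A) (D E F : L).

Lemma lie1r D : lie D 1 = 0.
Proof. by rewrite /lie mulr1 mul1r subrr. Qed.

Lemma adf1 D : adf 1 D = 0.
Proof. by rewrite /adf mulop1 lie1r. Qed.

Lemma iter_lie0 k D : iter k (lie D) 0 = 0.
Proof. by elim: k => //= k ->; exact: lie0r. Qed.

Lemma iter_adf0 k f : iter k (adf f) 0 = 0.
Proof. by elim: k => //= k ->; exact: adf0. Qed.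

Lemma adf_mull f g D : adf g (mulop f * D) = mulop f * adf g D.
Proof. by rewrite /adf lie_mull lie_mulop_comm mul0r addr0. Qed.

Lemma adf_mulr f g D : adf g (D * mulop f) = adf g D * mulop f.
Proof. by rewrite /adf lie_mull lie_mulop_comm mulr0 add0r. Qed.

(** Every other term of the Leibniz expansion brackets one of the factors more often than its order
    allows. *)
Lemma iter_adf_top r s g D E : ordlt r.+1 D -> ordlt s.+1 E ->
  iter (r + s) (adf g) (D * E) =
  (iter r (adf g) D * iter s (adf g) E) *+ 'C(r + s, r).
Proof.
move=> oD oE.
rewrite (@iter_leibniz L *%R) //=; [|exact: mulrDl| |exact: adfD|]; last first.
- by move=> x y; rewrite /adf lie_mull addrC.
- by move=> x y z; rewrite mulrDr.
have rlt : (r < (r + s).+1)%N by rewrite ltnS leq_addr.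
rewrite (bigD1 (Ordinal rlt))//= addKn big1 ?addr0// => i.
rewrite -val_eqE /= => ir; have [ri|ri|/eqP] := ltngtP r i; last first.
- by rewrite eq_sym (negPf ir).
- rewrite (iter_adf_zero g _ oE) ?mulr0 ?mul0rn//.
  by move: (ltn_ord i); lia.
- by rewrite (iter_adf_zero g ri oD) mul0r mul0rn.
Qed.

(** The polynomials with coefficients a_i / i! and b_i / i! have a constant product, so both are
    constant: if m and l are the last indices with nonzero coefficients, the coefficient at m + l of
    the product is nonzero. *)
Lemma binomial_conv_unit (a b : nat -> R) :
  (exists K, forall i, (K <= i)%N -> a i = 0) ->
  (exists K, forall i, (K <= i)%N -> b i = 0) ->
  a 0%N != 0 -> b 0%N != 0 ->
  (forall N, (0 < N)%N -> \sum_(i < N.+1) a i * b (N - i)%N *+ 'C(N, i) = 0) ->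
  a 1%N = 0.
Proof.
move=> [K aK] [K' bK] a0 b0 ab.
have bnd (c : nat -> R) k0 : (forall i, (k0 <= i)%N -> c i = 0) ->
    forall i, c i != 0 -> (i <= k0)%N.
  move=> ck i; apply: contraNT; rewrite -ltnNge => /ltnW /ck ->; exact: eqxx.
case: (ex_maxnP (ex_intro (fun i => a i != 0) _ a0) (bnd _ _ aK)) => m am mmax.
case: (ex_maxnP (ex_intro (fun i => b i != 0) _ b0) (bnd _ _ bK)) => l bl lmax.
have [m0|m0] := posnP m.
  apply/eqP; apply: contraT => /mmax; rewrite m0.
  by [].
have mlt : (m < (m + l).+1)%N by rewrite ltnS leq_addr.
have := ab (m + l)%N; rewrite addn_gt0 m0 => /(_ isT).
rewrite (bigD1 (Ordinal mlt))//= addKn big1 ?addr0 => [/eqP|i].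
  by rewrite -mulr_natr !mulf_eq0 (negPf am) (negPf bl) pnatr_eq0 -leqn0 leqNgt bin_gt0
      leq_addr.
rewrite -val_eqE /= => im; have [mi|im'|/eqP] := ltngtP m i; last first.
- by rewrite eq_sym (negPf im).
- rewrite [b _](_ : _ = 0) ?mulr0 ?mul0rn//; apply/eqP.
  by apply: contraT => /lmax; move: (ltn_ord i); lia.
- rewrite [a i](_ : _ = 0) ?mul0r ?mul0rn//; apply/eqP.
  by apply: contraT => /mmax; lia.
Qed.

Definition locnil D := forall E, exists k, iter k (lie D) E = 0.

Section Fixed.
Variables (k : nat) (D : L) (g : A) (p : M).
Hypotheses (oD : ordlt k.+2 D) (nD : locnil D).

Lemma ordlt_iter_lie i f : ordlt (i * k).+1 (iter i (lie D) (mulop f)).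
Proof.
elim: i => [|i IH]; first exact: ordlt_mulop.
rewrite iterS (_ : (i.+1 * k).+1 = (k.+2 + (i * k).+1).-2); last by lia.
exact: ordlt_lie.
Qed.

(** The symbol of degree i k of (ad D)^i f at the covector dg at p; [ordlt_iter_lie] bounds the
    order by this degree. Bracketing i k times with g gives (i k)! times the symbol, whence the
    normalization, which makes symbols multiplicative. *)
Let chi i f : R := ((i * k)`!%:R)^-1 *
  (iter (i * k) (adf g) (iter i (lie D) (mulop f))) 1 p.

Let top i f :=
  iter (i * k) (adf g) (iter i (lie D) (mulop f)).

Lemma topE i f : top i f = mulop (top i f 1).
Proof.
by apply/ordlt1P; have := ordlt_iter_adf (i * k) g (ordlt_iter_lie i f); rewrite subSnn.
Qed.

(* Thus f |-> \sum_i chi i f t^i / i! is a ring morphism into polynomials in t (by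
   chi_fin), and invertible functions have constant images. *)
Lemma chi_mul N u v :
  chi N (u * v) = \sum_(i < N.+1) chi i u * chi (N - i)%N v *+ 'C(N, i).
Proof.
rewrite /chi mulopM (@iter_leibniz L *%R (lie D)); last first.
- by move=> x y; rewrite lie_mulr addrC.
- by move=> x y; rewrite lieDr.
- by move=> x y z; rewrite mulrDr.
- exact: mulrDl.
rewrite -[iter (N * k) _ _]/(iter (N * k) (adf g) _).
have itD r (I : Type) (s : seq I) (E : I -> L) :
    iter r (adf g) (\sum_(i <- s) E i) = \sum_(i <- s) iter r (adf g) (E i).
  by elim: r => //= r ->; rewrite adf_sum.
have itMn r (E : L) j : iter r (adf g) (E *+ j) = iter r (adf g) E *+ j.
  elim: r => //= r ->; elim: j => [|j IH]; first by rewrite !mulr0n adf0.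
  by rewrite !mulrS adfD IH.
rewrite itD dop_sum cinf_sum mulr_sumr; apply: eq_bigr => i _.
rewrite itMn; have iN : (i <= N)%N by rewrite -ltnS.
have -> : (N * k)%N = (i * k + (N - i) * k)%N by rewrite -mulnDl subnKC.
rewrite (iter_adf_top _ (ordlt_iter_lie i u) (ordlt_iter_lie (N - i) v)).
rewrite -/(top i u) -/(top (N - i) v) [top i u]topE [top (N - i) v]topE.
set a := top i u 1; set b := top (N - i) v 1.
have dMn (E : L) j f : (E *+ j) f p = E f p *+ j.
  by elim: j => [|j IH]; rewrite ?mulr0n // !mulrS -IH.
rewrite !dMn !dopE !cinfE mulr1 -!mulrnAr.
set x := a p; set y := b p; rewrite !mulr1.
have bf := bin_fact (leq_addr ((N - i) * k) (i * k)); rewrite addKn in bf.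
have := bin_gt0 (i * k + (N - i) * k) (i * k); rewrite leq_addr.
have mn (z : R) j : z *+ j = z * j%:R by rewrite mulr_natr.
rewrite -bf !natrM ![y *+ _]mn [y * _ *+ _]mn lt0n -(pnatr_eq0 R).
have := fact_gt0 (i * k); rewrite lt0n -(pnatr_eq0 R).
have := fact_gt0 ((N - i) * k); rewrite lt0n -(pnatr_eq0 R).
move: ('C(N, i)%:R : R) ('C(_, _)%:R : R) (((i * k)`!)%:R : R) => c c' F1.
move: ((_`!)%:R : R) => F2 F20 F10 c'0; field.
by rewrite F10 F20 c'0.
Qed.

Lemma chi_fin f : exists K, forall i, (K <= i)%N -> chi i f = 0.
Proof.
have [K DK] := nD (mulop f); exists K => i Ki.
rewrite /chi (_ : iter i (lie D) _ = 0); last first.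
  by rewrite -(subnK Ki) iterD DK iter_lie0.
by rewrite iter_adf0 dopE cinfE mulr0.
Qed.

Lemma chi_unit u v : u * v = 1 -> chi 1 u = 0.
Proof.
move=> uv; have c0 f : chi 0 f = f p by rewrite /chi mul0n fact0 invr1 mul1r /= mulr1.
have uvp : u p * v p = 1 by rewrite -cinfE uv.
have H := @binomial_conv_unit (chi^~ u) (chi^~ v) (chi_fin u) (chi_fin v).
apply: H.
- by rewrite c0; apply/eqP => u0; move: uvp; rewrite u0 mul0r => /esym/eqP; rewrite
    oner_eq0.
- by rewrite c0; apply/eqP => u0; move: uvp; rewrite u0 mulr0 => /esym/eqP; rewrite
    oner_eq0.
move=> N N0; rewrite -chi_mul uv /chi mulop1.
have -> : iter N (lie D) 1 = 0.
  by rewrite -(prednK N0) iterSr lie1r iter_lie0.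
by rewrite iter_adf0 dopE cinfE mulr0.
Qed.

End Fixed.

Hypothesis unit_sqr : forall f, exists v, (1 + f ^+ 2) * v = 1.

(** The order is lowered one step at a time. For fixed g and p, the map taking f to the value at p
    of (ad g)^k [D, f] is a derivation and, up to a factor, the coefficient [chi 1] of f, so it
    kills 1 + f^2. Once it is zero, f = g gives what [ordlt_polar] asks for. *)
Lemma locnil_ordlt1 D k : ordlt k D -> locnil D -> ordlt 1 D.
Proof.
case: k => [/=->|k]; first by move=> _; exact: (ordlt0 _ 1).
elim: k => // k IH oD nD; apply: IH => //; apply: ordlt_polar => // g.
have tp (f : A) : iter k (adf g) (adf f D) = mulop (iter k (adf g) (adf f D) 1).
  apply/ordlt1P; have := ordlt_iter_adf k g (ordlt_adf f oD).
  by rewrite /= subSnn.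
have add (f f' : A) : iter k (adf g) (adf (f + f') D) = iter k (adf g) (adf f D) + iter
    k (adf g) (adf f' D).
  by rewrite adfDf; elim: k {oD tp} => //= k ->; rewrite adfD.
have dtop (f f' : A) : iter k (adf g) (adf (f * f') D) = mulop f * iter k (adf g) (adf
    f' D) + iter k (adf g) (adf f D) * mulop f'.
  have -> : adf (f * f') D = mulop f * adf f' D + adf f D * mulop f'.
    by rewrite /adf mulopM lie_mulr.
  by elim: k {oD tp add} => //= k ->; rewrite adfD adf_mull adf_mulr.
have unit0 (f : A) (p : M) : iter k (adf g) (adf (1 + f ^+ 2) D) 1 p = 0.
  have [v fv] := unit_sqr f; have := chi_unit g p oD nD fv.
  rewrite mul1n /= => /eqP; rewrite mulf_eq0 invr_eq0 pnatr_eq0 -leqn0 leqNgt fact_gt0 /=.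
  by move=> /eqP; rewrite -/(adf (1 + f ^+ 2) D).
have key (f : A) : iter k (adf g) (adf f D) 1 = 0.
  apply: cinf_ext => p.
  have tpv (f' h : A) : iter k (adf g) (adf f' D) h = iter k (adf g) (adf f' D) 1 * h.
    by rewrite {1}tp dopE.
  have e (f' : A) : (2%:R * f' p) * iter k (adf g) (adf f' D) 1 p = 0.
    have := unit0 f' p; rewrite expr2 add dtop adf1 iter_adf0 add0r !dopE mulr1.
    by rewrite (tpv f' f') !cinfE => <-; ring.
  (* The functions f and f + 1 have the same image, and they do not both vanish at p. *)
  have := e (f + 1); rewrite add adf1 iter_adf0 addr0 !cinfE => e1; have e2 := e f.
  by lra.
by rewrite iterSr tp key mulop0.
Qed.

End Nil.

(** * Action of automorphisms on functions *)

Section Aut.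
Context {R : realType} {n : nat} (M : manifold R n).
Local Notation A := (cinf M).
Local Notation L := (Dop M).
Implicit Types (f g h u v : A) (D E X Y : L).

Lemma cinf_sqr0 f : f * f = 0 -> f = 0.
Proof.
move=> f0; apply: cinf_ext => p; have := congr1 (fun g : A => g p) f0.
by rewrite !cinfE => /eqP; rewrite mulf_eq0 orbb => /eqP.
Qed.

Lemma cinf_double0 f : f + f = 0 -> f = 0.
Proof.
move=> f0; apply: cinf_ext => p; have := congr1 (fun g : A => g p) f0.
by rewrite !cinfE; lra.
Qed.

Lemma polar_defect X (b : A -> A -> A) : derivation X ->
  (forall f g h, b f (g + h) = b f g + b f h) ->
  (forall f g h, b (f * g) h = b f (g * h) + f * b g h) ->
  (forall u f g, b f (u * X g) + b g (u * X f) = 0) ->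
  forall f g h, b f (h * X g ^+ 2) = 0.
Proof.
move=> dX bD bM bX f g h.
have step f' u g1 g2 : b f' (u * g1 * X g2) = g1 * b f' (u * X g2).
  have := bX u f' (g1 * g2); rewrite dX bM mulrDr bD.
  have := bX (u * g2) f' g1; have := bX u f' g2.
  rewrite (_ : u * (X g1 * g2) = u * g2 * X g1); last by ring.
  rewrite (_ : u * (g1 * X g2) = u * g1 * X g2); last by ring.
  rewrite (_ : g2 * (u * X f') = u * g2 * X f'); last by ring.
  move=> /addr0_eq <- /addr0_eq <- e.
  by apply/eqP; rewrite -subr_eq0 -[X in _ == X]e; apply/eqP; ring.
set a := X g.
have ba f' h' : b f' (h' * a) = h' * b f' a.
  by have := step f' 1 h' g; rewrite !mul1r.
have rel g' : X g' * b f a + X f * b g' a = 0.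
  have := bX a f g'; rewrite [a * X g']mulrC [a * X f]mulrC.
  by rewrite !ba.
have Xf0 : X f * b f a = 0 by exact: cinf_double0 (rel f).
have aba : a * b f a = 0.
  apply: cinf_sqr0.
  transitivity (b f a * a * (X g * b f a + X f * b g a) - (X f * b f a) * (a * b g a)).
    by rewrite -/a; ring.
  by rewrite rel Xf0; ring.
rewrite -/a expr2 mulrA ba.
by transitivity (h * (a * b f a)); [ring|rewrite aba mulr0].
Qed.

(* Holds because finitely many functions suffice to have no common critical point
   (manifold_full). *)
Definition full := forall N (P : A -> Prop), P 0 ->
  (forall f g, P f -> P g -> P (f + g)) ->
  (forall X g h, derivation X -> P (h * X g ^+ N)) -> forall h, P h.

(** The defect is the commutator of T with f; its skew-symmetry is the Leibniz rule for T composed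
    with u X. *)
Lemma comp_deriv_linear (T : A -> A) : full ->
  (forall f g, T (f + g) = T f + T g) ->
  (forall X, derivation X -> derivation (fun f => T (X f))) ->
  forall f g, T (f * g) = f * T g.
Proof.
move=> Mfull TD TX f g; apply/eqP; rewrite -subr_eq0; apply/eqP.
pose b f' h := T (f' * h) - f' * T h.
have bD f' h1 h2 : b f' (h1 + h2) = b f' h1 + b f' h2.
  by rewrite /b !mulrDr !TD; ring.
move: g; apply: (Mfull 2%N (fun h => b f h = 0)).
- have := bD f 0 0; rewrite addr0 => /eqP.
  by rewrite -subr_eq0 opprD addNKr oppr_eq0 => /eqP.
- by move=> h1 h2; rewrite bD => -> ->; rewrite addr0.
move=> X g h dX; apply: polar_defect => //.
- by move=> f1 f2 h'; rewrite /b !mulrA; ring.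
- move=> u f1 f2; have := TX _ (derivation_mull u dX) f1 f2.
  rewrite !dopE dX mulrDr TD.
  rewrite (_ : u * (X f1 * f2) = f2 * (u * X f1)); last by ring.
  rewrite (_ : u * (f1 * X f2) = f1 * (u * X f2)); last by ring.
  by rewrite /b => /eqP; rewrite -subr_eq0 => /eqP e; rewrite -[RHS]e; ring.
Qed.

(** A predicate on bare maps, so that composites and inverses need no [{linear _ -> _}]
    structure. *)
Definition lieaut (F : L -> L) :=
  [/\ linear F, bijective F & forall D E, F (lie D E) = lie (F D) (F E)].

Section LieautTheory.
Variables (F : L -> L).
Hypothesis autF : lieaut F.

Lemma lieaut_linear : linear F. Proof. by case: autF. Qed.

Lemma lieautD D E : F (D + E) = F D + F E.
Proof. by have := lieaut_linear 1 D E; rewrite !scale1r. Qed.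

Lemma lieaut0 : F 0 = 0.
Proof. by apply: (addrI (F 0)); rewrite -lieautD !addr0. Qed.

Lemma lieautZ (c : R) D : F (c *: D) = c *: F D.
Proof. by have := lieaut_linear c D 0; rewrite lieaut0 !addr0. Qed.

Lemma lieautN D : F (- D) = - F D.
Proof. by rewrite -scaleN1r lieautZ scaleN1r. Qed.

Lemma lieautB D E : F (D - E) = F D - F E.
Proof. by rewrite lieautD lieautN. Qed.

Lemma lieaut_lie D E : F (lie D E) = lie (F D) (F E).
Proof. by case: autF. Qed.

Lemma lieaut_inj : injective F.
Proof. by case: autF => _ /bij_inj. Qed.

Lemma lieaut_inv G : cancel F G -> cancel G F -> lieaut G.
Proof.
move=> FG GF; split; last by move=> D E; apply: lieaut_inj; rewrite lieaut_lie !GF.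
  by move=> c D E; apply: lieaut_inj; rewrite lieautD lieautZ !GF.
by exists F.
Qed.

Lemma lieaut_iter k D E : F (iter k (lie D) E) = iter k (lie (F D)) (F E).
Proof. by elim: k => //= k IH; rewrite lieaut_lie IH. Qed.

Lemma lieaut_locnil D : locnil D -> locnil (F D).
Proof.
have [_ [G FG GF] _] := autF => nD E; have [k Dk] := nD (G E); exists k.
by rewrite -[E]GF -lieaut_iter Dk lieaut0.
Qed.

End LieautTheory.

Lemma lieaut_comp F G : lieaut F -> lieaut G -> lieaut (F \o G).
Proof.
move=> aF aG; split=> [c D E||D E] /=.
- by rewrite (lieautD aG) (lieautZ aG) (lieautD aF) (lieautZ aF).
- by case: aF aG => _ bF _ [_ bG _]; exact: bij_comp.
- by rewrite (lieaut_lie aG) (lieaut_lie aF).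
Qed.

Lemma mulop_locnil f : (forall D, exists k, ordlt k D) -> locnil (mulop f).
Proof.
move=> fin E; have [k oE] := fin E; exists k.
have H j D : iter j (lie (mulop f)) D = (-1) ^+ j *: iter j (adf f) D.
  elim: j => [|j IH]; first by rewrite scale1r.
  by rewrite !iterS IH lieZr lieC scalerN /adf exprS -scalerA scaleN1r.
by rewrite H (iter_adf_zero f (leqnn k)) ?scaler0.
Qed.

Section Structure.
Hypothesis Mfull : full.
Hypothesis Mfin : forall D, exists k, ordlt k D.
Hypothesis Msqr : forall f, exists v, (1 + f ^+ 2) * v = 1.
Hypothesis Mconst : forall f, (forall X, derivation X -> X f = 0) ->
  exists c : R, f = c *: (1 : A).

Definition on_functions (F : L -> L) f : A := F (mulop f) 1.

Lemma on_functionsE F f : lieaut F -> F (mulop f) = mulop (on_functions F f).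
Proof.
move=> aF; apply/ordlt1P; have [k oF] := Mfin (F (mulop f)).
apply: (locnil_ordlt1 Msqr oF); apply: lieaut_locnil => //.
exact: mulop_locnil.
Qed.

Lemma on_functionsK F G : lieaut F -> cancel F G -> cancel G F ->
  cancel (on_functions F) (on_functions G).
Proof.
move=> aF FG GF f; rewrite {1}/on_functions -on_functionsE// FG.
by rewrite dopE mulr1.
Qed.

Lemma on_functionsD F f g : lieaut F ->
  on_functions F (f + g) = on_functions F f + on_functions F g.
Proof. by move=> aF; rewrite /on_functions mulopD (lieautD aF). Qed.

Lemma lieaut_ordlt F k D : lieaut F -> ordlt k D -> ordlt k (F D).
Proof.
move=> aF; have [_ [G FG GF] _] := aF; have aG := lieaut_inv aF FG GF.
elim: k D => [|k IH] D /=; first by move=> ->; exact: lieaut0.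
move=> oD f; rewrite -[mulop f]GF on_functionsE// -(lieaut_lie aF).
exact: IH.
Qed.

Definition deriv_part D : L := D - mulop (D 1).

Lemma deriv_part_deriv D : ordlt 2 D -> derivation (deriv_part D).
Proof. exact: ordlt2_deriv. Qed.

Lemma on_functions_deriv F X f : lieaut F -> derivation X ->
  on_functions F (X f) = deriv_part (F X) (on_functions F f).
Proof.
move=> aF dX; apply: mulop_inj; rewrite -on_functionsE// -lie_deriv//.
have dFX : derivation (deriv_part (F X)).
  by apply: deriv_part_deriv; apply: lieaut_ordlt => //; exact: ordlt_deriv.
rewrite (lieaut_lie aF) on_functionsE// -(lie_deriv _ dFX).
by rewrite /deriv_part lieBl lie_mulop_comm subr0.
Qed.

(* T h = U (f U^-1 h), composed with any derivation, is again a derivation, so T is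
   linear over functions by comp_deriv_linear. *)
Lemma on_functions_mul F (p0 : M) : lieaut F -> exists2 k : R, k != 0 &
  on_functions F 1 = k *: (1 : A) /\ forall f g,
    k *: on_functions F (f * g) = on_functions F f * on_functions F g.
Proof.
move=> aF; have [_ [G FG GF] _] := aF; have aG := lieaut_inv aF FG GF.
set U := on_functions F; set U' := on_functions G.
have UK : cancel U' U by exact: on_functionsK.
have UK' : cancel U U' by exact: on_functionsK.
(* The unit is central, hence so is its image under F, and U 1 is killed by every derivation. *)
have [k Uk] : exists k : R, U 1 = k *: (1 : A).
  apply: Mconst => X dX; apply: mulop_inj; rewrite -lie_deriv// -on_functionsE//.
  by rewrite -[X]GF -(lieaut_lie aF) mulop1 lie1r mulop0 (lieaut0 aF).
exists k.
  apply/eqP => k0; move: Uk; rewrite k0 scale0r => U0.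
  have : (1 : A) p0 = (0 : A) p0.
    by congr (cfun _ p0); rewrite -[1]UK' U0 /U' /on_functions mulop0 (lieaut0 aG) dopE.
  by rewrite !cinfE => /eqP; rewrite oner_eq0.
split=> // f g.
pose T h := U (f * U' h).
have TL h h' : T (h * h') = h * T h'.
  apply: comp_deriv_linear => //.
    by move=> h1 h2; rewrite /T /U' on_functionsD// mulrDr /U on_functionsD.
  move=> X dX; have dX' : derivation (deriv_part (G X)).
    by apply: deriv_part_deriv; apply: lieaut_ordlt => //; exact: ordlt_deriv.
  have dY := derivation_mull f dX'.
  have TX h1 : T (X h1) = deriv_part (F (mulop f * deriv_part (G X))) h1.
    rewrite -[in RHS](UK h1) -(on_functions_deriv _ aF dY).
    by rewrite /T {1}/U' on_functions_deriv// dopE.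
  move=> h1 h2; rewrite !TX; apply: deriv_part_deriv.
  by apply: lieaut_ordlt => //; exact: ordlt_deriv.
(* T is multiplication by T 1; its values at U g and at U 1 allow T 1 to be eliminated. *)
have e1 : U (f * g) = U g * T 1 by rewrite -TL mulr1 /T UK'.
have e2 : U f = U 1 * T 1 by rewrite -TL mulr1 /T UK' mulr1.
by rewrite e1 e2 Uk scaler_mull mul1r scaler_mull mulrC.
Qed.

End Structure.
End Aut.

(** * Automorphisms acting on functions by a scalar *)

Section Kappa.
Context {R : realType} {n : nat} (M : manifold R n).
Local Notation A := (cinf M).
Local Notation L := (Dop M).
Implicit Types (f g h u v w : A) (D E X Y Z : L).

Hypothesis Mfull : full M.
Variables (F : L -> L) (k : R).
Hypotheses (autF : lieaut F) (k0 : k != 0).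
Hypothesis Fk : forall f, F (mulop f) = mulop (k *: f).

Definition cocycle_part (G : L -> L) X : A := G X 1.
Local Notation c := (cocycle_part F).

Lemma cinf_nat (p : M) j : (j%:R : A) p = j%:R.
Proof. by elim: j => // j IH; rewrite -[j.+1]addn1 !natrD cinfE IH. Qed.

Lemma cocycle_partD X Y : c (X + Y) = c X + c Y.
Proof. by rewrite /cocycle_part (lieautD autF) dopE. Qed.

Lemma cocycle_partE X : derivation X -> F X = X + mulop (c X).
Proof.
move=> dX; suff /ordlt1P e : ordlt 1 (F X - X).
  by rewrite -[LHS](subrK X) e addrC !dopE (derivation1 dX) subr0.
move=> f /=; apply/eqP; rewrite lieBl subr_eq0; apply/eqP.
have -> : mulop f = k^-1 *: F (mulop f).
  by rewrite Fk mulopZ scalerA mulVf// scale1r.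
rewrite {1}lieZr -(lieaut_lie autF) lie_deriv// !Fk.
by rewrite lieZr !mulopZ lieZr lie_deriv// !scalerA mulVf ?mulfV// scale1r.
Qed.

(** For the conjugation k = -1 and c = div, so lam = 1 and [cocycle_partZ] is the rule div(f X) = f
    div X + X f. For k = 1 it says that c is linear over functions. *)
Local Notation lam := ((1 - k) / 2%:R).

Lemma lie_uXX u X f : derivation X ->
  lie (mulop u * (X * X)) (mulop f) =
  (mulop (2%:R * u * X f) * X) + mulop (u * X (X f)).
Proof.
move=> dX; apply: dop_ext => h; rewrite /lie !dopE !dX raddfD /= !dX; ring.
Qed.

Let defect f X := c (mulop f * X) - f * c X - lam *: X f.

(** The bracket of k F E with f is F [E, f], which differs from [E, f] by a function only. So k F E
    - E has order at most 1, and its brackets with functions form a derivation. *)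
Lemma derivation_second u X : derivation X ->
  derivation (fun f => c (mulop (2%:R * u * X f) * X) + (k - 1) *: (u * X (X f))).
Proof.
move=> dX; pose E := mulop u * (X * X); pose G := k *: F E - E.
have oE : ordlt 3 E.
  by apply: ordlt_mull; apply: ordlt_derivl => //; exact: ordlt_deriv.
have GE f : lie G (mulop f) = mulop (c (mulop (2%:R * u * X f) * X) +
    (k - 1) *: (u * X (X f))).
  have dY : derivation (mulop (2%:R * u * X f) * X) by exact: derivation_mull.
  have e : k *: lie (F E) (mulop f) = mulop (2%:R * u * X f) * X +
      mulop (c (mulop (2%:R * u * X f) * X)) + mulop (k *: (u * X (X f))).
    rewrite -lieZr -mulopZ -Fk -(lieaut_lie autF) lie_uXX// (lieautD autF) Fk.
    by rewrite cocycle_partE.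
  rewrite /G lieBl lieZl e lie_uXX//.
  apply: dop_ext => h; rewrite !dopE; apply: cinf_ext => p; rewrite !cinfE; ring.
have oG : ordlt 2 G by move=> f; rewrite GE; exact: ordlt_mulop.
move=> f g; have := ordlt2_deriv oG f g.
have dG h : (G - mulop (G 1)) h = c (mulop (2%:R * u * X h) * X) +
    (k - 1) *: (u * X (X h)).
  have := congr1 (fun D : L => D 1) (GE h); rewrite /lie !dopE !mulr1 => <-.
  by rewrite [h * _]mulrC.
by rewrite !dG.
Qed.

(** [polar_defect] only reaches multiples of X' whose coefficient contains (X' g)^2 for this same
    X'; the field Z below passes to an arbitrary X. *)
Lemma cocycle_partZ f X : derivation X ->
  c (mulop f * X) = f * c X + lam *: X f.
Proof.
have defD f' Y Z : defect f' (Y + Z) = defect f' Y + defect f' Z.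
  rewrite /defect mulrDr !cocycle_partD !dopE scalerDr; ring.
have sq X' g f' h : derivation X' -> defect f' (mulop (h * X' g ^+ 2) * X') = 0.
  move=> dX; pose b f h := defect f (mulop h * X').
  apply: (@polar_defect _ _ _ X' b) => //.
  - by move=> f1 g1 g2; rewrite /b mulopD mulrDl defD.
  - move=> f1 f2 h'; rewrite /b /defect !mulrA -!mulopM !dopE dX !mulrA.
    apply: cinf_ext => p; rewrite !cinfE; ring.
  move=> u f1 f2; have := derivation_second u dX f1 f2.
  rewrite !dX !raddfD /= !dX.
  have two w : c (mulop (2%:R * w) * X') = 2%:R * c (mulop w * X').
    by rewrite -[2%:R]/(1 + 1) !mulrDl !mul1r mulopD mulrDl cocycle_partD.
  rewrite -[2%:R * u * _]mulrA two -[2%:R * u * _]mulrA two -[2%:R * u * _]mulrA two.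
  have cD g1 g2 : c (mulop (g1 + g2) * X') = c (mulop g1 * X') + c (mulop g2 * X').
    by rewrite mulopD mulrDl cocycle_partD.
  rewrite [u * (X' f1 * f2 + _)]mulrDr cD.
  rewrite /b /defect !mulrA -!mulopM !dopE !mulrA.
  rewrite (_ : u * X' f1 * f2 = f2 * u * X' f1); last by ring.
  rewrite (_ : u * f1 * X' f2 = f1 * u * X' f2); last by ring.
  move: (c _) (c _) (c _) (c _) => c1 c2 c3 c4 e.
  apply: cinf_ext => p; have := congr1 (fun f : A => f p) e.
  by rewrite !(cinfE, cinf_nat) => e'; lra.
move=> dX.
suff : defect f (mulop 1 * X) = 0.
  by rewrite mulop1 mul1r /defect => /eqP; rewrite subr_eq0 subr_eq => /eqP ->; rewrite
      addrC.
move: 1; apply: (Mfull (N := 5)).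
- rewrite mulop0 mul0r; have := defD f 0 0; rewrite addr0 => /eqP.
  by rewrite -subr_eq0 opprD addNKr oppr_eq0 => /eqP.
- by move=> h1 h2 e1 e2; rewrite mulopD mulrDl defD e1 e2 addr0.
move=> X' g h dX'; set a := X' g; pose b := X g.
(* Chosen so that Z g = a^2 and X has coefficient a: (Z g)^2 times a is a^5, the exponent taken in
   [full]. The X' part is covered by [sq] for X', its coefficient containing a^2. *)
pose Z := mulop a * X + mulop (a - b) * X'.
have dZ : derivation Z by apply: derivationD; exact: derivation_mull.
have Zg : Z g = a ^+ 2 by rewrite !dopE -/a -/b; ring.
have := sq Z g f h dZ; rewrite Zg mulrDr defD !mulrA -!mulopM.
have := sq X' g f (h * a ^+ 2 * (a - b)) dX'; rewrite -/a.
rewrite (_ : h * a ^+ 2 * (a - b) * a ^+ 2 = h * a * a * a * a * (a - b)); last by ring.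
move=> ->; rewrite addr0.
by rewrite (_ : h * a * a * a * a * a = h * a ^+ 5); last by ring.
Qed.

(** Only the brackets of D with functions enter, so the formula holds both for D = X and for D = F
    X, with the same X on the right. *)
Lemma lie_symm_sandwich D X u v : (forall f, lie D (mulop f) = mulop (X f)) ->
  derivation X ->
  lie (mulop v * D + D * mulop v) (D * mulop u * D) =
  D * mulop (v * X u - 2%:R * (u * X v)) * D +
  D * mulop (v * X u - 2%:R * (u * X v)) * D - mulop (X (u * X (X v))).
Proof.
move=> DX dX.
have De f h : D (f * h) = f * D h + X f * h.
  by have := congr1 (fun E : L => E h) (DX f); rewrite /lie !dopE => <-; ring.
apply: dop_ext => h; rewrite /lie !dopE.
have X2 : X (2%:R : A) = 0.
  by rewrite -[2%:R]/(1 + 1) raddfD /= (derivation1 dX) addr0.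
have DD f g : D (f + g) = D f + D g by rewrite raddfD.
have DB f g : D (f - g) = D f - D g by rewrite raddfB.
have XD f g : X (f + g) = X f + X g by rewrite raddfD.
have XB f g : X (f - g) = X f - X g by rewrite raddfB.
rewrite ?(De, DB, DD, dX, XB, XD, X2); ring.
Qed.

Let K := k - k^-1.

Section Square.
Variable X : L.
Hypothesis dX : derivation X.

Let sandwich u := X * mulop u * X.
Let e u := (F (sandwich u) - k^-1 *: (F X * mulop u * F X)) 1.

Lemma lieF f : lie (F X) (mulop f) = mulop (X f).
Proof. by rewrite cocycle_partE// lieDl lie_mulop_comm addr0 lie_deriv. Qed.

(** By the value of c(f X) found above, both operators have the same brackets with functions; they
    differ by a function, called e u. *)
Lemma F_sandwich u : F (sandwich u) = k^-1 *: (F X * mulop u * F X) + mulop (e u).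
Proof.
suff /ordlt1P H : ordlt 1 (F (sandwich u) - k^-1 *: (F X * mulop u * F X)).
  by rewrite /e -H addrC subrK.
move=> f /=; apply/eqP; rewrite lieBl subr_eq0; apply/eqP.
have fE : mulop f = k^-1 *: F (mulop f).
  by rewrite Fk mulopZ scalerA mulVf// scale1r.
rewrite [in LHS]fE lieZr -(lieaut_lie autF) lieZl.
congr (_ *: _).
rewrite /sandwich !lie_mull !lie_mulop_comm !lieF !(lie_deriv _ dX).
rewrite !(mulr0, add0r).
set w := u * X f.
have -> : X * mulop u * mulop (X f) + mulop (X f) * mulop u * X =
    mulop (2%:R * w) * X + mulop (X w).
  rewrite -mulrA -!mulopM -/w; apply: dop_ext => h; rewrite !dopE dX /w; ring.
rewrite (lieautD autF) Fk cocycle_partE; last exact: derivation_mull.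
rewrite cocycle_partZ// cocycle_partE//.
have -> : X (2%:R * w) = 2%:R * X w.
  by rewrite dX -[2%:R]/(1 + 1) raddfD /= (derivation1 dX); ring.
apply: dop_ext => h; rewrite !dopE !dX; apply: cinf_ext => p.
by rewrite ?(cinfE, cinf_nat); field.
Qed.

Lemma eD u v : e (u + v) = e u + e v.
Proof.
rewrite /e /sandwich mulopD !(mulrDr, mulrDl) (lieautD autF) !dopE scalerDr; ring.
Qed.

Lemma eN u : e (- u) = - e u.
Proof.
apply/eqP; rewrite -subr_eq0 opprK -eD addNr.
by have := eD 0 0; rewrite addr0 => /eqP; rewrite -subr_eq0 opprD addNKr oppr_eq0.
Qed.

(** F maps v X + X v to v F X + F X v. So F applied to [lie_symm_sandwich] for X can be compared
    with the same formula for F X: the function X (u X (X v)) comes with k in the first and with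
    k^-1 in the second, hence K. *)
Lemma e_rel u v : 2%:R * e (v * X u - 2%:R * (u * X v)) =
  2%:R * v * X (e u) + K *: X (u * X (X v)).
Proof.
set y := v * X u - _.
have [F1 F2] : F (mulop v * X + X * mulop v) = mulop v * F X + F X * mulop v /\ True.
  split=> //.
  have -> : mulop v * X + X * mulop v = mulop (2%:R * v) * X + mulop (X v).
    by apply: dop_ext => h; rewrite !dopE dX; ring.
  rewrite (lieautD autF) Fk cocycle_partE; last exact: derivation_mull.
  rewrite cocycle_partZ// cocycle_partE//.
  have -> : X (2%:R * v) = 2%:R * X v.
    by rewrite dX -[2%:R]/(1 + 1) raddfD /= (derivation1 dX); ring.
  apply: dop_ext => h; rewrite !dopE dX; apply: cinf_ext => p.
  by rewrite ?(cinfE, cinf_nat); field.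
have := congr1 F (lie_symm_sandwich u v (fun f => lie_deriv f dX) dX).
rewrite (lieaut_lie autF) F1 -/(sandwich u) F_sandwich lieDr lieZr.
rewrite (lie_symm_sandwich u v lieF dX) -/y -/(sandwich y).
rewrite (lieautB autF) (lieautD autF) F_sandwich Fk.
have -> : lie (mulop v * F X + F X * mulop v) (mulop (e u)) = mulop (2%:R * v * X (e u)).
  rewrite lieDl !lie_mull lie_mulop_comm lieF mul0r mulr0 addr0 add0r -!mulopM -mulopD.
  by congr mulop; ring.
move=> /(congr1 (fun D : L => D 1)); rewrite !dopE !mulr1 => E.
apply: cinf_ext => p; have := congr1 (fun f : A => f p) E.
by rewrite ?(cinfE, cinf_nat) /K; lra.
Qed.

(** Three instances of [e_rel]: (u, 1) shows that e commutes with X, (1, w) then gives 4 e (X w) = -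
    K X^3 w, and in (v, v), as 2 v X v = X (v^2), all terms but a multiple of K X v X^2 v cancel. *)
Lemma k_derivative_product v : K *: (X v * X (X v)) = 0.
Proof.
have X1 : X 1 = 0 := derivation1 dX.
have two w : X (2%:R * w) = 2%:R * X w.
  by rewrite dX -[2%:R]/(1 + 1) raddfD /= X1; ring.
have e0 : e 0 = 0 by have := eN 0; rewrite oppr0 => /eqP; rewrite -subr_eq0 opprK =>
    /eqP /cinf_double0.
have eX u : e (X u) = X (e u).
  apply: cinf_ext => p; have := congr1 (fun f : A => f p) (e_rel u 1).
  rewrite X1 mulr0 mulr0 subr0 mul1r raddf0 mulr0 raddf0 scaler0 addr0 mulr1.
  by rewrite ?(cinfE, cinf_nat); lra.
have Xe1 : X (e 1) = 0 by rewrite -eX X1.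
have e2 w : e (2%:R * w) = 2%:R * e w.
  by rewrite -[2%:R]/(1 + 1) !mulrDl !mul1r eD.
have eder w p : 4%:R * e (X w) p = - K * X (X (X w)) p.
  have := congr1 (fun f : A => f p) (e_rel 1 w).
  rewrite X1 mulr0 add0r mul1r eN e2 Xe1 mul1r.
  by rewrite ?(cinfE, cinf_nat); lra.
apply: cinf_ext => p; have := congr1 (fun f : A => f p) (e_rel v v).
rewrite (_ : v * X v - _ = - (v * X v)); last by ring.
rewrite eN -eX; have := eder v p; have := eder (v * v) p.
rewrite (_ : X (v * v) = 2%:R * (v * X v)); last by rewrite dX; ring.
have XD f g : X (f + g) = X f + X g by rewrite raddfD.
rewrite e2 !two ?(dX, XD).
move: (e (v * X v)) (e (X v)) => a b.
rewrite ?(cinfE, cinf_nat) => E1 E2 E3.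
have : v p * (4%:R * b p) = v p * (- K * X (X (X v)) p) by rewrite E2.
by lra.
Qed.

End Square.

Lemma kappa_square (p0 : M) : k ^+ 2 = 1.
Proof.
have [K0|K0] := eqVneq K 0.
  move/eqP: K0; rewrite subr_eq0 => /eqP K0.
  by rewrite expr2 {1}K0 mulVf.
suff H : forall h : A, h = 0.
  have := congr1 (fun f : A => f p0) (H 1).
  by rewrite !cinfE => /eqP; rewrite oner_eq0.
apply: (Mfull (N := 1)) => // [f g -> ->|X g h dX]; first by rewrite addr0.
rewrite expr1 (_ : X g = 0) ?mulr0//.
have P Y w : derivation Y -> Y w * Y (Y w) = 0.
  move=> dY; have := k_derivative_product dY w.
  move=> /(congr1 (fun f => K^-1 *: f)).
  by rewrite scalerA mulVf// scale1r scaler0.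
(* The product for the derivation f X, minus f^3 times the one for X. *)
have Q f : f ^+ 2 * X f * (X g) ^+ 2 = 0.
  have := P _ g (derivation_mull f dX); rewrite !dopE dX.
  have := P _ g dX => e1 e2.
  transitivity (f * X g * (f * (X f * X g + f * X (X g))) - f ^+ 3 * (X g * X (X g))).
    by ring.
  by rewrite e2 e1; ring.
apply: cinf_ext => p.
have Q0 := congr1 (fun f : A => f p) (Q g).
have Q1 := congr1 (fun f : A => f p) (Q (g + 1)).
have Q2 := congr1 (fun f : A => f p) (Q (g + 1 + 1)).
have X1 w : X (w + 1) = X w by rewrite raddfD /= (derivation1 dX) addr0.
move: Q0 Q1 Q2; rewrite !X1 !(cinfE, cinfX) => Q0 Q1 Q2.
(* The relations for f = g, g + 1, g + 2 are combined: the second difference of t^2 is 2. *)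
have : (X g p) ^+ 3 = 0 by lra.
by move/eqP; rewrite expf_eq0 /= => /eqP.
Qed.

End Kappa.

(** * Automorphisms fixing functions and vector fields *)

Section Fix.
Context {R : realType} {n : nat} (M : manifold R n).
Local Notation A := (cinf M).
Local Notation L := (Dop M).
Implicit Types (f g h u v w : A) (D E F X Y Z : L).

(** Coordinates and coordinate fields near p in global terms: multiplication by the cutoff b
    discards the points where the expansion of X would fail. *)
Definition framed := forall p : M, exists (b : A) (x : 'I_n -> A) (d : 'I_n -> L),
  [/\ b p = 1, forall l, derivation (d l) & forall X f, derivation X ->
      b * X f = \sum_l b * X (x l) * d l f].

(** Euler's identity for the symbol of D, a homogeneous polynomial of degree k + 1 in the covector:
    bracketing with x l differentiates it in the l-th component, and d l multiplies it by that
    component. *)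
Lemma frame_ordlt (b : A) (x : 'I_n -> A) (d : 'I_n -> L) k D :
  (forall l, derivation (d l)) ->
  (forall X f, derivation X -> b * X f = \sum_l b * X (x l) * d l f) ->
  ordlt k.+2 D ->
  ordlt k.+1 (k.+1%:R *: (mulop b * D) -
              \sum_l mulop b * d l * lie D (mulop (x l))).
Proof.
move=> dd bX oD; apply: ordlt_polar => [|f].
  apply: ordltB; first by apply: ordltZ; exact: ordlt_mull.
  apply: ordlt_sum => l; rewrite -mulrA; apply: ordlt_mull.
  by apply: ordlt_derivl => //; exact: oD.
have itZ j (c : R) E : iter j (adf f) (c *: E) = c *: iter j (adf f) E.
  by elim: j => //= j ->; rewrite adfZ.
have itD j E E' : iter j (adf f) (E + E') = iter j (adf f) E + iter j (adf f) E'.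
  by elim: j => //= j ->; rewrite adfD.
have itN j E : iter j (adf f) (- E) = - iter j (adf f) E.
  by rewrite -scaleN1r itZ scaleN1r.
have itb j E : iter j (adf f) (mulop b * E) = mulop b * iter j (adf f) E.
  by elim: j => //= j ->; rewrite adf_mull.
rewrite itD itN itZ (big_morph _ (itD _) (iter_adf0 _ _)); apply/eqP.
rewrite subr_eq0; apply/eqP; rewrite itb.
set Y := iter k (adf f) D.
have oY : ordlt 2 Y by have := ordlt_iter_adf k f oD; rewrite -addn2 addKn.
have adY g : adf g Y = mulop (deriv_part Y g).
  have dY := ordlt2_deriv oY.
  by rewrite -lie_deriv// /adf lieBl lie_mulop_comm subr0.
have term l : iter k.+1 (adf f) (mulop b * d l * lie D (mulop (x l))) =
    (mulop (b * d l f) * mulop (deriv_part Y (x l))) *+ k.+1.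
  have od : ordlt 2 (mulop b * d l) by apply: ordlt_mull; exact: ordlt_deriv.
  have oDx : ordlt k.+1 (lie D (mulop (x l))) by exact: oD.
  have := iter_adf_top f od oDx; rewrite add1n bin1 => ->.
  rewrite -[lie D _]/(adf (x l) D) iter_adf_comm -/Y adY /= adf_mull.
  by rewrite {1}/adf lie_deriv// -mulopM.
rewrite (eq_bigr _ (fun l _ => term l)) iterS -/Y adY -mulopM bX; last exact: ordlt2_deriv.
apply: dop_ext => g; rewrite dop_sum !dopE mulr_suml scaler_sumr.
apply: eq_bigr => l _; rewrite -[mulop _ * _ *+ _]scaler_nat.
by rewrite !dopE; congr (_ *: _); ring.
Qed.

Variable (G : L -> L).
Hypothesis Mfull : full M.
Hypothesis Mframed : framed.
Hypothesis Mfin : forall D, exists k, ordlt k D.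
Hypotheses (autG : lieaut G) (Gf : forall f, G (mulop f) = mulop f).
Hypothesis (GX : forall X, derivation X -> G X = X).

Lemma fix_ordlt2 D : ordlt 2 D -> G D = D.
Proof.
move=> oD; rewrite -[D](subrK (mulop (D 1))) (lieautD autG) Gf.
by rewrite GX//; exact: ordlt2_deriv.
Qed.

Section Step.
Variable k : nat.
Local Notation K := k.+2.
Hypothesis IH : forall D, ordlt K D -> G D = D.

(** The obstruction at order K: G adds the function h D to D, and h only depends on D modulo
    operators of order less than K. *)
Let h D : A := (G D - D) 1.

Lemma defectE D : ordlt K.+1 D -> G D = D + mulop (h D).
Proof.
move=> oD; rewrite /h; suff /ordlt1P H : ordlt 1 (G D - D).
  by rewrite -H addrC subrK.
move=> f; rewrite lieBl -{1}[mulop f]Gf -(lieaut_lie autG) IH ?subrr//.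
Qed.

Lemma hD D E : h (D + E) = h D + h E.
Proof. by rewrite /h (lieautD autG) !dopE; ring. Qed.

Lemma hN D : h (- D) = - h D.
Proof. by rewrite /h (lieautN autG) !dopE; ring. Qed.

Lemma hB D E : h (D - E) = h D - h E.
Proof. by rewrite hD hN. Qed.

Lemma h_low D : ordlt K D -> h D = 0.
Proof. by move=> /IH; rewrite /h => ->; rewrite subrr dopE. Qed.

Lemma h_mod D E : ordlt K (D - E) -> h D = h E.
Proof. by move=> /h_low; rewrite hB => /eqP; rewrite subr_eq0 => /eqP. Qed.

Lemma h_lie X D : derivation X -> ordlt K.+1 D -> h (lie X D) = X (h D).
Proof.
move=> dX oD; rewrite {1}/h (lieaut_lie autG) GX// defectE// lieDr lie_deriv//.
by rewrite !dopE; ring.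
Qed.

Lemma h_bracket E F : ordlt K E -> ordlt K F -> h (lie E F) = 0.
Proof.
by move=> oE oF; rewrite /h (lieaut_lie autG) !IH// subrr dopE.
Qed.

(** For k = 0 the operator X X is itself of order K, out of reach of [h_bracket]. Instead h
    [f X, X X] = f h [X, X X] = 0, and [f X, X X] is -2 (X f) X X up to lower order. *)
Lemma h_Xf_sqr X f : k = 0%N -> derivation X -> h (mulop (X f) * X * X) = 0.
Proof.
move=> k0 dX.
have oXX : ordlt K.+1 (X * X).
  by rewrite k0; apply: ordlt_derivl => //; exact: ordlt_deriv.
have dfX := derivation_mull f dX.
have := h_lie dfX oXX; rewrite !dopE -(h_lie dX oXX).
rewrite (_ : lie X (X * X) = 0); last by rewrite /lie mulrA subrr.
rewrite (h_low (ordlt0 _ _)) mulr0.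
pose T := mulop (X f) * X * X.
have oT : ordlt K (lie (mulop f * X) (X * X) - (- (T + T))).
  have -> : lie (mulop f * X) (X * X) - (- (T + T)) = - (mulop (X (X f)) * X).
    apply: dop_ext => w; rewrite /lie /T !dopE !dX !raddfD /= !dX; ring.
  by rewrite k0; apply: ordltN; apply: ordlt_mull; exact: ordlt_deriv.
rewrite (h_mod oT) hN hD => /eqP; rewrite oppr_eq0 => /eqP.
exact: cinf_double0.
Qed.

Lemma h_cube X f : k = 0%N -> derivation X -> h (lie (X * X * X) (mulop f)) = 0.
Proof.
move=> k0 dX; pose T := mulop (X f) * X * X.
have oT : ordlt K (lie (X * X * X) (mulop f) - (T + T + T)).
  have -> : lie (X * X * X) (mulop f) - (T + T + T) =
      mulop (3%:R * X (X f)) * X + mulop (X (X (X f))).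
    have XD (u v : A) : X (u + v) = X u + X v by rewrite raddfD.
    apply: dop_ext => w; rewrite /lie /T !dopE ?(dX, XD); ring.
  rewrite k0; apply: ordltD; first by apply: ordlt_mull; exact: ordlt_deriv.
  by apply: ordltS; exact: ordlt_mulop.
by rewrite (h_mod oT) !hD h_Xf_sqr// !addr0.
Qed.

(** Up to brackets, (X + Y)^3 - (X - Y)^3 - 2 Y^3 is 6 X X Y, so that cubes give access to X X Y. *)
Lemma cube_polarization X Y :
  (X + Y) * (X + Y) * (X + Y) - (X - Y) * (X - Y) * (X - Y) - Y * Y * Y -
  Y * Y * Y - (X * X * Y + X * X * Y + X * X * Y +
               (X * X * Y + X * X * Y + X * X * Y)) =
  X * lie Y X + lie Y (X * X) + (X * lie Y X + lie Y (X * X)).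
Proof.
have XB (u v : A) : X (u - v) = X u - X v by rewrite raddfB.
have YB (u v : A) : Y (u - v) = Y u - Y v by rewrite raddfB.
have XD (u v : A) : X (u + v) = X u + X v by rewrite raddfD.
have YD (u v : A) : Y (u + v) = Y u + Y v by rewrite raddfD.
apply: dop_ext => w; rewrite /lie !dopE ?(XB, YB, XD, YD); ring.
Qed.

(** For k > 0 the operator is, modulo order less than K, the difference of the brackets [X X, g F]
    and [g X X, F], whose entries G already fixes. For k = 0 it is reached from cubes by
    polarization, F being a derivation plus a function. *)
Lemma h_sqr_mul X F g : derivation X -> ordlt K F ->
  h (lie (X * X * F) (mulop g)) = 0.
Proof.
move=> dX oF; have [k0|k_gt0] := posnP k; last first.
  have oXX : ordlt 3 (X * X) by apply: ordlt_derivl => //; exact: ordlt_deriv.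
  have oK : ordlt K (X * X) by apply: ordltW oXX.
  have := h_bracket oK (ordlt_mull g oF).
  have := h_bracket (ordlt_mull g oK) oF => e1 e2.
  transitivity (h (lie (X * X) (mulop g * F) - lie (mulop g * (X * X)) F)).
    apply: h_mod.
    have -> : lie (X * X * F) (mulop g) - (lie (X * X) (mulop g * F) -
        lie (mulop g * (X * X)) F) = lie (X * X) (lie F (mulop g)).
      have XB (u v : A) : X (u - v) = X u - X v by rewrite raddfB.
      have FB (u v : A) : F (u - v) = F u - F v by rewrite raddfB.
      apply: dop_ext => w; rewrite /lie !dopE ?(XB, FB); ring.
    have := ordlt_lie oXX (oF g : ordlt k.+1 _); apply: ordltW; lia.
  by rewrite hB e1 e2 subr0.
have oY := ordlt2_deriv (_ : ordlt 2 F).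
pose Y := deriv_part F; have dY : derivation Y by apply: oY; rewrite -k0.
pose c3 Z := lie (Z * Z * Z) (mulop g).
pose T := lie (X * X * Y) (mulop g).
have e : h (c3 (X + Y) - c3 (X - Y) - c3 Y - c3 Y) = 0.
  have hc Z : derivation Z -> h (c3 Z) = 0 by exact: h_cube.
  rewrite 3!hB !hc ?subr0//; last exact: derivationD.
  by apply: derivationD => //; exact: derivationN.
have oXY : ordlt 3 (lie Y (X * X)).
  rewrite lie_mulr; have oL := ordlt_deriv (derivation_lie dY dX).
  have oX := ordlt_deriv dX.
  by apply: ordltD; [exact: (ordltM oX oL)|exact: (ordltM oL oX)].
have oX3 : ordlt 3 (X * lie Y X).
  by apply: ordlt_derivl => //; apply: ordlt_deriv; exact: derivation_lie.
pose S := X * lie Y X + lie Y (X * X).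
have oS : ordlt 3 S by exact: ordltD.
have eS : c3 (X + Y) - c3 (X - Y) - c3 Y - c3 Y - (T + T + T + (T + T + T)) =
    lie (S + S) (mulop g).
  pose U := X * X * Y; pose V := (X + Y) * (X + Y) * (X + Y).
  pose W := (X - Y) * (X - Y) * (X - Y).
  transitivity (lie (V - W - Y * Y * Y - Y * Y * Y - (U + U + U + (U + U + U))) (mulop g)).
    by rewrite 4!lieBl !lieDl.
  by rewrite /U /V /W cube_polarization.
have eT : h T = 0.
  have /h_mod : ordlt K (c3 (X + Y) - c3 (X - Y) - c3 Y - c3 Y - (T + T + T + (T + T + T))).
    by rewrite eS k0; exact: (ordltD oS oS).
  rewrite e !hD => e'; apply: cinf_ext => p.
  by have := congr1 (fun u : A => u p) e'; rewrite !cinfE; lra.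
have -> : lie (X * X * F) (mulop g) = T + lie (X * X * mulop (F 1)) (mulop g).
  by rewrite -lieDl -mulrDr subrK.
rewrite hD eT add0r; apply: h_low.
have o3 : ordlt 3 (X * X * mulop (F 1)).
  by apply: ordlt_mulr; apply: ordlt_derivl => //; exact: ordlt_deriv.
by rewrite k0; exact: o3.
Qed.

Lemma h_scale (c : R) D : h (c *: D) = c *: h D.
Proof. by rewrite /h (lieautZ autG) !dopE scalerBr. Qed.

Lemma lie_exp_mod X g j : derivation X ->
  ordlt j (lie (X ^+ j.+1) (mulop g) - (X ^+ j * mulop (X g)) *+ j.+1).
Proof.
move=> dX; elim: j => [|j IHj].
  by rewrite expr1 expr0 mul1r mulr1n lie_deriv//= subrr.
have oX := ordlt_deriv dX.
have oXj i : ordlt i.+1 (X ^+ i).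
  elim: i => [|i IHi]; first by rewrite expr0 -mulop1; exact: ordlt_mulop.
  by rewrite exprS; exact: ordlt_derivl.
have -> : lie (X ^+ j.+2) (mulop g) - (X ^+ j.+1 * mulop (X g)) *+ j.+2 =
    X * (lie (X ^+ j.+1) (mulop g) - (X ^+ j * mulop (X g)) *+ j.+1) -
    lie (X ^+ j.+1) (mulop (X g)).
  have -> : lie (X ^+ j.+2) (mulop g) = X * lie (X ^+ j.+1) (mulop g) +
      (X ^+ j.+1 * mulop (X g) - lie (X ^+ j.+1) (mulop (X g))).
    rewrite [X ^+ j.+2]exprS lie_mull (lie_deriv g dX); congr (_ + _).
    by rewrite /lie opprB addrC subrK.
  rewrite [X in _ = X - _]mulrBr mulrnAr mulrA -exprS.
  move: (lie _ (mulop (X g))) (X ^+ j.+1 * mulop (X g)) => w v.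
  move: (X * _) => u.
  by rewrite [v *+ j.+2]mulrS opprD !addrA [u + v - w - v]addrAC addrK addrAC.
apply: ordltB; first exact: ordlt_derivl.
by have := oXj j.+1 => /(_ (X g)).
Qed.

(** Induction on i: bracketing X^2 X^j (X g)^i F with g trades one X for a factor X g, while the
    bracket falling on F gives the previous case for [F, g]. At i = K a single X is left. *)
Lemma h_descend X g i : derivation X -> (i <= K)%N -> forall F, ordlt i F ->
  h (X ^+ (K.+1 - i) * mulop (X g ^+ i) * F) = 0.
Proof.
move=> dX; elim: i => [|i IHi] iK F oF.
  by rewrite [F]oF mulr0; apply: h_low; exact: ordlt0.
set a := X g; pose H := mulop (a ^+ i) * F.
have oH : ordlt i.+1 H by exact: ordlt_mull.
have oXj j : ordlt j.+1 (X ^+ j).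
  elim: j => [|j IHj]; first by rewrite expr0 -mulop1; exact: ordlt_mulop.
  by rewrite exprS; exact: ordlt_derivl.
have [j Kj] : exists j, K = (j + i).+1 by exists (K - i.+1)%N; lia.
have -> : (K.+1 - i.+1)%N = j.+1 by lia.
have e0 : h (lie (X * X * (X ^+ j * H)) (mulop g)) = 0.
  apply: h_sqr_mul => //; have := ordltM (oXj j) oH.
  by rewrite addSn addnS -Kj.
have e1 : h (X ^+ j.+2 * lie H (mulop g)) = 0.
  have := IHi (ltnW iK) (lie F (mulop g)) (oF g).
  rewrite (_ : (K.+1 - i)%N = j.+2); last by lia.
  by rewrite -/a /H lie_mull lie_mulop_comm mul0r addr0 mulrA.
have eX : X * X * (X ^+ j * H) = X ^+ j.+2 * H by rewrite !exprS !mulrA.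
move: e0; rewrite eX lie_mull hD e1 add0r.
have -> : h (lie (X ^+ j.+2) (mulop g) * H) = h ((X ^+ j.+1 * mulop a * H) *+ j.+2).
  apply: h_mod; rewrite -mulrnAl -mulrBl.
  have := ordltM (lie_exp_mod g j.+1 dX) oH.
  by rewrite addSn addnS -Kj.
rewrite -scaler_nat h_scale => /eqP; rewrite scaler_eq0 pnatr_eq0 /= => /eqP.
by rewrite /H mulrA -[_ * mulop a * _]mulrA -mulopM -exprS.
Qed.

Lemma h_derivation_mul Y F : derivation Y -> ordlt K F -> h (Y * F) = 0.
Proof.
move=> dY oF; rewrite -[F]mul1r -mulop1.
move: 1 F oF; apply: (Mfull (N := K.*2.+1)).
- by move=> F oF; rewrite mulop0 mul0r mulr0; apply: h_low; exact: ordlt0.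
- by move=> f g Pf Pg F oF; rewrite mulopD mulrDl mulrDr hD Pf// Pg// addr0.
move=> X g w dX F oF; set a := X g; pose b := Y g.
(* As in [cocycle_partZ], Z g = a^2; its K-th power and the coefficient a of Y make up the exponent
   2 K + 1. Of the two factors q = a^K, the X part needs one next to X, and the other joins F. *)
pose Z := mulop a * Y + mulop (a - b) * X.
have dZ : derivation Z by apply: derivationD; exact: derivation_mull.
have Zg : Z g = a ^+ 2 by rewrite !dopE -/a -/b; ring.
have e (V : L) (F' : L) : derivation V -> ordlt K F' -> h (V * mulop (V g ^+ K) * F') = 0.
  by move=> dV oF'; have := h_descend g dV (leqnn K) oF'; rewrite subSnn expr1.
have [q qE] : exists q, q = a ^+ K by exists (a ^+ K).
have := e Z (mulop w * F) dZ (ordlt_mull w oF).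
have := e X (mulop ((a - b) * q * w) * F) dX (ordlt_mull _ oF).
have -> : a ^+ K.*2.+1 = a * (q * q) by rewrite qE -addnn exprS exprD.
rewrite Zg -exprM mulnC exprM -/a -qE expr2 => e1.
have -> : Z * mulop (q * q) * (mulop w * F) =
    mulop a * (Y * (mulop (q * q * w) * F)) +
    mulop (a - b) * (X * (mulop (q * q * w) * F)).
  by apply: dop_ext => u; rewrite !dopE !mulrA.
rewrite hD.
have -> : h (mulop (a - b) * (X * (mulop (q * q * w) * F))) = 0.
  rewrite -[RHS]e1; apply: h_mod.
  have -> : mulop (a - b) * (X * (mulop (q * q * w) * F)) -
      X * mulop q * (mulop ((a - b) * q * w) * F) =
      - (mulop (X (a - b)) * (mulop (q * q * w) * F)).
    apply: dop_ext => u; rewrite !dopE.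
    have -> : q * ((a - b) * q * w * F u) = (a - b) * (q * q * w * F u) by ring.
    rewrite [X ((a - b) * _)]dX; ring.
  by apply: ordltN; do 2 apply: ordlt_mull.
rewrite addr0 => <-; apply: h_mod.
have -> : Y * (mulop (w * (a * (q * q))) * F) - mulop a * (Y * (mulop (q * q * w) * F)) =
    mulop (Y a) * (mulop (q * q * w) * F).
  apply: dop_ext => u; rewrite !dopE.
  have -> : w * (a * (q * q)) * F u = a * (q * q * w * F u) by ring.
  rewrite [Y (a * _)]dY; ring.
by do 2 apply: ordlt_mull.
Qed.

(** The key is f * Y (h E) = h (f [Y, E]): the remaining term [f, E] Y equals Y [f, E] up to lower
    order, and h vanishes on the latter. With E = g w D and E = w D this expresses h on (X g) w D
    and on f (X g) w D by the same terms. *)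
Lemma h_linear f D : ordlt K.+1 D -> h (mulop f * D) = f * h D.
Proof.
suff H : forall w g D, ordlt K.+1 D ->
    h (mulop (g * w) * D) = g * h (mulop w * D).
  by move=> oD; have := H 1 f D oD; rewrite mulr1 mulop1 mul1r.
apply: (Mfull (N := 1)) => {f D}.
- by move=> g D oD; rewrite mulr0 mulop0 mul0r (h_low (ordlt0 _ _)) mulr0.
- move=> f1 f2 P1 P2 g D oD.
  by rewrite [g * (f1 + f2)]mulrDr !mulopD ![(mulop _ + mulop _) * D]mulrDl !hD P1//
      P2//; ring.
move=> X g w dX f D oD; rewrite expr1.
have hf Y f' E : derivation Y -> ordlt K.+1 E -> f' * Y (h E) = h (mulop f' * lie Y E).
  move=> dY oE; have := h_lie (derivation_mull f' dY) oE; rewrite !dopE => <-.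
  rewrite lie_mull hD; suff -> : h (lie (mulop f') E * Y) = 0 by rewrite addr0.
  have oL : ordlt K (lie (mulop f') E).
    by rewrite lieC; apply: ordltN; exact: oE.
  rewrite -(h_derivation_mul dY oL); apply: h_mod.
  have := ordlt_lie oL (ordlt_deriv dY); rewrite addn2; exact.
have fD E : ordlt K.+1 E -> ordlt K.+1 (mulop f * E) by exact: ordlt_mull.
have wD : ordlt K.+1 (mulop w * D) by exact: ordlt_mull.
have key : h (mulop (X g) * (mulop w * D)) = X (h (mulop g * (mulop w * D))) - g * X (h
    (mulop w * D)).
  have := h_lie dX (ordlt_mull g wD); rewrite lie_mulr lie_deriv// hD => <-.
  by rewrite -hf// addrAC subrr add0r.
have key' : h (mulop f * (mulop (X g) * (mulop w * D))) =
    f * (X (h (mulop g * (mulop w * D))) - g * X (h (mulop w * D))).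
  have := hf X f _ dX (ordlt_mull g wD); rewrite lie_mulr lie_deriv// mulrDr hD.
  have := hf X (f * g) _ dX wD; rewrite mulopM -[mulop f * mulop g * _]mulrA => <- e.
  by rewrite mulrBr e; ring.
have e f' : mulop (f' * (w * X g)) * D = mulop f' * (mulop (X g) * (mulop w * D)).
  by rewrite !mulrA -!mulopM; congr (mulop _ * _); ring.
by rewrite e key' -key -[w * X g]mul1r e mulop1 mul1r.
Qed.

(** By Euler's identity a multiple of b D is, up to lower order, a sum of products of a derivation
    and an operator of lower order, on which h vanishes. Linearity and b p = 1 then give the value
    at p. *)
Lemma h_zero D : ordlt K.+1 D -> h D = 0.
Proof.
move=> oD; apply: cinf_ext => p; have [b [x [d [bp dd bX]]]] := Mframed p.
have : h (mulop b * D) = 0.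
  have oK := frame_ordlt dd bX oD.
  have := h_low oK; rewrite hB h_scale.
  have -> : h (\sum_l mulop b * d l * lie D (mulop (x l))) = 0.
    apply: (big_ind (fun E => h E = 0)) => [|E E' e e'|l _].
    - exact/h_low/ordlt0.
    - by rewrite hD e e' addr0.
    - by apply: h_derivation_mul; [exact: derivation_mull|exact: oD].
  by rewrite subr0 => /eqP; rewrite scaler_eq0 pnatr_eq0 /= => /eqP.
rewrite h_linear// => /(congr1 (fun f : A => f p)).
by rewrite !cinfE bp mul1r.
Qed.

Lemma fix_step D : ordlt K.+1 D -> G D = D.
Proof. by move=> oD; rewrite defectE// h_zero// mulop0 addr0. Qed.

End Step.

Lemma fix_all D : G D = D.
Proof.
have [k oD] := Mfin D.
have H j : forall E, ordlt j.+2 E -> G E = E.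
  elim: j => [|j IHj] E; first exact: fix_ordlt2.
  exact: fix_step.
by apply: (H k); do 2 apply: ordltS.
Qed.

End Fix.

(** * Calculus in Euclidean space *)

Section Flat.
Context {R : realType}.
Implicit Types (x y : R) (m : nat).

(** The powers x^-m make the family stable under differentiation, so smoothness is proved for all m
    at once. *)
Definition flat m x : R := if 0 < x then x^-1 ^+ m * expR (- x^-1) else 0.

Lemma flat_ge0 m x : 0 <= flat m x.
Proof.
by rewrite /flat; case: ifP => // x0; rewrite mulr_ge0 ?expR_ge0// exprn_ge0// invr_ge0 ltW.
Qed.

Lemma flat_le m x : flat m x <= m`!%:R.
Proof.
rewrite /flat; case: ifP => [x0|_]; last by rewrite ler0n.
have y0 : 0 <= x^-1 by rewrite invr_ge0 ltW.
rewrite expRN ler_pdivrMr ?expR_gt0//.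
have f0 : (0 : R) < m`!%:R by rewrite ltr0n fact_gt0.
rewrite mulrC -ler_pdivrMr//; case: m f0 => [|m] f0.
  by rewrite expr0 fact0 divr1 (le_trans _ (expR_ge1Dx _))// lerDl.
by apply: le_trans (expR_ge1Dxn m y0); rewrite lerDr.
Qed.

Lemma flatS m x : flat m x = x * flat m.+1 x.
Proof.
rewrite /flat; case: ifP => x0; last by rewrite mulr0.
by rewrite exprS !mulrA divff ?mul1r// gt_eqF.
Qed.

Lemma is_derive_flat m x :
  is_derive x 1 (flat m) (- (m%:R * flat m.+1 x) + flat m.+2 x).
Proof.
have [x0|x0|->] := ltgtP x 0.
- have -> : - (m%:R * flat m.+1 x) + flat m.+2 x = 0.
    by rewrite /flat (lt_gtF x0) mulr0 oppr0 addr0.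
  apply: near_eq_is_derive (is_derive_cst (0 : R) x (1 : R)).
  near=> y; rewrite /flat (_ : (0 < y) = false)//; apply/negbTE; rewrite -leNgt.
  by apply: ltW; near: y; exact: lt_nbhsl.
- pose g y := y^-1.
  have dg : is_derive x 1 g (- x ^- 2).
    have := @is_deriveV _ id x 1 1; rewrite /GRing.scale/= mulr1.
    by apply; rewrite gt_eqF.
  pose F := (g ^+ m) * (expR \o (- g)).
  have dF : is_derive x 1 F (- (m%:R * flat m.+1 x) + flat m.+2 x).
    have d1 := is_deriveX m dg.
    have d2 := is_derive1_comp (is_derive_expR ((- g) x)) (is_deriveN dg).
    apply: is_derive_eq (is_deriveM d1 d2) _.
    rewrite /flat x0 /GRing.scale/= !fctE /= /g.
    case: m {F d1} => [|m]; rewrite ?expr0 ?expr1 -?exprVn ?exprS /=.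
      by ring.
    by ring.
  apply: near_eq_is_derive dF; near=> y.
  rewrite /F /flat /g !fctE /= ifT//.
  by near: y; exact: lt_nbhsr.
- have -> : - (m%:R * flat m.+1 0) + flat m.+2 0 = 0.
    by rewrite /flat ltxx mulr0 oppr0 addr0.
  have cv : (fun h => h^-1 *: ((flat m \o shift 0) (h *: 1) - flat m 0)) @ 0^' --> (0 : R).
    apply/cvgrPdist_le => /= e e0; near=> h.
    have h0 : h != 0 by near: h; exact: nbhs_dnbhs_neq.
    rewrite sub0r normrN /shift /= addr0 {2}/flat ltxx subr0 /GRing.scale /= mulr1.
    (* By [flatS] used twice, the difference quotient is h times the bounded function
       [flat m.+2]. *)
    rewrite flatS mulrA mulVf// mul1r flatS normrM (ger0_norm (flat_ge0 _ _)).
    apply: (@le_trans _ _ (`|h| * (m.+2)`!%:R)); first by rewrite ler_wpM2l// flat_le.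
    rewrite -ler_pdivlMr ?ltr0n ?fact_gt0//.
    near: h; apply: dnbhs0_le.
    by rewrite divr_gt0// ltr0n fact_gt0.
  by apply: DeriveDef; [apply/cvg_ex; exists 0|exact: cvg_lim cv].
Unshelve. all: by end_near. Qed.

Lemma derive_scal1 (W : normedModType R) (f : R -> W) x v : differentiable f x ->
  'D_v f x = v *: 'D_1 f x.
Proof.
move=> df; rewrite !deriveE// -linearZ /=; congr ('d f x _).
by rewrite /GRing.scale/= mulr1.
Qed.

Lemma smooth_flat m : smooth_on setT (flat m).
Proof.
have df m' x : differentiable (flat m') x.
  by apply/derivable1_diffP; case: (is_derive_flat m' x).
move=> k; elim: k m => [|k IH] m; first by move=> x _; exact: differentiable_continuous.
split=> [x _|v]; first exact: df.
apply: Ck_ext (CkZ v openT (CkD openT (CkZ (- m%:R) openT (IH m.+1)) (IH m.+2))) => //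
    [|x _].
  exact: openT.
rewrite derive_scal1//; congr (_ *: _).
by rewrite (derive_val (is_derive := is_derive_flat m x)) scaleNr.
Qed.

End Flat.

(** * Further closure properties of C^k functions *)

Section CkMore.
Context {R : realType}.

Lemma Ck_comp_real (V : normedModType R) k (U : set V) (A : set R)
    (s : V -> R) (g : R -> R) : open U -> (forall x, U x -> A (s x)) ->
  Ck k U s -> Ck k A g -> Ck k U (fun x => g (s x)).
Proof.
move=> oU sUO; elim: k g => [|k IH] g.
  by move=> cs cg x Ux; apply: continuous_comp; [exact: cs|exact/cg/sUO].
move=> Cs [dg Dg]; have [ds Ds] := Cs; split=> [x Ux|v].
  by apply: (differentiable_comp (f := s)); [exact: ds|exact/dg/sUO].
apply: (@Ck_ext _ _ _ _ _ (fun x => 'D_v s x * 'D_1 g (s x))) => //.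
  move=> x Ux; have dsx := ds _ Ux; have dgx := dg _ (sUO _ Ux).
  rewrite [RHS]deriveE; last exact: (differentiable_comp dsx dgx).
  rewrite (diff_comp dsx dgx)/= -(deriveE _ dsx) -(deriveE _ dgx).
  by rewrite [RHS]derive_scal1.
exact: CkM oU (Ds v) (IH _ (CkS Cs) (Dg 1)).
Qed.

Lemma CkV (V : normedModType R) k (U : set V) (f : V -> R) : open U ->
  (forall x, U x -> f x != 0) -> Ck k U f -> Ck k U (fun x => (f x)^-1).
Proof.
move=> oU f0; elim: k => [|k IH].
  by move=> cf x Ux; apply: continuousV; [exact: f0|exact: cf].
move=> Cf; have [df Df] := Cf; split=> [x Ux|v].
  by apply: differentiableV; [exact: df|exact: f0].
have CI := IH (CkS Cf).
apply: (@Ck_ext _ _ _ _ _ (fun x => (-1) *: ((f x)^-1 * (f x)^-1 * 'D_v f x))) => //.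
  move=> x Ux; rewrite deriveV; [|exact: f0|exact/diff_derivable/df].
  by rewrite /GRing.scale /= expr2 invfM; ring.
exact: CkZ (CkM oU (CkM oU CI CI) (Df v)).
Qed.

Lemma Ck_prod (V : normedModType R) k (U : set V) (I : Type) (r : seq I)
    (F : I -> V -> R) : open U ->
  (forall i, Ck k U (F i)) -> Ck k U (fun x => \prod_(i <- r) F i x).
Proof.
move=> oU CF; elim: r => [|i r IH].
  by apply: Ck_ext (@Ck_cst R V R k U 1) => // x _; rewrite big_nil.
by apply: Ck_ext (CkM oU (CF i) IH) => // x _; rewrite big_cons.
Qed.

Lemma CkN (V W : normedModType R) k (U : set V) (f : V -> W) : open U ->
  Ck k U f -> Ck k U (fun x => - f x).
Proof. by move=> oU Cf; apply: Ck_ext (CkZ (-1) oU Cf) => // x _; rewrite scaleN1r. Qed.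

Lemma CkB (V W : normedModType R) k (U : set V) (f g : V -> W) : open U ->
  Ck k U f -> Ck k U g -> Ck k U (fun x => f x - g x).
Proof. by move=> oU Cf Cg; apply: CkD => //; exact: CkN. Qed.

Lemma Ck_of_coord (V : normedModType R) n k (U : set V) (f : V -> 'rV[R]_n) :
  open U -> (forall l, Ck k U (fun x => f x 0 l)) -> Ck k U f.
Proof.
move=> oU Cf.
have H (l : 'I_n) j (g : V -> R) : Ck j U g ->
    Ck j U (fun x => g x *: (delta_mx 0 l : 'rV[R]_n)).
  elim: j g => [|j IH] g.
    by move=> cg x Ux; apply: continuousZl; exact: cg.
  move=> [dg Dg]; split=> [x Ux|v].
    by apply: differentiableZl; exact: dg.
  apply: Ck_ext (IH _ (Dg v)) => // x Ux.
  have dgx := dg _ Ux; rewrite [RHS]deriveE; last exact: differentiableZl.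
  by rewrite diffZl//= -deriveE.
apply: (@Ck_ext _ _ _ _ _ (fun x => \sum_l f x 0 l *: delta_mx 0 l)) => //.
  by move=> x _; rewrite -row_sum_delta.
by apply: Ck_sum => // l; exact: H.
Qed.

End CkMore.

(** * Cutoff functions *)

Section Bump.
Context {R : realType}.

Definition plateau (t : R) : R :=
  flat 0 (4%:R - t * t) / (flat 0 (4%:R - t * t) + flat 0 (t * t - 1)).

Lemma flat_gt0 m (x : R) : 0 < x -> 0 < flat m x.
Proof.
by move=> x0; rewrite /flat x0 mulr_gt0 ?expR_gt0// exprn_gt0// invr_gt0.
Qed.

Lemma flat_eq0 m (x : R) : x <= 0 -> flat m x = 0.
Proof. by move=> x0; rewrite /flat ltNge x0. Qed.

Lemma plateau_den (t : R) : 0 < flat 0 (4%:R - t * t) + flat 0 (t * t - 1).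
Proof.
have [t2|t2] := ltP (t * t) 4%:R.
  by apply: ltr_pwDl; [apply: flat_gt0; rewrite subr_gt0|exact: flat_ge0].
apply: ltr_wpDl; [exact: flat_ge0|apply: flat_gt0; rewrite subr_gt0].
by apply: lt_le_trans t2; rewrite ltr1n.
Qed.

Lemma smooth_plateau : smooth_on setT plateau.
Proof.
have ct k : Ck k setT (fun t : R => t) by exact: smooth_id.
have c1 k (c : R) : Ck k setT (fun t : R => t * t - c).
  by apply: CkB openT (CkM openT (ct k) (ct k)) (Ck_cst k setT c).
have c2 k : Ck k setT (fun t : R => flat 0 (4%:R - t * t)).
  apply: (Ck_comp_real (A := setT)) => //; [exact: openT| |exact: smooth_flat].
  by apply: CkB openT (Ck_cst k setT _) (CkM openT (ct k) (ct k)).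
move=> k; apply: CkM openT (c2 k) _; apply: CkV openT _ _.
  by move=> t _; rewrite gt_eqF// plateau_den.
apply: CkD openT (c2 k) _.
apply: (@Ck_comp_real R _ k setT setT (fun t : R => t * t - 1) (flat 0) openT) => //;
    exact: smooth_flat.
Qed.

Lemma plateau_ge0 t : 0 <= plateau t.
Proof. by rewrite divr_ge0 ?flat_ge0// ltW// plateau_den. Qed.

Lemma plateau_le1 t : plateau t <= 1.
Proof. by rewrite ler_pdivrMr ?plateau_den// mul1r lerDl flat_ge0. Qed.

Lemma plateau1 t : `|t| <= 1 -> plateau t = 1.
Proof.
move=> t1; rewrite /plateau (flat_eq0 0 (x := t * t - 1)) ?addr0; last first.
  by rewrite subr_le0 -expr2 -real_normK ?num_real// expr_le1.
rewrite divff// gt_eqF// flat_gt0// subr_gt0.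
have : t * t <= 1 by rewrite -expr2 -real_normK ?num_real// expr_le1.
by move=> /le_lt_trans; apply; rewrite ltr1n.
Qed.

Lemma plateau0 t : 2%:R <= `|t| -> plateau t = 0.
Proof.
move=> t2; rewrite /plateau (flat_eq0 0 (x := 4%:R - t * t)) ?mul0r//.
rewrite subr_le0 -expr2 -(real_normK (num_real t)).
by rewrite (_ : 4%:R = 2%:R ^+ 2 :> R) ?lerXn2r ?nnegrE//; ring.
Qed.

Context {n : nat}.
Implicit Types (x c : 'rV[R]_n).

Lemma rV_norm_leP (x : 'rV[R]_n) (r : R) : 0 <= r ->
  reflect (forall l, `|x 0 l| <= r) (`|x| <= r).
Proof.
have -> : `|x| = mx_norm x by [].
move=> r0; rewrite mx_normrE; apply: (iffP idP) => [xr l|xr].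
  apply: le_trans xr.
  exact: (le_bigmax 0 (fun ij : 'I_1 * 'I_n => `|x ij.1 ij.2|) (0, l)).
by apply/bigmax_leP; split=> // -[i j] _ /=; rewrite ord1.
Qed.

Lemma rV_coord_le x l : `|x 0 l| <= `|x|.
Proof. by move/rV_norm_leP: (lexx `|x|); apply. Qed.

(** The norm of row vectors is the maximum norm, so a product of one-variable plateaus is 1 on the
    ball of radius r and 0 off the ball of radius 2 r. *)
Definition bumpR c (r : R) x : R := \prod_l plateau (r^-1 * (x 0 l - c 0 l)).

Lemma smooth_bumpR c r : smooth_on setT (bumpR c r).
Proof.
move=> k; apply: (@Ck_prod R _ k setT _ _ (fun l x => plateau (r^-1 * (x 0 l - c 0 l)))
    openT) => l.
apply: (Ck_comp_real (A := setT)) => //; [exact: openT| |exact: smooth_plateau].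
apply: (CkZ _ openT); apply: CkB openT _ (Ck_cst _ _ _).
exact: Ck_coord openT (smooth_id _ _).
Qed.

Lemma bumpR_ge0 c r x : 0 <= bumpR c r x.
Proof. by apply: prodr_ge0 => l _; exact: plateau_ge0. Qed.

Lemma bumpR_le1 c r x : bumpR c r x <= 1.
Proof. by apply: prodr_ile1 => l _; rewrite plateau_ge0 plateau_le1. Qed.

Lemma bumpR1 c r x : 0 < r -> `|x - c| <= r -> bumpR c r x = 1.
Proof.
move=> r0 /(rV_norm_leP _ (ltW r0)) xc; rewrite /bumpR big1// => l _.
apply: plateau1; have := xc l; rewrite !mxE normrM gtr0_norm ?invr_gt0// => h.
by rewrite mulrC ler_pdivrMr// mul1r.
Qed.

Lemma bumpR0 c r x : 0 < r -> 2%:R * r <= `|x - c| -> bumpR c r x = 0.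
Proof.
move=> r0 xc; have r2 : 0 < 2%:R * r by rewrite mulr_gt0.
have [l hl] : exists l, 2%:R * r <= `|(x - c) 0 l|.
  apply: contrapT => H.
  have n0 : `|x - c| != 0 by rewrite gt_eqF// (lt_le_trans r2).
  have [[i j]] := mx_norm_neq0 n0; rewrite ord1 => e.
  by apply: H; exists j; rewrite -e.
rewrite /bumpR (bigD1 l)//= plateau0 ?mul0r//.
rewrite normrM gtr0_norm ?invr_gt0// mulrC ler_pdivlMr//.
by move: hl; rewrite !mxE.
Qed.

End Bump.

(** * Mean value estimates along segments *)

Section Segment.
Context {R : realType} {n : nat}.
Implicit Types (x u a c : 'rV[R]_n) (f : 'rV[R]_n -> R).

Lemma derive_partial_sum f x u : differentiable f x ->
  'D_u f x = \sum_l u 0 l * partial l f x.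
Proof.
move=> df; rewrite deriveE// {1}(row_sum_delta u) raddf_sum.
apply: eq_bigr => l _; rewrite /partial deriveE//.
exact: linearZ_LR.
Qed.

Lemma is_derive_line f a u (s : R) : differentiable f (a + s *: u) ->
  is_derive s 1 (fun s => f (a + s *: u)) ('D_u f (a + s *: u)).
Proof.
move=> df.
have E : (fun h : R => h^-1 *: (((fun s => f (a + s *: u)) \o shift s) (h *: 1) -
      f (a + s *: u))) =
    (fun h => h^-1 *: ((f \o shift (a + s *: u)) (h *: u) - f (a + s *: u))).
  apply/funext => h; congr (_ *: (_ - _)); rewrite /= /shift /=.
  have h1 : h *: (1 : R) = h by exact: mulr1.
  by congr f; rewrite h1 scalerDl addrCA.
have du : derivable f (a + s *: u) u by exact: diff_derivable.
by apply: DeriveDef; rewrite /derivable /derive E.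
Qed.

Lemma MVT_line f a u : (forall s : R, 0 <= s <= 1 -> differentiable f (a + s *: u)) ->
  exists2 s : R, 0 <= s <= 1 & f (a + u) - f a = 'D_u f (a + s *: u).
Proof.
move=> df; pose phi s := f (a + s *: u).
have d (s : R) : 0 <= s <= 1 -> is_derive s 1 phi ('D_u f (a + s *: u)).
  by move=> s01; apply: is_derive_line; exact: df.
have [||s s01] := @MVT_segment R phi (fun s => 'D_u f (a + s *: u)) 0 1 ler01.
- by move=> s; rewrite in_itv/= => /andP[s0 s1]; apply: d; rewrite !ltW.
- apply: derivable_within_continuous => s; rewrite in_itv/= => s01.
  by case: (d s s01).
rewrite /phi scale1r scale0r addr0 subr0 mulr1 => e.
by exists s => //; move: s01; rewrite in_itv.
Qed.

Lemma norm_derive_le f x u (C : R) : differentiable f x ->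
  (forall l, `|partial l f x| <= C) -> `|'D_u f x| <= n%:R * C * `|u|.
Proof.
move=> df fC; rewrite derive_partial_sum//.
apply: le_trans (ler_norm_sum _ _ _) _.
apply: (@le_trans _ _ (\sum_(l < n) C * `|u|)); last first.
  by rewrite sumr_const card_ord -mulrA mulr_natl.
apply: ler_sum => l _; rewrite normrM mulrC.
by apply: ler_pM => //; exact: rV_coord_le.
Qed.

(** The uniformity in the base point b is what allows a compactness argument when differentiating
    under the integral. *)
Lemma strict_diff f (U : set 'rV[R]_n) a (e : R) : open U -> Ck 1 U f -> U a -> 0 < e ->
  \forall b \near a & u \near (0 : 'rV[R]_n),
    `|f (b + u) - f b - 'D_u f b| <= e * `|u|.
Proof.
move=> oU [df Df] Ua e0.
(* Each of the n partial derivatives varies by at most 2 e', and 2 n e' <= e; the added 1 keeps the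
   denominator positive when n = 0. *)
pose e' := e / (2%:R * n%:R + 1).
have den : 0 < 2%:R * n%:R + 1 :> R by rewrite ltr_wpDl// mulr_ge0.
have e'0 : 0 < e' by rewrite divr_gt0.
have near_a : \forall y \near a, U y /\ forall l, `|partial l f a - partial l f y| <= e'.
  near=> y; split; first by near: y; exact: open_nbhs_nbhs.
  near: y; apply: filter_forall => l.
  by move/cvgrPdist_le: (Df (delta_mx 0 l) a Ua) => /(_ e' e'0).
have /nbhs_ballP[r /= r0 rP] := near_a.
have r2 : 0 < r / 2%:R by rewrite divr_gt0.
near=> b u => /=.
have ab : `|a - b| < r / 2%:R.
  near: b; have := nbhsx_ballx a _ r2; rewrite -ball_normE; exact.
have u2 : `|u| < r / 2%:R.
  near: u; have := nbhsx_ballx (0 : 'rV[R]_n) _ r2; rewrite -ball_normE /ball_/=.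
  by apply: filterS => y /=; rewrite sub0r normrN.
have bu (s : R) : 0 <= s <= 1 -> ball a r (b + s *: u).
  move=> /andP[s0 s1]; rewrite -ball_normE /ball_/= opprD addrA.
  apply: le_lt_trans (ler_normB _ _) _.
  rewrite [r]splitr ltr_leD// normrZ ger0_norm//.
  by apply: le_trans (ltW u2); rewrite ler_piMl.
have [s s01 ->] : exists2 s : R, 0 <= s <= 1 & f (b + u) - f b = 'D_u f (b + s *: u).
  by apply: MVT_line => s s01; apply: df; case: (rP _ (bu _ s01)).
have b0 : ball a r b by have := bu 0; rewrite scale0r addr0; apply; rewrite lexx ler01.
have [Ub fb] := rP _ b0; have [Us fs] := rP _ (bu _ s01).
rewrite !derive_partial_sum; [|exact: df|exact: df].
rewrite -sumrB; apply: le_trans (ler_norm_sum _ _ _) _.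
apply: (@le_trans _ _ (\sum_(l < n) (2%:R * e') * `|u|)).
  apply: ler_sum => l _; rewrite -mulrBr normrM mulrC.
  apply: ler_pM => //; last exact: rV_coord_le.
  rewrite (_ : _ - _ = (partial l f a - partial l f b) - (partial l f a - partial l f
      (b + s *: u))); last by ring.
  by apply: le_trans (ler_normB _ _) _; rewrite mulr_natl mulr2n lerD.
rewrite sumr_const card_ord -[X in _ <= X]mulr1.
rewrite -mulr_natr -!mulrA mulrC [e * _]mulrC /e'.
rewrite -mulrA [X in X <= _](_ : _ = (2%:R * n%:R / (2%:R * n%:R + 1)) * (`|u| * e));
    last by field; rewrite gt_eqF.
rewrite !mulr1 [e * _]mulrC ler_piMl ?mulr_ge0//; first exact: ltW.
by rewrite ler_pdivrMr// mul1r lerDl.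
Unshelve. all: by end_near. Qed.

Lemma partial0_constant f a r : (forall x, ball a r x -> differentiable f x) ->
  (forall l x, ball a r x -> partial l f x = 0) ->
  forall x, ball a r x -> f x = f a.
Proof.
move=> df f0 x; rewrite -ball_normE /ball_/= => ax.
have bs (s : R) : 0 <= s <= 1 -> ball a r (a + s *: (x - a)).
  move=> /andP[s0 s1]; rewrite -ball_normE /ball_/= opprD addrA subrr sub0r normrN.
  by rewrite normrZ ger0_norm//; apply: le_lt_trans ax; rewrite distrC ler_piMl.
have [s s01] := @MVT_line f a (x - a) (fun s s01 => df _ (bs s s01)).
rewrite [a + (x - a)]addrC subrK derive_partial_sum; last exact/df/bs.
rewrite big1 => [/subr0_eq//|l _]; rewrite f0 ?mulr0//; exact: bs.
Qed.

Lemma lipschitz_ball f a r (C : R) : (forall x, `|x - a| <= r -> differentiable f x) ->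
  (forall l x, `|x - a| <= r -> `|partial l f x| <= C) ->
  forall x y, `|x - a| <= r -> `|y - a| <= r -> `|f y - f x| <= n%:R * C * `|y - x|.
Proof.
move=> df fC x y xa ya.
have bs (s : R) : 0 <= s <= 1 -> `|x + s *: (y - x) - a| <= r.
  move=> /andP[s0 s1].
  have -> : x + s *: (y - x) - a = (1 - s) *: (x - a) + s *: (y - a).
    by rewrite !scalerBr !scalerBl !scale1r opprB addrACA; apply/rowP => l; rewrite
        !mxE; ring.
  apply: le_trans (ler_normD _ _) _; rewrite !normrZ !ger0_norm ?subr_ge0//.
  rewrite (_ : r = (1 - s) * r + s * r); last by ring.
  by rewrite lerD// ler_wpM2l// subr_ge0.
have [s s01 e] := @MVT_line f x (y - x) (fun s s01 => df _ (bs s s01)).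
move: e; rewrite [x + (y - x)]addrC subrK => ->; apply: norm_derive_le; first exact/df/bs.
by move=> l; apply: fC; exact: bs.
Qed.

End Segment.

(** * Integrals over the unit interval *)

Section UnitIntegral.
Context {R : realType}.
Implicit Types (f g : R -> R) (c : R).
Local Notation mu := (@lebesgue_measure R).
Local Notation I01 := (`[0, 1]%classic : set R).

Definition int01 f : R := \int[mu]_(t in I01) f t.

Lemma int01_integrable f : {within I01, continuous f} ->
  mu.-integrable I01 (EFin \o f).
Proof. by move=> cf; apply: continuous_compact_integrable => //; exact:
    segment_compact. Qed.

Lemma mI01 : measurable I01. Proof. exact: measurable_itv. Qed.

Lemma mu01 : fine (mu I01) = 1.
Proof. by rewrite lebesgue_measure_itv /= lte01 /= ?oppr0 ?addr0 ?subr0. Qed.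

Lemma int01D f g : {within I01, continuous f} -> {within I01, continuous g} ->
  int01 (fun t => f t + g t) = int01 f + int01 g.
Proof. by move=> cf cg; apply: RintegralD; [exact: mI01|exact: int01_integrable|exact:
    int01_integrable]. Qed.

Lemma int01Z c f : {within I01, continuous f} ->
  int01 (fun t => c * f t) = c * int01 f.
Proof. by move=> cf; apply: RintegralZl; [exact: mI01|exact: int01_integrable]. Qed.

Lemma int01_eq f g : (forall t : R, 0 <= t <= 1 -> f t = g t) -> int01 f = int01 g.
Proof.
move=> fg; apply: eq_Rintegral => t; rewrite inE /= in_itv/= => t01; exact: fg.
Qed.

Lemma int01_norm f c : {within I01, continuous f} ->
  (forall t : R, 0 <= t <= 1 -> `|f t| <= c) -> `|int01 f| <= c.
Proof.
move=> cf fc; have iF := int01_integrable cf; rewrite /int01.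
apply: le_trans; first by apply: le_normr_Rintegral iF; exact: mI01.
have -> : c = int01 (fun=> c) by rewrite /int01 Rintegral_cst ?mu01 ?mulr1//; exact: mI01.
apply: le_Rintegral; first exact: mI01.
- have := integrable_norm iF; exact.
- by apply: int01_integrable; apply: continuous_subspaceT => x; exact: cst_continuous.
- by move=> t; rewrite /= in_itv/= => t01; exact: fc.
Qed.

Lemma int01_FTC f g : {within I01, continuous f} ->
  (forall t : R, 0 <= t <= 1 -> is_derive t 1 g (f t)) -> int01 f = g 1 - g 0.
Proof.
move=> cf dg.
have cg (t : R) : 0 <= t <= 1 -> {for t, continuous g}.
  by move=> t01; apply/differentiable_continuous/derivable1_diffP; case: (dg t t01).
rewrite /int01 /Rintegral (@continuous_FTC2 _ f g 0 1 ltr01 cf)//.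
- split.
  + by move=> t; rewrite in_itv/= => /andP[t0 t1]; case: (dg t _); rewrite ?ltW.
  + by apply: cvg_at_right_filter; apply: cg; rewrite lexx ler01.
  + by apply: cvg_at_left_filter; apply: cg; rewrite lexx ler01.
move=> t; rewrite in_itv/= => /andP[t0 t1]; rewrite derive1E.
by apply: (@derive_val _ _ _ _ _ _ _ (dg t _)); rewrite !ltW.
Qed.

End UnitIntegral.

(** * Integrals along rays, Hadamard's and Poincare's lemmas *)

Section Parametric.
Context {R : realType} {n : nat}.
Implicit Types (x v a : 'rV[R]_n) (h : 'rV[R]_n -> R).

Lemma differentiable_approx (V : normedModType R) (f T : V -> R) (x : V) :
  differentiable T x ->
  (forall e : R, 0 < e -> \forall w \near (0 : V),
     `|f (x + w) - f x - (T (x + w) - T x)| <= e * `|w|) ->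
  differentiable f x /\ forall w : V, 'D_w f x = 'D_w T x.
Proof.
move=> dT H; pose e := f - T.
have cl0 : continuous (\0 : V -> R) by move=> y; exact: cst_continuous.
have E : e \o shift x = cst (e x) + \0 +o_ 0 id.
  apply/eqaddoP => _/posnumP[eps]; near=> v.
  have : `|f (x + v) - f x - (T (x + v) - T x)| <= eps%:num * `|v|.
    by near: v; exact: H.
  rewrite /e !fctE /= [v + x]addrC addr0; apply: le_trans.
  by rewrite le_eqVlt; apply/orP; left; apply/eqP; congr `|_|; ring.
have d0 : 'd e x = \0 :> (V -> R) by exact: diff_unique.
have de : differentiable e x by apply/diff_locallyP; rewrite d0.
have fE : f = e + T by rewrite /e subrK.
split; first by rewrite fE; exact: differentiableD.
move=> v; rewrite fE deriveD; [|exact: diff_derivable|exact: diff_derivable].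
by rewrite deriveE// d0 add0r.
Unshelve. all: by end_near. Qed.

Variables (c : 'rV[R]_n) (r : R).
Local Notation B := (ball c r).

Lemma ball_star t x : 0 <= t <= 1 -> B x -> B (c + t *: (x - c)).
Proof.
move=> /andP[t0 t1]; rewrite -ball_normE /ball_/= => cx.
rewrite opprD addrA subrr sub0r normrN normrZ ger0_norm//.
by apply: le_lt_trans cx; rewrite distrC ler_piMl.
Qed.

Lemma derive_coord (x v : 'rV[R]_n) l : 'D_v (fun y : 'rV[R]_n => y 0 l) x = v 0 l.
Proof.
have := @derive_mx R 'rV[R]_n 1 n id x v.
move=> /(_ _)/(congr1 (fun M : 'rV[R]_n => M 0 l)).
by rewrite derive_id mxE => ->//; exact: derivable_id.
Qed.

Lemma open_B : open B. Proof. exact: ball_open. Qed.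

(** Each differentiation in x brings out a factor t, hence the weights t^m. *)
Definition pint m h x : R := int01 (fun t => t ^+ m * h (c + t *: (x - c))).

Lemma segment_cvg (t0 : R) x0 (Q : 'rV[R]_n -> Prop) :
  (\forall y \near c + t0 *: (x0 - c), Q y) ->
  \forall t \near t0 & x \near x0, Q (c + t *: (x - c)).
Proof.
move=> nQ.
have cv : (fun z : R * 'rV[R]_n => c + z.1 *: (z.2 - c)) @ (t0, x0) -->
    c + t0 *: (x0 - c).
  apply: cvgD; first exact: cvg_cst.
  apply: cvgZ; first exact: cvg_fst.
  by apply: cvgB; [exact: cvg_snd|exact: cvg_cst].
exact: cv _ nQ.
Qed.

Lemma segment_cvg1 (t0 : R) x0 (Q : 'rV[R]_n -> Prop) :
  (\forall y \near c + t0 *: (x0 - c), Q y) ->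
  \forall t \near t0, Q (c + t *: (x0 - c)).
Proof.
move=> nQ.
have cv : (fun t : R => c + t *: (x0 - c)) @ t0 --> c + t0 *: (x0 - c).
  apply: cvgD; first exact: cvg_cst.
  by apply: cvgZl; exact: cvg_id.
exact: cv _ nQ.
Qed.

Lemma scale_cvg (t0 : R) (Q : 'rV[R]_n -> Prop) :
  (\forall y \near (0 : 'rV[R]_n), Q y) ->
  \forall t \near t0 & v \near (0 : 'rV[R]_n), Q (t *: v).
Proof.
move=> nQ.
have cv : (fun z : R * 'rV[R]_n => z.1 *: z.2) @ (t0, (0 : 'rV[R]_n)) --> t0 *: (0 :
    'rV[R]_n).
  by apply: cvgZ; [exact: cvg_fst|exact: cvg_snd].
by rewrite scaler0 in cv; exact: cv _ nQ.
Qed.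

Lemma cont_integrand m h x : Ck 0 B h -> B x ->
  {within `[0, 1]%classic, continuous (fun t : R => t ^+ m * h (c + t *: (x - c)))}.
Proof.
move=> ch Bx; apply: continuous_in_subspaceT => t; rewrite inE /= in_itv/= => t01.
apply: cvgM; first exact: exprn_continuous.
have cv : (fun t : R => c + t *: (x - c)) @ t --> c + t *: (x - c).
  apply: cvgD; first exact: cvg_cst.
  by apply: cvgZl; exact: cvg_id.
apply: (cvg_comp _ _ cv); exact: (ch _ (ball_star t01 Bx)).
Qed.

Lemma within_mulr (k : R) (g : R -> R) (A : set R) :
  {within A, continuous g} -> {within A, continuous (fun t => k * g t)}.
Proof. by move=> cg t; apply: continuousM; [exact: cst_continuous|exact: cg]. Qed.

Lemma within_addr (f g : R -> R) (A : set R) :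
  {within A, continuous f} -> {within A, continuous g} ->
  {within A, continuous (fun t => f t + g t)}.
Proof. by move=> cf cg t; apply: continuousD; [exact: cf|exact: cg]. Qed.

Lemma continuous_pint m h : Ck 0 B h -> Ck 0 B (pint m h).
Proof.
move=> ch x0 Bx0; suff : pint m h @ x0 --> pint m h x0 by [].
apply/(@cvgrPdist_le R _ _ (nbhs x0) (nbhs_filter x0)) => e e0.
have I01 := @segment_compact R 0 1.
have e2 : 0 < e / 2%:R by rewrite divr_gt0.
have near_all : \forall x \near x0, `[0, 1]%classic `<=` (fun t : R =>
    `|h (c + t *: (x0 - c)) - h (c + t *: (x - c))| <= e).
  apply: (proj1 (compact_near_coveringP _) I01 'rV[R]_n (nbhs x0) _ (nbhs_filter _)).
  move=> t0 /=; rewrite in_itv/= => t01.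
  have := ch _ (ball_star t01 Bx0) => /cvgrPdist_le/(_ _ e2) nh.
  have [[P Q] /= [nP nQ] PQ] := segment_cvg nh; have nt := segment_cvg1 nh.
  near=> t x => /=.
  have h1 : `|h (c + t0 *: (x0 - c)) - h (c + t *: (x - c))| <= e / 2%:R.
    have Pt : P t by near: t.
    have Qx : Q x by near: x.
    exact: (PQ (t, x)).
  have h2 : `|h (c + t0 *: (x0 - c)) - h (c + t *: (x0 - c))| <= e / 2%:R.
    by near: t.
  rewrite [e]splitr (_ : _ - _ = (h (c + t0 *: (x0 - c)) - h (c + t *: (x - c))) -
    (h (c + t0 *: (x0 - c)) - h (c + t *: (x0 - c)))); last by ring.
  by apply: le_trans (ler_normB _ _) _; rewrite lerD.
have nB : \forall x \near x0, B x by apply: open_nbhs_nbhs; split=> //; exact: open_B.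
near=> x.
have Bx : B x by near: x.
have hx : `[0, 1]%classic `<=` (fun t : R =>
    `|h (c + t *: (x0 - c)) - h (c + t *: (x - c))| <= e) by near: x.
have c1 := cont_integrand (m:=m) ch Bx0; have c2 := cont_integrand (m:=m) ch Bx.
have -> : pint m h x0 - pint m h x = int01 (fun t : R =>
    t ^+ m * h (c + t *: (x0 - c)) + (-1) * (t ^+ m * h (c + t *: (x - c)))).
  by rewrite int01D ?int01Z ?mulN1r//; exact: within_mulr.
apply: int01_norm.
  exact: within_addr c1 (within_mulr (k:=-1) c2).
move=> t t01; rewrite mulN1r -mulrBr normrM.
apply: (@le_trans _ _ `|h (c + t *: (x0 - c)) - h (c + t *: (x - c))|).
  rewrite ler_piMl// normrX; case/andP: t01 => t0 t1.
  by rewrite ger0_norm// exprn_ile1.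
by apply: hx; rewrite /= in_itv.
Unshelve. all: by end_near. Qed.

Lemma int01_sum (I : Type) (s : seq I) (F : I -> R -> R) :
  (forall i, {within `[0, 1]%classic, continuous (F i)}) ->
  {within `[0, 1]%classic, continuous (fun t => \sum_(i <- s) F i t)} /\
  int01 (fun t => \sum_(i <- s) F i t) = \sum_(i <- s) int01 (F i).
Proof.
move=> cF; elim: s => [|i s [cs IH]].
  rewrite big_nil (_ : (fun t => _) = cst 0); last by apply/funext => t; rewrite big_nil.
  split; first by move=> x; exact: cst_continuous.
  have c0 : {within `[0, 1]%classic, continuous (cst 0 : R -> R)}.
    by move=> x; exact: cst_continuous.
  have := int01Z 0 c0.
  move=> H0; transitivity (int01 (fun t : R => 0 * (cst 0 : R -> R) t)).
    by apply: int01_eq => t _; rewrite mul0r.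
  by rewrite H0 mul0r.
rewrite big_cons (_ : (fun t => _) = (fun t => F i t + \sum_(j <- s) F j t)); last first.
  by apply/funext => t; rewrite big_cons.
split; first by move=> x; apply: continuousD; [exact: cF|exact: cs].
by rewrite int01D// IH.
Qed.

(** T is the linear candidate for the derivative. The remainder is estimated uniformly in t by
    covering the unit interval with the neighborhoods of [strict_diff]. *)
Lemma derive_pint m h x0 : Ck 1 B h -> B x0 ->
  differentiable (pint m h) x0 /\
  forall v, 'D_v (pint m h) x0 = \sum_l v 0 l * pint m.+1 (partial l h) x0.
Proof.
move=> Ch Bx0; have ch := CkS Ch; have [dh Dh] := Ch.
pose C l := pint m.+1 (partial l h) x0.
pose T (x : 'rV[R]_n) := \sum_l C l * x 0 l.
have CT : Ck 1 setT T.
  apply: Ck_sum openT _ => l; apply: (CkZ (C l) openT).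
  exact: Ck_coord openT (smooth_id _ _).
have dT x : differentiable T x by have [dT _] := CT; exact: dT.
have cD l : Ck 0 B (partial l h) by exact: Dh.
have [||dp Dp] := @differentiable_approx _ (pint m h) T x0; first exact: dT.
  move=> e e0.
  have near_all : \forall v \near (0 : 'rV[R]_n), `[0, 1]%classic `<=` (fun t : R =>
      0 <= t <= 1 -> `|h (c + t *: (x0 - c) + t *: v) - h (c + t *: (x0 - c)) -
                        'D_(t *: v) h (c + t *: (x0 - c))| <= e * `|v|).
    have I01 := @segment_compact R 0 1.
    apply: (proj1 (compact_near_coveringP _) I01 'rV[R]_n (nbhs (0 : 'rV[R]_n)) _
        (nbhs_filter _)).
    move=> t0 /=; rewrite in_itv/= => t01.
    have SD := strict_diff open_B Ch (ball_star t01 Bx0) e0.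
    case: SD => -[P Q] /= [nP nQ] PQ.
    have [[P' Q'] /= [nP' nQ'] PQ'] := scale_cvg t0 nQ; have nt := segment_cvg1 nP.
    near=> t v => /= t01'.
    have Pt : P' t by near: t.
    have Qv : Q' v by near: v.
    have Hv := PQ (c + t *: (x0 - c), t *: v).
    have {}Hv := Hv _; rewrite /= in Hv; apply: (le_trans (Hv _)).
      split; first by near: t.
      exact: (PQ' (t, v)).
    apply: ler_wpM2l; [exact: ltW|rewrite normrZ].
    by case/andP: t01' => t0' t1'; rewrite ger0_norm// ler_piMl.
  have nB : \forall v \near (0 : 'rV[R]_n), B (x0 + v).
    have cv : (fun v : 'rV[R]_n => x0 + v) @ (0 : 'rV[R]_n) --> x0 + 0.
      by apply: (@continuousD R _ _ (cst x0) id); [exact: cst_continuous|exact: cvg_id].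
    by rewrite addr0 in cv; apply: cv; apply: open_nbhs_nbhs; split=> //; exact: open_B.
  near=> v.
  have Bv : B (x0 + v) by near: v.
  have Hv : `[0, 1]%classic `<=` (fun t : R =>
      0 <= t <= 1 -> `|h (c + t *: (x0 - c) + t *: v) - h (c + t *: (x0 - c)) -
                        'D_(t *: v) h (c + t *: (x0 - c))| <= e * `|v|) by near: v.
  have c1 := cont_integrand (m:=m) ch Bx0; have c2 := cont_integrand (m:=m) ch Bv.
  have c3 l := cont_integrand (m:=m.+1) (cD l) Bx0.
  have c4 l : {within `[0, 1]%classic, continuous (fun t : R =>
      v 0 l * (t ^+ m.+1 * partial l h (c + t *: (x0 - c))))}.
    exact: (within_mulr (k:=v 0 l) (c3 l)).
  have [c5 sE] := int01_sum (index_enum 'I_n) c4.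
  have -> : T (x0 + v) - T x0 = int01 (fun t : R => \sum_l
      v 0 l * (t ^+ m.+1 * partial l h (c + t *: (x0 - c)))).
    rewrite sE /T -sumrB; apply: eq_bigr => l _.
    by rewrite int01Z// -/(pint _ _ _) -/(C l) !mxE; ring.
  have -> : pint m h (x0 + v) - pint m h x0 - int01 (fun t : R => \sum_l
      v 0 l * (t ^+ m.+1 * partial l h (c + t *: (x0 - c)))) =
      int01 (fun t : R => t ^+ m * h (c + t *: (x0 + v - c)) + (-1) *
        (t ^+ m * h (c + t *: (x0 - c)) + \sum_l
      v 0 l * (t ^+ m.+1 * partial l h (c + t *: (x0 - c))))).
    rewrite int01D//; last first.
      exact: (within_mulr (k:=-1) (within_addr c1 c5)).
    rewrite int01Z ?int01D//; first by rewrite /pint; ring.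
    exact: within_addr c1 c5.
  apply: int01_norm.
    exact: within_addr c2 (within_mulr (k:=-1) (within_addr c1 c5)).
  move=> t t01.
  have Bt := ball_star t01 Bx0.
  have := Hv t; rewrite /= in_itv/= => /(_ t01 t01); apply: le_trans.
  have -> : c + t *: (x0 + v - c) = c + t *: (x0 - c) + t *: v.
    by rewrite addrAC scalerDr addrA.
  rewrite derive_partial_sum; last exact: dh.
  set b := c + t *: (x0 - c).
  have -> : \sum_l v 0 l * (t ^+ m.+1 * partial l h b) = t ^+ m * \sum_l (t *: v) 0 l *
      partial l h b.
    by rewrite mulr_sumr; apply: eq_bigr => l _; rewrite !mxE exprS; ring.
  rewrite mulN1r opprD addrA -mulrBr -mulrBr normrM ler_piMl// normrX.
  by case/andP: t01 => t0 t1; rewrite ger0_norm// exprn_ile1.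
split=> // v; rewrite Dp.
have dc l : derivable (fun x : 'rV[R]_n => C l * x 0 l) x0 v.
  have dl : differentiable (fun x : 'rV[R]_n => x 0 l) x0 by exact: differentiable_coord.
  by apply: diff_derivable; exact: (differentiableZ (C l) dl).
have -> : T = \sum_l (fun x : 'rV[R]_n => C l * x 0 l).
  by apply/funext => x; rewrite fct_sumE.
rewrite derive_sum//; apply: eq_bigr => l _.
have dl : differentiable (fun x : 'rV[R]_n => x 0 l) x0 by exact: differentiable_coord.
have dvl : derivable (fun x : 'rV[R]_n => x 0 l) x0 v by exact: diff_derivable.
rewrite (deriveZ (C l) dvl) derive_coord.
by rewrite /GRing.scale /= mulrC.
Unshelve. all: by end_near. Qed.

Lemma Ck_pint k m h : Ck k B h -> Ck k B (pint m h).
Proof.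
elim: k m h => [|k IH] m h Ch; first exact: continuous_pint.
have C1 : Ck 1 B h by elim: k {IH} Ch => // k IH' /CkS.
split=> [x Bx|v]; first by have [] := derive_pint m C1 Bx.
apply: (@Ck_ext _ _ _ _ _ (fun x => \sum_l v 0 l *: pint m.+1 (partial l h) x)); first
    exact: open_B.
  by move=> x Bx; have [_ ->] := derive_pint m C1 Bx.
apply: Ck_sum open_B _ => l; apply: (CkZ _ open_B); apply: IH.
by have [_] := Ch; exact.
Qed.

Lemma partial_pint m h l x : Ck 1 B h -> B x ->
  partial l (pint m h) x = pint m.+1 (partial l h) x.
Proof.
move=> Ch Bx; rewrite /partial; have [_ ->] := derive_pint m Ch Bx.
rewrite (bigD1 l)//= big1 ?addr0 => [|j jl].
  by rewrite mxE !eqxx mul1r.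
by rewrite mxE (negPf jl) andbF mul0r.
Qed.

Lemma hadamard f x : smooth_on B f -> B x ->
  f x = f c + \sum_l (x 0 l - c 0 l) * pint 0 (partial l f) x.
Proof.
move=> sf Bx; have [df Df] := sf 1%N.
have c1 l : Ck 0 B (partial l f) by exact: Df.
have c2 l : {within `[0, 1]%classic, continuous (fun t : R =>
    (x 0 l - c 0 l) * (t ^+ 0 * partial l f (c + t *: (x - c))))}.
  exact: (within_mulr (k:=x 0 l - c 0 l) (cont_integrand (m:=0) (c1 l) Bx)).
have [c3 sE] := int01_sum (index_enum 'I_n) c2.
have d (t : R) : 0 <= t <= 1 -> is_derive t 1 (fun t => f (c + t *: (x - c)))
    (\sum_l (x 0 l - c 0 l) * (t ^+ 0 * partial l f (c + t *: (x - c)))).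
  move=> t01; have Bt := ball_star t01 Bx.
  apply: is_derive_eq (is_derive_line (df _ Bt)) _.
  rewrite derive_partial_sum; last exact: df.
  by apply: eq_bigr => l _; rewrite !mxE expr0 mul1r.
have := int01_FTC c3 d; rewrite sE scale1r scale0r addr0 [c + _]addrC subrK => e.
rewrite -[LHS](subrK (f c)) -e addrC; congr (_ + _); apply: eq_bigr => l _.
rewrite int01Z//; exact: (cont_integrand (m:=0) (c1 l) Bx).
Qed.

(** F integrates the form along rays from c. By closedness its k-th partial derivative is the
    integral over t of the derivative of t w_k(c + t (x - c)). *)
Lemma poincare (w : 'I_n -> 'rV[R]_n -> R) :
  (forall l, smooth_on B (w l)) ->
  (forall k l x, B x -> partial k (w l) x = partial l (w k) x) ->
  exists2 F, smooth_on B F & forall k x, B x -> partial k F x = w k x.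
Proof.
move=> sw cw.
pose F x := \sum_l (x 0 l - c 0 l) * pint 0 (w l) x.
have sc l k : Ck k B (fun x : 'rV[R]_n => x 0 l - c 0 l).
  apply: CkB open_B _ (Ck_cst _ _ _); exact: Ck_coord open_B (smooth_id _ _).
exists F => [k|k x Bx].
  apply: Ck_sum open_B _ => l; exact: (CkM open_B (sc l k) (Ck_pint 0 (sw l k))).
have dsc l : differentiable (fun x : 'rV[R]_n => x 0 l - c 0 l) x.
  by have [d _] := sc l 1%N; exact: d.
have dpi l : differentiable (pint 0 (w l)) x.
  by have [d _] := Ck_pint 0 (sw l 1%N); exact: d.
have FE : F = \sum_l ((fun x : 'rV[R]_n => x 0 l - c 0 l) * pint 0 (w l)).
  by apply/funext => y; rewrite fct_sumE.
rewrite /partial FE derive_sum => [|l]; last first.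
  by apply: derivableM; exact: diff_derivable.
have term l : 'D_(delta_mx 0 k) ((fun x : 'rV[R]_n => x 0 l - c 0 l) * pint 0 (w l)) x =
    (x 0 l - c 0 l) * pint 1 (partial l (w k)) x + (l == k)%:R * pint 0 (w l) x.
  rewrite deriveM; [|exact: diff_derivable|exact: diff_derivable].
  rewrite -/(partial k (pint 0 (w l)) x) partial_pint//; last exact: (sw l 1%N).
  transitivity ((x 0 l - c 0 l) * pint 1 (partial k (w l)) x +
      pint 0 (w l) x * 'D_(delta_mx 0 k) (fun x0 : 'rV[R]_n => x0 0 l - c 0 l) x);
          first by [].
  have -> : pint 1 (partial k (w l)) x = pint 1 (partial l (w k)) x.
    by apply: int01_eq => t t01; rewrite cw//; exact: ball_star.
  rewrite [in LHS](mulrC (pint 0 (w l) x)); congr (_ + _ * _).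
  have dl : derivable (fun x : 'rV[R]_n => x 0 l) x (delta_mx 0 k).
    by apply: diff_derivable; exact: differentiable_coord.
  have -> : (fun x : 'rV[R]_n => x 0 l - c 0 l) =
      (fun x : 'rV[R]_n => x 0 l) - cst (c 0 l) by [].
  have dc0 : derivable (cst (c 0 l) : 'rV[R]_n -> R) x (delta_mx 0 k).
    by apply: diff_derivable; exact: differentiable_cst.
  rewrite deriveB//.
  by rewrite derive_coord derive_cst subr0 mxE eqxx.
rewrite (eq_bigr _ (fun l _ => term l)) big_split/=.
rewrite [X in _ + X](bigD1 k)//= eqxx mul1r [X in _ + (_ + X)]big1 ?addr0; last first.
  by move=> l /negPf ->; rewrite mul0r.
have ck l : Ck 0 B (partial l (w k)) by have [_ D] := sw k 1%N; exact: D.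
have c2 l : {within `[0, 1]%classic, continuous (fun t : R =>
    (x 0 l - c 0 l) * (t ^+ 1 * partial l (w k) (c + t *: (x - c))))}.
  exact: (within_mulr (k:=x 0 l - c 0 l) (cont_integrand (m:=1) (ck l) Bx)).
have [c3 sE] := int01_sum (index_enum 'I_n) c2.
have c4 := cont_integrand (m:=0) (sw k 0%N) Bx.
have -> : \sum_l (x 0 l - c 0 l) * pint 1 (partial l (w k)) x + pint 0 (w k) x =
    int01 (fun t : R => \sum_l (x 0 l - c 0 l) * (t ^+ 1 * partial l (w k) (c + t *: (x
        - c))) +
      t ^+ 0 * w k (c + t *: (x - c))).
  rewrite int01D// sE; congr (_ + _); apply: eq_bigr => l _.
  rewrite int01Z//; exact: (cont_integrand (m:=1) (ck l) Bx).
have cfg := within_addr c3 c4.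
have dg (t : R) : 0 <= t <= 1 -> is_derive t 1 (fun t => t * w k (c + t *: (x - c)))
    (\sum_l (x 0 l - c 0 l) * (t ^+ 1 * partial l (w k) (c + t *: (x - c))) +
      t ^+ 0 * w k (c + t *: (x - c))).
  move=> t01; have Bt := ball_star t01 Bx.
  have [dw _] := sw k 1%N.
  have d1 := is_derive_line (dw _ Bt).
  apply: is_derive_eq (is_deriveM (is_derive_id t (1 : R)) d1) _.
  rewrite derive_partial_sum; last exact: dw.
  rewrite [LHS](_ : _ = t * (\sum_(l < n) (x - c) 0 l * partial l (w k) (c + t *: (x -
      c))) +
    w k (c + t *: (x - c)) * 1)//.
  rewrite mulr1 expr0 mul1r; congr (_ + _).
  by rewrite mulr_sumr; apply: eq_bigr => l _; rewrite !mxE expr1; ring.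
by rewrite (int01_FTC cfg dg) mul0r subr0 mul1r scale1r [c + _]addrC subrK.
Qed.

End Parametric.

(** * Smooth functions and operators defined locally *)

Lemma near_open (T : topologicalType) (p : T) (Q : T -> Prop) :
  (\forall q \near p, Q q) -> exists2 U, open U /\ U p & forall q, U q -> Q q.
Proof. by rewrite /prop_near1 nbhsE => -[U oU UQ]; exists U. Qed.

Section Patching.
Context {R : realType} {n : nat} (M : manifold R n).
Local Notation A := (cinf M).
Local Notation L := (Dop M).
Implicit Types (f g h u v : A) (D : L) (i j : idx M) (p q : M).

Lemma smooth_fun_sub (U V : set M) (f : M -> R) : V `<=` U ->
  smooth_fun U f -> smooth_fun V f.
Proof. by move=> VU sf i k; apply: Ck_sub (sf i k) => x [rx /VU]. Qed.

Lemma smooth_fun_ext (U : set M) (f g : M -> R) : open U ->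
  (forall p, U p -> f p = g p) -> smooth_fun U f -> smooth_fun U g.
Proof.
move=> oU fg sf i k; apply: Ck_ext (sf i k); first exact: preimage_param_open.
by move=> x [rx Ux]; exact: fg.
Qed.

Lemma smooth_fun_local (U : set M) (f : M -> R) :
  (forall p, U p -> exists2 V, V p & smooth_fun V f) -> smooth_fun U f.
Proof.
move=> H i k; apply: Ck_local => x [rx Ux].
have [V Vx sV] := H _ Ux; exists (rng i `&` param i @^-1` V) => //; exact: sV.
Qed.

Lemma smooth_fun_chart i (B : set 'rV[R]_n) (f : M -> R) : open B -> B `<=` rng i ->
  smooth_on B (f \o param i) -> smooth_fun (dom i `&` chart i @^-1` B) f.
Proof.
move=> oB Br sf j k.
have oD := @preimage_param_open R n M j _ (@preimage_chart_open R n M i _ oB).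
have cs : Ck k (rng j `&` param j @^-1` (dom i `&` chart i @^-1` B)) (chart i \o param j).
  by apply: Ck_sub (chart_compat j i k) => x [rx [dx _]].
apply: Ck_ext (Ck_comp oD _ cs (sf k)) => // x [rx [dx Bx]] //=.
by rewrite chartK.
Qed.

Lemma smooth_fun_cinf f : smooth_fun setT f.
Proof. by case: f => f /= /cinf_predP. Qed.

Lemma cinf_on f (U : set M) : smooth_fun U f.
Proof. by apply: smooth_fun_sub (smooth_fun_cinf f). Qed.

Lemma chart_comp i f p : dom i p -> (f \o param i) (chart i p) = f p.
Proof. by move=> dp; rewrite /= chartK. Qed.

Lemma cinf_continuous f : continuous (f : M -> R).
Proof.
move=> p; have [i dp] := dom_cover p.
have cf : (f \o param i) \o chart i @ p --> f p.
  rewrite -(chart_comp f dp).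
  have c2 : {for chart i p, continuous (f \o param i)} by have := cinfP f i 0%N => /(_
      _ (chart_rng dp)).
  exact: (continuous_comp (chart_continuous dp) c2).
apply: cvg_trans cf; apply: near_eq_cvg.
by apply: filterS (open_nbhs_nbhs (conj (dom_open i) dp)) => q dq; rewrite /= chartK.
Qed.

Definition chart_ext i (F : 'rV[R]_n -> R) : M -> R :=
  fun p => if `[< dom i p >] then F (chart i p) else 0.

Lemma chart_extE i F p : dom i p -> chart_ext i F p = F (chart i p).
Proof. by move=> dp; rewrite /chart_ext asboolT. Qed.

Lemma chart_ext_param i F x : rng i x -> chart_ext i F (param i x) = F x.
Proof. by move=> rx; rewrite chart_extE ?paramK//; exact: param_dom. Qed.

Lemma param_compact i (K : set 'rV[R]_n) : compact K -> K `<=` rng i ->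
  compact (param i @` K).
Proof.
move=> cK Kr; apply: continuous_compact cK; apply: continuous_in_subspaceT => x.
by rewrite inE => /Kr rx; exact: param_continuous.
Qed.

Lemma param_closed i (K : set 'rV[R]_n) : compact K -> K `<=` rng i ->
  closed (param i @` K).
Proof.
by move=> cK Kr; apply: compact_closed; [exact: pt_hausdorff|exact: param_compact].
Qed.

(** The image of K is compact, hence closed in the Hausdorff space M; the extension is 0 off it and
    is given by the chart near it. *)
Lemma chart_ext_smooth i (K B : set 'rV[R]_n) F : compact K -> open B ->
  K `<=` B -> B `<=` rng i -> smooth_on B F -> (forall x, rng i x -> ~ K x -> F x = 0) ->
  chart_ext i F \in @cinf_pred R n M.
Proof.
move=> cK oB KB Br sF F0; apply/cinf_predP.
have Kr : K `<=` rng i by move=> x /KB/Br.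
apply: smooth_fun_local => p _.
have [Kp|Kp] := pselect ((param i @` K) p).
  case: Kp => x Kx <-.
  exists (dom i `&` chart i @^-1` B).
    by split; [exact/param_dom/Kr|rewrite /= paramK; [exact: KB|exact: Kr]].
  apply: smooth_fun_chart => // k; apply: Ck_ext (sF k) => // y By.
  by rewrite /= chart_ext_param//; exact: Br.
exists (~` (param i @` K)) => //.
have oK : open (~` (param i @` K)) by apply: closed_openC; exact: param_closed.
apply: (smooth_fun_ext oK _ (cinf_on (0 : A) _)) => q nK.
rewrite /chart_ext; case: asboolP => // dq; rewrite F0//; first exact: chart_rng.
by move=> Kq; apply: nK; exists (chart i q) => //; rewrite chartK.
Qed.

Lemma rV_cball_compact (c : 'rV[R]_n) (r : R) : compact [set x | `|x - c| <= r].
Proof.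
have -> : [set x | `|x - c| <= r] = closed_ball_ Num.norm c r.
  by apply/seteqP; split=> x /=; rewrite distrC.
apply: bounded_closed_compact; last exact: closed_closed_ball_.
exists (`|c| + `|r|); split; first exact: num_real.
move=> y ry x /= cx; apply: ltW; apply: le_lt_trans ry.
rewrite -[x](subrK c); apply: le_trans (ler_normD _ _) _; rewrite addrC.
by rewrite lerD2l distrC (le_trans cx) ?ler_norm.
Qed.

Lemma open_closed_ball (B : set 'rV[R]_n) x : open B -> B x ->
  exists2 r : R, 0 < r & forall y, `|y - x| <= r -> B y.
Proof.
move=> oB Bx; have /nbhs_ballP[r /= r0 rB] : nbhs x B by exact: open_nbhs_nbhs.
exists (r / 2%:R); first by rewrite divr_gt0.
move=> y yx; apply: rB; rewrite -ball_normE /ball_/= distrC; apply: le_lt_trans yx _.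
by rewrite ltr_pdivrMr// ltr_pMr// ltr1n.
Qed.

(* Room for cutoff functions, which are 1 on the ball of radius r and vanish off
   the one of radius 2 r. *)
Definition nice i x (r : R) := 0 < r /\ forall y, `|y - x| <= 4%:R * r -> rng i y.

Lemma nice_exists i (B : set 'rV[R]_n) x : open B -> B `<=` rng i -> B x ->
  exists2 r, nice i x r & forall y, `|y - x| <= 4%:R * r -> B y.
Proof.
move=> oB Br Bx; have [r r0 rB] := open_closed_ball oB Bx.
have e : 4%:R * (r / 4%:R) = r by rewrite mulrC divfK.
exists (r / 4%:R); last by rewrite e.
by split=> [|y]; [rewrite divr_gt0|rewrite e => /rB/Br].
Qed.

Lemma nice_le i x r s : 0 < s -> s <= r -> nice i x r -> nice i x s.
Proof.
move=> s0 sr [r0 H]; split=> // y /le_trans ys; apply: H; apply: ys.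
by rewrite ler_pM2l.
Qed.

Lemma nice_center i x r : nice i x r -> rng i x.
Proof. by case=> r0; apply; rewrite subrr normr0 mulr_ge0// ltW. Qed.

Lemma cutoff_subproof i x r (B : set 'rV[R]_n) F : nice i x r -> open B -> B `<=` rng i ->
  (forall y, `|y - x| <= 2%:R * r -> B y) -> smooth_on B F ->
  chart_ext i (fun y => bumpR x r y * F y) \in @cinf_pred R n M.
Proof.
move=> [r0 nr] oB Br KB sF.
apply: (@chart_ext_smooth i [set y | `|y - x| <= 2%:R * r] B) => //; first exact:
    rV_cball_compact.
  move=> k; apply: CkM oB _ (sF k).
  by apply: Ck_sub (smooth_bumpR x r k).
move=> y _ /negP; rewrite -ltNge => /ltW yx; rewrite bumpR0 ?mul0r//.
Qed.

(** The default 0, taken when the extension is not smooth, keeps proofs out of the arguments;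
    [cutoffE] gives the intended value. *)
Definition cutoff i x r F : A :=
  if pselect (chart_ext i (fun y => bumpR x r y * F y) \in @cinf_pred R n M) is left H
  then Cinf H else 0.

Lemma cutoffE i x r B F : nice i x r -> open B -> B `<=` rng i ->
  (forall y, `|y - x| <= 2%:R * r -> B y) -> smooth_on B F ->
  cutoff i x r F = chart_ext i (fun y => bumpR x r y * F y) :> (M -> R).
Proof.
move=> nr oB Br KB sF; rewrite /cutoff; case: pselect => // H.
by have := cutoff_subproof nr oB Br KB sF.
Qed.

Lemma cutoff_rng i x r F : nice i x r -> smooth_on (rng i) F ->
  cutoff i x r F = chart_ext i (fun y => bumpR x r y * F y) :> (M -> R).
Proof.
move=> nr sF; apply: (cutoffE nr (@rng_open R n M i) _ _ sF) => // y yx.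
case: nr => r0 H; apply: H; apply: le_trans yx _.
by rewrite ler_pM2r// ler_nat.
Qed.

Lemma param_ball_nbhs i x r : nice i x r ->
  \forall q \near param i x, dom i q /\ `|chart i q - x| < r.
Proof.
move=> nr; have rx := nice_center nr; have [r0 _] := nr.
have oB : open (ball x r) by exact: ball_open.
apply: (@filterS _ _ _ (dom i `&` chart i @^-1` ball x r)).
  by move=> q [dq]; rewrite /= -ball_normE /ball_/= distrC.
apply: open_nbhs_nbhs; split; first exact: preimage_chart_open.
by split; [exact: param_dom|rewrite /= paramK//; exact: ballxx].
Qed.

Lemma bump_exists p (O : set M) : open O -> O p -> exists (b : A),
  [/\ forall q, 0 <= b q <= 1, \forall q \near p, b q = 1 &
      exists2 K, compact K /\ K `<=` O & forall q, ~ K q -> b q = 0].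
Proof.
move=> oO Op; have [i dp] := dom_cover p.
have [r nr rB] : exists2 r, nice i (chart i p) r &
    forall y, `|y - chart i p| <= 4%:R * r -> (rng i `&` param i @^-1` O) y.
  apply: nice_exists; first exact: preimage_param_open.
    by move=> y [].
  by split; [exact: chart_rng|rewrite /= chartK].
have bE := cutoff_rng nr (fun k => @Ck_cst _ _ _ k (rng i) (1 : R)).
exists (cutoff i (chart i p) r (fun=> 1)); rewrite bE; split.
- move=> q; rewrite /chart_ext; case: asboolP => _; rewrite ?lexx ?ler01//.
  by rewrite mulr1 bumpR_ge0 bumpR_le1.
- have := param_ball_nbhs nr; rewrite chartK//; apply: filterS => q [dq qp].
  by rewrite chart_extE// mulr1 bumpR1//; [case: nr|exact: ltW].
exists (param i @` [set y | `|y - chart i p| <= 2%:R * r]).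
  have le24 y : `|y - chart i p| <= 2%:R * r -> `|y - chart i p| <= 4%:R * r.
    by move=> /le_trans; apply; rewrite ler_pM2r ?ler_nat//; case: nr.
  split; last by move=> _ [y yx <-]; have [] := rB y (le24 _ yx).
  by apply: param_compact; [exact: rV_cball_compact|move=> y /le24/rB[]].
move=> q nK; rewrite /chart_ext; case: asboolP => // dq.
rewrite bumpR0 ?mul0r//; first by case: nr.
apply/ltW; rewrite ltNge; apply/negP => yq; apply: nK.
by exists (chart i q) => //; rewrite chartK.
Qed.

Lemma dop_local D f g p : (\forall q \near p, f q = g q) -> D f p = D g p.
Proof.
case: D => D /= /dop_predP[k [lD hD]] fg.
have [i dp] := dom_cover p; have [U [Lt [oU Ux Ur _ eL]]] := hD i _ (chart_rng dp).
have := eL f _ Ux; have := eL g _ Ux; rewrite !chartK// => -> ->.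
have [W [oW Wp] Wfg] := near_open fg.
have oV := openI oU (@preimage_param_open R n M i _ oW).
apply: eq_bigr => t _; congr (_ * _).
apply: (@partials_ext R n t.2 (U `&` (rng i `&` param i @^-1` W))) => //.
  by move=> y [_ [_ Wy]]; exact: Wfg.
by split=> //; split; [exact: chart_rng|rewrite /= chartK].
Qed.

(** F p represents the wanted function near p, so only the value of F q at q itself has to match F
    p. *)
Lemma glue_cinf (F : M -> A) :
  (forall p, \forall q \near p, F q q = F p q) -> exists f : A, forall p, f p = F p p.
Proof.
move=> HF.
have sF : (fun p => F p p) \in @cinf_pred R n M.
  apply/cinf_predP; apply: smooth_fun_local => p _.
  have [W [oW Wp] WF] := near_open (HF p).
  exists W => //; apply: (smooth_fun_ext oW _ (cinf_on (F p) _)) => q Wq.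
  by rewrite WF.
by exists (Cinf sF).
Qed.

(** The common bound k is what makes the glued operator of finite order. *)
Lemma glue_dop (k : nat) (F : M -> L) : (forall p, diff_order k (F p)) ->
  (forall p, \forall q \near p, forall f, F q f q = F p f q) ->
  exists D : L, forall p f, D f p = F p f p.
Proof.
move=> oF HF.
have sF f : exists g : A, forall p, g p = F p f p.
  by apply: (glue_cinf (F := fun p => F p f)) => p; apply: filterS (HF p) => q /(_ f).
have [D HD] := choice sF.
have dD : D \in @dop_pred R n M.
  apply/dop_predP; exists k; split.
    move=> a f g; apply: cinf_ext => p.
    by rewrite HD linearP !cinfE !HD.
  move=> i x rx; have [_ /(_ i x rx)[U [Lt [oU Ux Ur tL eL]]]] := oF (param i x).
  have [W [oW Wp] WF] := near_open (HF (param i x)).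
  have oV := openI oU (@preimage_param_open R n M i _ oW).
  exists (U `&` (rng i `&` param i @^-1` W)), Lt; split=> //.
  - by move=> y [/Ur].
  - by apply: local_terms_sub tL => // y [].
  move=> f y [Uy [ry Wy]]; rewrite HD WF// eL//.
by exists (MkDop dD).
Qed.

End Patching.

(** * From local expressions to algebraic order *)

Section Order.
Context {R : realType} {n : nat} (M : manifold R n).
Local Notation A := (cinf M).
Local Notation L := (Dop M).

Lemma partials_mul_comm (U : set 'rV[R]_n) (h : 'rV[R]_n -> R) k s : open U ->
  smooth_on U h -> (size s <= k.+1)%N -> exists2 T, local_terms k U T &
    forall (g : 'rV[R]_n -> R) y, smooth_on U g -> U y ->
      partials s (fun z => h z * g z) y - h y * partials s g y = local_expr T g y.
Proof.
move=> oU sh; elim: s k => [|l s IH] k /= sk.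
  by exists nil => // g y _ _; rewrite /local_expr big_nil subrr.
have [T T1 T2] : exists2 T, local_terms k U T & forall (g : 'rV[R]_n -> R) y,
    smooth_on U g -> U y -> partial l (fun z => partials s (fun z => h z * g z) z - h z
        * partials s g z) y =
      local_expr T g y.
  case: k sk => [|k] sk.
    exists nil => // g y _ Uy; rewrite /local_expr big_nil; case: s {IH} sk => // _.
    transitivity (partial l (cst 0 : 'rV[R]_n -> R) y); last exact: derive_cst.
    by congr partial; apply/funext => z /=; rewrite subrr.
  have [T tT eT] := IH k sk.
  have [T' tT' eT'] := partial_expr_along l oU (@smooth_id _ _ U) (fun x Ux => Ux) tT.
  exists T' => // g y sg Uy; rewrite -[RHS](eT' g y sg Uy); apply: near_eq_derive.
  by apply: filterS (open_nbhs_nbhs (conj oU Uy)) => z Uz; exact: eT.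
exists ((partial l h, s) :: T).
  move=> t; rewrite inE => /orP[/eqP->|/T1//]; split; first exact: smooth_partial.
  exact: sk.
move=> g y sg Uy; rewrite /local_expr big_cons -/(local_expr T g y) -T2//=.
have dh : derivable h y (delta_mx 0 l).
  by apply: diff_derivable; exact: smooth_differentiable sh Uy.
have dg : derivable (partials s g : 'rV[R]_n -> R) y (delta_mx 0 l).
  by apply: diff_derivable; apply: smooth_differentiable Uy; exact: smooth_partials.
have dhg : derivable (partials s (fun z => h z * g z) : 'rV[R]_n -> R) y (delta_mx 0 l).
  apply: diff_derivable; apply: smooth_differentiable Uy; apply: smooth_partials => j.
  exact: CkM oU (sh j) (sg j).
have dm : derivable (fun z => h z * partials s g z) y (delta_mx 0 l) by exact:
    (derivableM dh dg).
have -> : partial l (fun z => partials s (fun z0 => h z0 * g z0) z - h z * partials s g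
    z) y =
  partial l (partials s (fun z => h z * g z)) y - partial l (fun z => h z * partials s
      g z) y.
  exact: deriveB dhg dm.
have -> : partial l (fun z => h z * partials s g z) y =
  h y * partial l (partials s g) y + partials s g y * partial l h y.
  exact: deriveM dh dg.
by ring.
Qed.

Lemma diff_order_lie k (D : L) (h : A) : diff_order k.+1 D -> diff_order k (lie D
    (mulop h)).
Proof.
move=> [_ hD]; split; first exact: dop_linear.
move=> i x rx; have [U [T [oU Ux Ur tT eT]]] := hD i x rx.
have sU (f : A) : smooth_on U (f \o param i) by move=> j; apply: Ck_sub (cinfP f i j).
have [T' tT' eT'] : exists2 T', local_terms k U T' & forall (g : 'rV[R]_n -> R) y,
    smooth_on U g -> U y -> local_expr T (fun z => (h \o param i) z * g z) y -
      (h \o param i) y * local_expr T g y = local_expr T' g y.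
  elim: T tT {eT} => [|t T IH] tT.
    by exists nil => // g y _ _; rewrite /local_expr !big_nil mulr0 subrr.
  have [st szt] := tT t (mem_head _ _).
  have [T1 tT1 eT1] := partials_mul_comm oU (sU h) szt.
  have [|T2 tT2 eT2] := IH; first by move=> u uT; apply: tT; rewrite inE uT orbT.
  exists ([seq (fun z => t.1 z * u.1 z, u.2) | u <- T1] ++ T2).
    apply: local_terms_cat => // _ /mapP[u /tT1[su szu] ->]; split=> // j.
    exact: CkM oU (st j) (su j).
  move=> g y sg Uy; rewrite /local_expr !big_cons big_cat /= big_map.
  rewrite -!/(local_expr _ _ _) -(eT2 _ _ sg Uy).
  have -> : \sum_(j <- T1) t.1 y * j.1 y * partials j.2 g y = t.1 y * local_expr T1 g y.
    by rewrite mulr_sumr; apply: eq_bigr => u _; rewrite mulrA.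
  by rewrite -(eT1 g y sg Uy) /=; ring.
exists U, T'; split=> // f y Uy; rewrite -eT'//.
rewrite -eT//.
transitivity (D (h * f) (param i y) - h (param i y) * D f (param i y)); first by [].
by rewrite eT.
Qed.

Lemma diff_order_ordlt k (D : L) : diff_order k D -> ordlt k.+1 D.
Proof.
elim: k D => [|k IH] D oD; last by move=> f; apply: IH; exact: diff_order_lie.
apply/ordlt1P; apply: dop_ext => f; apply: cinf_ext => p.
have [_ hD] := oD; have [i dp] := dom_cover p.
have [U [T [oU Ux Ur tT eT]]] := hD i _ (chart_rng dp).
have E g : D g p = (\sum_(t <- T) t.1 (chart i p)) * g p.
  rewrite -[in LHS](chartK dp) eT// mulr_suml; apply: eq_big_seq => t /tT[_].
  by rewrite leqn0 size_eq0 => /eqP-> /=; rewrite chartK.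
by rewrite dopE cinfE !E cinfE mulr1.
Qed.

Lemma dop_ordlt (D : L) : exists k, ordlt k D.
Proof.
case: D => D DD; have /dop_predP[k oD] := DD; exists k.+1.
exact: diff_order_ordlt.
Qed.

End Order.

(** * Coordinate fields and local frames *)

Section Frames.
Context {R : realType} {n : nat} (M : manifold R n).
Local Notation A := (cinf M).
Local Notation L := (Dop M).
Implicit Types (f g : A) (i j : idx M).

Lemma partialD i l f g x : rng i x -> partial l ((f + g) \o param i) x =
  partial l (f \o param i) x + partial l (g \o param i) x.
Proof.
move=> rx; rewrite /partial -deriveD//.
  by apply: diff_derivable; exact: smooth_differentiable (cinfP f i) rx.
by apply: diff_derivable; exact: smooth_differentiable (cinfP g i) rx.
Qed.

Lemma partialZ i l (c : R) f x : rng i x -> partial l ((c *: f) \o param i) x =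
  c * partial l (f \o param i) x.
Proof.
move=> rx; transitivity (c *: partial l (f \o param i) x); last by [].
rewrite /partial -deriveZ//.
by apply: diff_derivable; exact: smooth_differentiable (cinfP f i) rx.
Qed.

Lemma partialM i l f g x : rng i x -> partial l ((f * g) \o param i) x =
  partial l (f \o param i) x * g (param i x) + f (param i x) * partial l (g \o param i) x.
Proof.
move=> rx.
have df : derivable (f \o param i) x (delta_mx 0 l).
  by apply: diff_derivable; exact: smooth_differentiable (cinfP f i) rx.
have dg : derivable (g \o param i) x (delta_mx 0 l).
  by apply: diff_derivable; exact: smooth_differentiable (cinfP g i) rx.
have := deriveM df dg => e.
transitivity (f (param i x) * partial l (g \o param i) x + g (param i x) * partial l (f
    \o param i) x).
  exact: e.
by rewrite addrC mulrC.
Qed.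

Lemma smooth_partial_cinf i l f : smooth_on (rng i) (partial l (f \o param i)).
Proof. exact/smooth_partial/cinfP. Qed.

Definition coord_field_fun i x r l f : A := cutoff i x r (partial l (f \o param i)).

Lemma coord_field_funE i x r l f p : nice i x r ->
  coord_field_fun i x r l f p =
  chart_ext i (fun y => bumpR x r y * partial l (f \o param i) y) p.
Proof. by move=> nr; rewrite /coord_field_fun cutoff_rng//; exact: smooth_partial_cinf. Qed.

(** Off the domain of chart i the cutoff vanishes on the open complement of a compact set, where the
    empty list of terms serves. On the domain, the chain rule for the change of charts gives terms
    of order 1. *)
Lemma coord_field_subproof i x r l : nice i x r -> coord_field_fun i x r l \in
    @dop_pred R n M.
Proof.
move=> nr; apply/dop_predP; exists 1%N; split.
  move=> a f g; apply: cinf_ext => p.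
  transitivity (a * coord_field_fun i x r l f p + coord_field_fun i x r l g p); last by [].
  have ef := coord_field_funE l f p nr; have eg := coord_field_funE l g p nr.
  have efg := coord_field_funE l (a *: f + g) p nr.
  apply: (etrans efg); apply: esym; apply: (etrans (congr2 (fun u v => a * u + v) ef eg)).
  apply: esym.
  rewrite /chart_ext; case: asboolP => [dp|_]; last by rewrite mulr0 addr0.
  by rewrite partialD ?partialZ; [ring|exact: chart_rng|exact: chart_rng].
move=> j y ry; set p := param j y.
have [dp|ndp] := pselect (dom i p); last first.
  have cK := @rV_cball_compact R n x (2%:R * r).
  have oK : open (~` (param i @` [set y | `|y - x| <= 2%:R * r])).
    apply: closed_openC; apply: param_closed => // z zx.
    by case: nr => r0; apply; apply: le_trans zx _; rewrite ler_pM2r// ler_nat.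
  exists (rng j `&` param j @^-1` (~` (param i @` [set y | `|y - x| <= 2%:R * r]))),
      nil; split=> //.
  - exact: preimage_param_open.
  - split=> // -[z zx zp]; apply: ndp; rewrite /p -zp; apply: param_dom.
    by case: nr => r0; apply; apply: le_trans zx _; rewrite ler_pM2r// ler_nat.
  move=> f z [rz nz]; rewrite /local_expr big_nil coord_field_funE// /chart_ext.
  case: asboolP => // dz; rewrite bumpR0 ?mul0r//; first by case: nr.
  apply/ltW; rewrite ltNge; apply/negP => yq; apply: nz.
  by exists (chart i (param j z)) => //; rewrite chartK.
pose tau := chart i \o param j; pose sg := chart j \o param i.
pose U := rng j `&` param j @^-1` dom i; pose W := rng i `&` param i @^-1` dom j.
have oU : open U by apply: preimage_param_open; exact: dom_open.
have oW : open W by apply: preimage_param_open; exact: dom_open.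
have stau : smooth_on U tau by exact: chart_compat.
have ssg : smooth_on W sg by exact: chart_compat.
have UW z : U z -> W (tau z).
  move=> [rz dz]; split; first exact: chart_rng.
  by rewrite /tau /= chartK//; exact: param_dom.
have sgl m : smooth_on W (partial l (fun y => sg y 0 m)).
  by apply: smooth_partial => k; exact: Ck_coord.
exists U, [seq (fun z => bumpR x r (tau z) * partial l (fun y => sg y 0 m) (tau z), [:: m])
  | m <- index_enum 'I_n]; split=> //.
- by move=> z [].
- move=> t /mapP[m _ ->]; split=> // k; apply: (CkM oU).
    exact: (Ck_comp (A := setT) oU _ (stau k) (smooth_bumpR x r k)).
  exact: (Ck_comp oU UW (stau k) (sgl m k)).
move=> f z Uz; have [rz dz] := Uz.
rewrite coord_field_funE// chart_extE// /local_expr big_map.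
rewrite -/(tau z); have Wz := UW _ Uz.
have -> : partial l (f \o param i) (tau z) = partial l (fun y => (f \o param j) (sg y))
    (tau z).
  apply: near_eq_derive; apply: filterS (open_nbhs_nbhs (conj oW Wz)) => u [ru du].
  by rewrite /sg /= chartK.
have dsg : differentiable sg (tau z) by exact: smooth_differentiable ssg Wz.
have sz : sg (tau z) = z by rewrite /sg /tau /= chartK ?paramK.
have df : differentiable (f \o param j) (sg (tau z)).
  by rewrite sz; exact: smooth_differentiable (cinfP f j) rz.
rewrite {1}/partial (derive_comp_partial _ dsg df) mulr_sumr.
by apply: eq_bigr => m _; rewrite sz /= mulrA.
Qed.

Definition coord_field i x r l : L :=
  if pselect (coord_field_fun i x r l \in @dop_pred R n M) is left H then MkDop H else 0.

Lemma coord_fieldE i x r l f p : nice i x r -> coord_field i x r l f p =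
  chart_ext i (fun y => bumpR x r y * partial l (f \o param i) y) p.
Proof.
move=> nr; rewrite /coord_field; case: pselect => [H|/(_ (coord_field_subproof l nr))//].
exact: coord_field_funE.
Qed.

Lemma coord_field_in i x r l f y : nice i x r -> `|y - x| <= r ->
  coord_field i x r l f (param i y) = partial l (f \o param i) y.
Proof.
move=> nr yx; have [r0 H] := nr.
rewrite coord_fieldE// chart_ext_param ?bumpR1 ?mul1r//.
by apply: H; apply: le_trans yx _; rewrite ler_peMl ?ler1n// ltW.
Qed.

Lemma derivation_coord_field i x r l : nice i x r -> derivation (coord_field i x r l).
Proof.
move=> nr f g; apply: cinf_ext => p; rewrite !cinfE !coord_fieldE//.
rewrite /chart_ext; case: asboolP => [dp|_]; last by rewrite mul0r mulr0 addr0.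
by rewrite partialM ?chartK//; [ring|exact: chart_rng].
Qed.

Definition coord_fun i x r l : A := cutoff i x r (fun y => y 0 l).

Lemma coord_funE i x r l p : nice i x r ->
  coord_fun i x r l p = chart_ext i (fun y => bumpR x r y * y 0 l) p.
Proof.
move=> nr; rewrite /coord_fun cutoff_rng// => k.
exact: (Ck_coord l (@rng_open R n M i) (smooth_id _ k)).
Qed.

Lemma coord_fun_in i x r l y : nice i x r -> `|y - x| <= r ->
  coord_fun i x r l (param i y) = y 0 l.
Proof.
move=> nr yx; have [r0 H] := nr.
rewrite coord_funE// chart_ext_param ?bumpR1 ?mul1r//.
by apply: H; apply: le_trans yx _; rewrite ler_peMl ?ler1n// ltW.
Qed.

Lemma pint_center (c : 'rV[R]_n) (h : 'rV[R]_n -> R) : pint c 0 h c = h c.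
Proof.
rewrite /pint (int01_eq (g := fun t => h c)) => [|t _]; last first.
  by rewrite expr0 mul1r subrr scaler0 addr0.
have := @int01_FTC R (fun=> h c) (fun t => t * h c).
rewrite mul1r mul0r subr0; apply; first by move=> t; exact: cst_continuous.
move=> t _; have := is_deriveM (is_derive_id t (1 : R)) (is_derive_cst (h c) t (1 : R)).
move=> H; apply: is_derive_eq H _.
transitivity (t * 0 + h c * 1); first by [].
by rewrite mulr0 add0r mulr1.
Qed.

(** By Hadamard's lemma f is, near y, a constant plus the sum of (x_l - y_l) G_l, where G_l(y) is
    the l-th partial derivative. The G_l are cut off to become global functions, which is harmless
    as X only sees germs. *)
Lemma frame_at (X : L) f i x r y : nice i x r -> derivation X -> `|y - x| < r ->
  X f (param i y) =
  \sum_l X (coord_fun i x r l) (param i y) * partial l (f \o param i) y.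
Proof.
move=> nr dX yx; have [r0 Hr] := nr.
have Br : ball x r `<=` rng i.
  move=> z; rewrite -ball_normE /ball_/= distrC => zx; apply: Hr.
  by apply: le_trans (ltW zx) _; rewrite ler_peMl ?ler1n// ltW.
have Bxy : ball x r y by rewrite -ball_normE /ball_/= distrC.
have [s ns sB] := nice_exists (ball_open x r) Br Bxy.
have [s0 Hs] := ns.
pose B := ball y (4%:R * s).
have BB : B `<=` rng i.
  by move=> z; rewrite /B -ball_normE /ball_/= distrC => /ltW/Hs.
have sf : smooth_on B (f \o param i) by move=> k; apply: Ck_sub (cinfP f i k).
pose P l := pint y 0 (partial l (f \o param i)).
have sP l : smooth_on B (P l).
  move=> k; apply: Ck_pint; exact: (smooth_partial l sf k).
pose G l := cutoff i y s (P l).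
have GE l : G l = chart_ext i (fun z => bumpR y s z * P l z) :> (M -> R).
  apply: (cutoffE ns _ BB _ (sP l)); first exact: ball_open.
  move=> z zy; rewrite /B -ball_normE /ball_/= distrC; apply: le_lt_trans zy _.
  by rewrite ltr_pM2r// ltr_nat.
pose q0 := param i y; have ry := nice_center ns.
have dq0 : dom i q0 by exact: param_dom.
pose g : A := f q0 *: (1 : A) + \sum_l (coord_fun i x r l - y 0 l *: (1 : A)) * G l.
have fg : \forall q \near q0, f q = g q.
  apply: filterS (param_ball_nbhs ns) => q [dq qy].
  have Bq : B (chart i q).
    rewrite /B -ball_normE /ball_/= distrC; apply: lt_le_trans qy _.
    by rewrite ler_peMl ?ler1n// ltW.
  have := hadamard sf Bq; rewrite chart_comp// => ->.
  rewrite /g !cinfE mulr1 cinf_sum; congr (_ + _); apply: eq_bigr => l _.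
  rewrite !cinfE mulr1 GE chart_extE// bumpR1 ?mul1r//; last exact: ltW.
  congr ((_ - _) * _); rewrite -[in RHS](chartK dq) coord_fun_in//.
  have : ball x r (chart i q).
    by apply: sB; apply: ltW; apply: lt_le_trans qy _; rewrite ler_peMl ?ler1n// ltW.
  by rewrite -ball_normE /ball_/= distrC => /ltW.
rewrite (dop_local X fg) /g.
have X1 : X (f q0 *: (1 : A)) = 0 by rewrite linearZ_LR /= derivation1// scaler0.
have XS u v : X (u + v) = X u + X v by rewrite linearD.
have Xsum (F : 'I_n -> A) : X (\sum_l F l) = \sum_l X (F l) by rewrite linear_sum.
rewrite XS X1 add0r Xsum cinf_sum; apply: eq_bigr => l _.
have XD u v : X (u - v) = X u - X v by rewrite linearB.
have Xc : X (y 0 l *: (1 : A)) = 0 by rewrite linearZ_LR /= derivation1// scaler0.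
rewrite dX XD Xc subr0 !cinfE mulr1.
rewrite coord_fun_in//; last exact: ltW.
rewrite subrr mul0r addr0 GE chart_extE// /q0 paramK// bumpR1 ?subrr ?normr0 ?mul1r//;
    last exact: ltW.
by rewrite /P pint_center.
Qed.

Lemma manifold_framed : framed M.
Proof.
move=> p; have [i dp] := dom_cover p.
have [r nr _] := nice_exists (@rng_open R n M i) (fun x rx => rx) (chart_rng dp).
have [r0 Hr] := nr; set x := chart i p in nr Hr *.
(* The cutoff of radius r / 2 vanishes off the ball of radius r, on which [frame_at] holds. *)
have r2 : 0 < r / 2%:R by rewrite divr_gt0.
have nr2 : nice i x (r / 2%:R).
  by apply: nice_le nr => //; rewrite ler_pdivrMr// ler_peMr ?ler1n// ltW.
have bE := cutoff_rng nr2 (fun k => @Ck_cst _ _ _ k (rng i) (1 : R)).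
exists (cutoff i x (r / 2%:R) (fun=> 1)), (coord_fun i x r), (coord_field i x r); split.
- by rewrite bE chart_extE// bumpR1 ?mul1r// subrr normr0 ltW.
- by move=> l; exact: derivation_coord_field.
move=> X f dX; apply: cinf_ext => q; rewrite cinf_sum.
set b := cutoff _ _ _ _; have [b0|b0] := eqVneq (b q) 0.
  by rewrite cinfE b0 mul0r big1// => l _; rewrite !cinfE b0 !mul0r.
move: b0; rewrite /b bE /chart_ext; case: asboolP; last by rewrite eqxx.
move=> dq; rewrite mulr1 => b0.
have qx : `|chart i q - x| < r.
  rewrite ltNge; apply: contra b0 => qx; rewrite bumpR0//.
  by rewrite mulrC divfK.
rewrite cinfE -(chartK dq) (frame_at f nr dX qx) mulr_sumr; apply: eq_bigr => l _.
by rewrite !cinfE coord_field_in ?mulrA// ltW.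
Qed.

End Frames.

(** * Proper functions and Milnor's theorem *)

(** [cover_compact] speaks of pointed spaces: a point of K is made the base point, and the empty K
    is treated apart. *)
Lemma compact_subcover (X : topologicalType) (K : set X) (I : choiceType)
    (D : set I) (f : I -> set X) : compact K -> (forall i, D i -> open (f i)) ->
  (forall p, K p -> exists2 i, D i & f i p) ->
  exists2 s : seq I, forall i, i \in s -> D i & forall p, K p -> exists2 i, i \in s & f i p.
Proof.
move=> cK oF KD; have [[p0 _]|K0] := pselect (K !=set0); last first.
  by exists nil => // p Kp; case: K0; exists p.
pose Y : ptopologicalType := HB.pack_for ptopologicalType X (isPointed.Build X p0).
have : @cover_compact Y K by rewrite -(@compact_cover Y).
move=> /(_ I D f oF)[|s sD Ks]; first by move=> p Kp; have [i Di fi] := KD p Kp; exists i.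
exists (finmap.enum_fset s) => [i si|p Kp]; first by have := sD i si; rewrite inE.
by have [i si fi] := Ks p Kp; exists i.
Qed.

Section Functions.
Context {R : realType} {n : nat} (M : manifold R n).
Local Notation A := (cinf M).
Local Notation L := (Dop M).
Implicit Types (f g h : A) (p q : M).

Lemma cinf_inv f : (forall p, f p != 0) -> exists v : A, f * v = 1.
Proof.
move=> f0; have sv : (fun p => (f p)^-1) \in @cinf_pred R n M.
  apply/cinf_predP => i k; have oU := @preimage_param_open R n M i _ openT.
  apply: (CkV oU) => [x _|]; first exact: f0.
  exact: (smooth_fun_cinf f i k).
by exists (Cinf sv); apply: cinf_ext => p; rewrite !cinfE /= divff.
Qed.

Lemma manifold_sqr f : exists v : A, (1 + f ^+ 2) * v = 1.
Proof.
apply: cinf_inv => p; rewrite cinfE cinfX cinfE gt_eqF// ltr_pwDl//.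
exact: sqr_ge0.
Qed.

Lemma cinf_sum_sqr_ge0 (I : Type) (s : seq I) (F : I -> A) p : 0 <= (\sum_(i <- s) F i
    ^+ 2) p.
Proof. by rewrite cinf_sum sumr_ge0// => i _; rewrite cinfX sqr_ge0. Qed.

Lemma cinf_separates p q : (forall f, f p = f q) -> p = q.
Proof.
move=> fpq; apply: contrapT => pq.
have oq : open (~` [set q]).
  by apply: closed_openC; apply: accessible_closed_set1;
      exact/hausdorff_accessible/pt_hausdorff.
have [b [_ b1 [K [_ Kq] b0]]] := bump_exists oq pq.
have := fpq b; rewrite (nbhs_singleton b1) b0; last by move=> /Kq; apply.
by move/eqP; rewrite oner_eq0.
Qed.

Lemma manifold_const (p0 : M) f : connected [set: M] ->
  (forall X : L, derivation X -> X f = 0) -> exists c : R, f = c *: (1 : A).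
Proof.
move=> cM f0; exists (f p0); apply: cinf_ext => p; rewrite cinfE cinfE mulr1.
pose B := [set q | f q = f p0].
have loc q : \forall q' \near q, f q' = f q.
  have [i dq] := dom_cover q.
  have [r nr _] := nice_exists (@rng_open R n M i) (fun x rx => rx) (chart_rng dq).
  have [r0 Hr] := nr; have := param_ball_nbhs nr; rewrite chartK//; apply: filterS.
  set x := chart i q in nr Hr *; move=> q' [dq' q'x].
  rewrite -(chart_comp f dq') -(chart_comp f dq).
  have rr y : ball x r y -> rng i y.
    rewrite -ball_normE /ball_/= distrC => /ltW yx; apply: Hr.
    by apply: le_trans yx _; rewrite ler_peMl ?ler1n// ltW.
  apply: (@partial0_constant R n (f \o param i) x r); last by rewrite -ball_normE
      /ball_/= distrC.
    by move=> y /rr ry; exact: smooth_differentiable (cinfP f i) ry.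
  move=> l y By; have yx : `|y - x| <= r.
    by move: By; rewrite -ball_normE /ball_/= distrC => /ltW.
  by rewrite -(coord_field_in l f nr yx) f0//; exact: derivation_coord_field.
have -> // : B p; suff -> : B = [set: M] by [].
apply: cM; first by exists p0.
  exists B; rewrite ?setTI// openE => q /= Bq; apply: filterS (loc q) => q' e.
  by rewrite /B /= e.
exists B; rewrite ?setTI// -[B]setCK; apply: open_closedC; rewrite openE => q /= Bq.
by apply: filterS (loc q) => q' /= e Bq'; apply: Bq; rewrite /B /= -e.
Qed.

(** For each set U of a countable base on which some compactly supported bump is 1, one such bump is
    kept, at the index c U; the other indices get the pair (0, set0). *)
Lemma bump_sequence : exists (b : nat -> A) (K : nat -> set M),
  (forall m, [/\ forall q, 0 <= b m q <= 1, compact (K m) & forall q, ~ K m q -> b m q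
      = 0]) /\
  forall p, exists m, \forall q \near p, b m q = 1.
Proof.
have [B /countable_injP[c cinj] [Bo Bb]] := pt_second_countable M.
pose good (z : A * set M) (U : set M) := [/\ forall q, 0 <= z.1 q <= 1,
  compact z.2, forall q, ~ z.2 q -> z.1 q = 0 & forall q, U q -> z.1 q = 1].
have [z zP] : {z : nat -> A * set M & forall m, good (z m) set0 /\
    forall U, B U -> c U = m -> (exists z, good z U) -> good (z m) U}.
  apply: (@choice _ _ (fun m z => good z set0 /\
    forall U, B U -> c U = m -> (exists z, good z U) -> good z U)) => m.
  have [[U [BU cU [z gz]]]|nU] := pselect (exists U, [/\ B U, c U = m & exists z, good
      z U]).
    exists z; split; first by case: gz.
    move=> U' BU' cU' _; suff -> : U' = U by [].
    by apply: cinj; rewrite ?inE// cU.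
  exists (0, set0); split; first by split=> //; [move=> q; rewrite /= lexx ler01|exact:
      compact0].
  by move=> U BU cU [z gz]; case: nU; exists U; split=> //; exists z.
exists (fun m => (z m).1), (fun m => (z m).2); split=> [m|p].
  by have [[]] := zP m.
have [b [b01 b1 [K [cK _] b0]]] := bump_exists openT (I : [set: M] p).
have [U [BU Up] Ub] := Bb p _ b1.
have [|_ _ _ z1] := (zP (c U)).2 U BU erefl; first by exists (b, K); split.
exists (c U); apply: filterS (open_nbhs_nbhs (conj (Bo _ BU) Up)) => q; exact: z1.
Qed.

(** g is the sum over m of the products (1 - b 0) ... (1 - b m). Where b k = 1 all terms from k on
    vanish, so the sum is locally finite; off K 0, ..., K m the first m + 1 terms are 1, so g >= m +
    1 there. *)
Lemma proper_function : exists g : A, (forall p, 0 <= g p) /\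
  forall c : R, exists2 K, compact K & forall p, g p <= c -> K p.
Proof.
have [b [K [bK near1]]] := bump_sequence.
have [N NP] := choice near1.
pose t m : A := \prod_(i < m.+1) (1 - b i).
pose S k : A := \sum_(m < k) t m.
have tE m p : t m p = \prod_(i < m.+1) (1 - b i p).
  rewrite /t; elim: m.+1 => [|j IH]; first by rewrite !big_ord0.
  by rewrite big_ord_recr [RHS]big_ord_recr cinfE IH.
have b01 m q : 0 <= b m q <= 1 by have [+ _ _] := bK m; apply.
have t0 m p : 0 <= t m p.
  by rewrite tE; apply: prodr_ge0 => i _; rewrite subr_ge0; have /andP[] := b01 i p.
have tv k m q : (k <= m)%N -> b k q = 1 -> t m q = 0.
  move=> km bk; rewrite tE (bigD1 (inord k : 'I_m.+1))//= inordK ?ltnS// bk subrr.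
  by rewrite mul0r.
have SE k k' q : b k q = 1 -> b k' q = 1 -> S k q = S k' q.
  wlog kk' : k k' / (k <= k')%N => [H|bk _].
    by case: (leqP k k') => [/H|/ltnW/H h ? ?]; [exact|exact/esym/h].
  rewrite /S !cinf_sum -(subnKC kk') big_split_ord /= [X in _ = _ + X]big1 ?addr0// => i _.
  by rewrite (tv k)//= leq_addr.
have [g gE] : exists g : A, forall p, g p = S (N p) p.
  apply: (glue_cinf (F := fun p => S (N p))) => p; apply: filterS (NP p) => q bq.
  by apply: SE => //; exact: nbhs_singleton (NP q).
exists g; split=> [p|c].
  by rewrite gE cinf_sum sumr_ge0.
pose m := Num.truncn `|c|.
have cm : c < m.+1%:R by apply: le_lt_trans (ler_norm _) _; exact: truncnS_gt.
exists (\big[setU/set0]_(i < m.+1) K i).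
  elim: m.+1 => [|j IH]; first by rewrite big_ord0; exact: compact0.
  by rewrite big_ord_recr; apply: compactU => //; have [] := bK j.
move=> p gc; apply: contrapT => nK.
have b0 i : (i < m.+1)%N -> b i p = 0.
  move=> im; have [_ _ ->//] := bK i; move=> Ki; apply: nK.
  by rewrite (bigD1 (Ordinal im))//=; left.
have bN := nbhs_singleton (NP p).
have mN : (m.+1 <= N p)%N.
  by rewrite leqNgt; apply/negP => /b0; rewrite bN => /eqP; rewrite oner_eq0.
move: gc; rewrite leNgt => /negP; apply; apply: (lt_le_trans cm).
rewrite gE cinf_sum -(subnKC mN) big_split_ord /=.
rewrite -[X in X <= _]addr0 lerD ?sumr_ge0//.
rewrite -[X in X%:R](card_ord m.+1) -sumr_const ler_sum// => i _.
rewrite tE big1// => j _; rewrite b0 ?subr0//.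
by rewrite (leq_trans (ltn_ord j)).
Qed.

(* A character of A is an evaluation: otherwise the square of g minus its value,
   plus finitely many squares of functions killed by the character, would be
   invertible, g being proper. *)
Lemma character_point (chi : A -> R) : chi 1 = 1 ->
  (forall f g, chi (f + g) = chi f + chi g) ->
  (forall (c : R) f, chi (c *: f) = c * chi f) ->
  (forall f g, chi (f * g) = chi f * chi g) -> exists p, forall f, chi f = f p.
Proof.
move=> chi1 chiD chiZ chiM; apply: contrapT => np.
have chi0 : chi 0 = 0 by rewrite -(scale0r (0 : A)) chiZ mul0r.
have chiN f : chi (- f) = - chi f by rewrite -scaleN1r chiZ mulN1r.
have chiX f k : chi (f ^+ k) = chi f ^+ k.
  by elim: k => [|k IH]; rewrite ?expr0// !exprS chiM IH.
have sep p : exists h, chi h = 0 /\ h p != 0.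
  apply: contrapT => H; apply: np; exists p => f; apply/eqP/negPn/negP => fp.
  apply: H; exists (f - chi f *: (1 : A)); split.
    by rewrite chiD chiN chiZ chi1 mulr1 subrr.
  by rewrite !cinfE mulr1 subr_eq0 eq_sym.
have [g [g0 gproper]] := proper_function.
have [K cK Kg] := gproper (chi g).
have [h h0|p Kp|D' D'D KD'] := @compact_subcover M K A [set h | chi h = 0] (fun h =>
    [set p | h p != 0]) cK.
- exact: (open_comp (f := h : M -> R) (fun x _ => @cinf_continuous R n M h x)
    (@open_neq R 0)).
- by have [h [h0 hp]] := sep p; exists h.
pose F : A := (g - chi g *: (1 : A)) ^+ 2 + \sum_(h <- D') h ^+ 2.
have chiF : chi F = 0.
  have chisum (s : seq A) : (forall h, h \in s -> chi h = 0) -> chi (\sum_(h <- s) h ^+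
      2) = 0.
    elim: s => [|h s IH] Hs; first by rewrite big_nil.
    rewrite big_cons chiD chiX Hs ?mem_head// expr0n add0r IH// => h' h's.
    by apply: Hs; rewrite inE h's orbT.
  rewrite /F chiD chisum ?addr0 => [|h hD']; last exact: D'D.
  by rewrite chiX chiD chiN chiZ chi1 mulr1 subrr expr0n.
have [v vF] : exists v : A, F * v = 1.
  apply: cinf_inv => p; rewrite /F cinfE cinfX gt_eqF//.
  have [gc|gc] := leP (g p) (chi g).
    have [h hD' hp] := KD' p (Kg p gc); apply: ltr_wpDl; first exact: sqr_ge0.
    rewrite cinf_sum (big_rem h)//; apply: ltr_pwDl.
      by rewrite cinfX lt_def sqr_ge0 expf_eq0 andbT.
    by apply: sumr_ge0 => h' _; rewrite cinfX sqr_ge0.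
  apply: ltr_pwDl; last exact: cinf_sum_sqr_ge0.
  have -> : (g - chi g *: (1 : A)) p = g p - chi g by rewrite !cinfE mulr1.
  by rewrite exprn_gt0// subr_gt0.
have := congr1 chi vF; rewrite chiM chiF mul0r chi1 => /esym/eqP.
by rewrite oner_eq0.
Qed.

(** For continuity take a bump b at phi q supported in the given open set: alpha b is nonzero near
    q, and phi sends the points where it is nonzero into the support. Smoothness is then that of
    alpha applied to cut off coordinates. *)
Lemma pullback_smooth (alpha : A -> A) (phi : M -> M) :
  (forall f q, alpha f q = f (phi q)) -> smooth_map phi.
Proof.
move=> aE; have cphi : continuous phi.
  move=> q U; rewrite nbhsE => -[W [oW Wq] WU].
  have [b [_ b1 [K [_ KW] b0]]] := bump_exists oW Wq.
  have nq : \forall q' \near q, alpha b q' != 0.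
    have c := @cinf_continuous R n M (alpha b) q.
    apply: (c [set y | y != 0]); apply: open_nbhs_nbhs; split; first exact: open_neq.
    by rewrite /= aE (nbhs_singleton b1) oner_eq0.
  apply: filterS nq => q'; rewrite aE => bq; apply: WU; apply: KW.
  by apply: contrapT => /b0 e; rewrite e eqxx in bq.
split=> // i j.
have oW := @preimage_map_open R n M phi i j cphi.
move=> k; apply: Ck_local => x Wx; have [rx dx] := Wx.
have [r nr _] := nice_exists (@rng_open R n M j) (fun x rx => rx) (chart_rng dx).
have [r0 _] := nr.
have oV := @preimage_param_open R n M i _ (open_comp (fun x _ => cphi x)
  (@preimage_chart_open R n M j _ (ball_open (chart j (phi (param i x))) r))).
exists (rng i `&` param i @^-1` (phi @^-1` (dom j `&` chart j @^-1` ball (chart j (phi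
    (param i x))) r))).
  by split=> //; split=> //; exact: ballxx.
apply: (Ck_of_coord oV) => l.
have sa : Ck k (rng i `&` param i @^-1` (phi @^-1` (dom j `&` chart j @^-1` ball (chart
    j (phi (param i x))) r)))
    (alpha (coord_fun j (chart j (phi (param i x))) r l) \o param i).
  by apply: Ck_sub (cinfP _ i k) => y [].
apply: (Ck_ext oV _ sa) => y [ry [dy By]] /=.
rewrite aE -[phi (param i y)](chartK dy) coord_fun_in ?chartK//.
by move: By; rewrite /= -ball_normE /ball_/= distrC => /ltW.
Qed.

(** D is the inverse of phi, because [push D] acts on functions by composition with the inverse of
    D. *)
Lemma pullback_diffeo (alpha beta : A -> A) (phi psi : M -> M) :
  cancel alpha beta -> cancel beta alpha ->
  (forall f q, alpha f q = f (phi q)) -> (forall f q, beta f q = f (psi q)) ->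
  exists D : diffeo M, forall f q, alpha f q = f (Defs.dinv D q).
Proof.
move=> ab ba aE bE.
have pK : cancel psi phi by move=> q; apply: cinf_separates => f; rewrite -aE -bE ab.
have qK : cancel phi psi by move=> q; apply: cinf_separates => f; rewrite -bE -aE ba.
by exists (Diffeo pK qK (pullback_smooth bE) (pullback_smooth aE)).
Qed.

End Functions.

(** * Families without common critical points *)

Section Avoid.
Context {R : realType}.

Lemma truncn_eq_dist (s t : R) : 0 <= s -> 0 <= t -> Num.truncn s = Num.truncn t ->
  `|s - t| <= 1.
Proof.
move=> s0 t0 e; have := truncn_itv s0; have := truncn_itv t0; rewrite e.
move=> /andP[a b] /andP[c d]; rewrite -natr1 in b d.
by rewrite ler_norml; lra.
Qed.

Lemma natr_dist_lt1 (j k : nat) : `|j%:R - k%:R| < 1 :> R -> j = k.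
Proof.
have H (a b : nat) : `|a%:R - b%:R| < 1 :> R -> (a <= b)%N.
  rewrite ltr_norml => /andP[_ h2]; rewrite leqNgt; apply/negP => ba.
  have h3 : b.+1%:R <= a%:R :> R by rewrite ler_nat.
  by move: h3; rewrite -natr1; lra.
by move=> jk; apply/eqP; rewrite eqn_leq !H//; rewrite distrC.
Qed.

(* Pigeonhole: the cube is cut into (K m + 1)^n cells, whose images are too small
   to contain two of the m^(n+1) points of a grid of mesh eps / m. *)
Lemma avoid_image n (F : 'rV[R]_n -> 'I_n.+1 -> R) (c : 'rV[R]_n) (rho C eps : R) :
  0 < rho -> 0 < eps ->
  (forall x y l, `|x - c| <= rho -> `|y - c| <= rho -> `|F y l - F x l| <= C * `|y - x|) ->
  exists a : 'I_n.+1 -> R, (forall l, 0 <= a l <= eps) /\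
    forall x, `|x - c| <= rho -> exists l, F x l != a l.
Proof.
move=> rho0 eps0 lipF; apply: contrapT => H.
have {}H (a : 'I_n.+1 -> R) : (forall l, 0 <= a l <= eps) ->
    exists x, `|x - c| <= rho /\ forall l, F x l = a l.
  move=> a01; apply: contrapT => nx; apply: H; exists a; split=> // x xc.
  apply: contrapT => nl; apply: nx; exists x; split=> // l.
  by apply/eqP/negPn/negP => Fl; apply: nl; exists l.
(* Then the image of a cell of side 2 rho / (K m) has diameter less than the mesh eps / m. *)
pose K := (Num.truncn (2%:R * rho * `|C| / eps)).+1.
have KP : 2%:R * rho * `|C| < K%:R * eps.
  by rewrite -ltr_pdivrMr// truncnS_gt.
(* With this m, (K m + 1)^n <= ((K + 1) m)^n < m^(n + 1): there are more grid points than cells. *)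
pose m := (K.+1 ^ n).+1.
have m0 : 0 < m%:R :> R by rewrite ltr0n.
have K0 : 0 < K%:R :> R by rewrite ltr0n.
pose a (k : {ffun 'I_n.+1 -> 'I_m}) l : R := eps * (k l)%:R / m%:R.
have a01 k l : 0 <= a k l <= eps.
  have km : (k l)%:R <= m%:R :> R by rewrite ler_nat ltnW.
  apply/andP; split; first by rewrite /a divr_ge0 ?mulr_ge0// ltW.
  by rewrite /a ler_pdivrMr// ler_pM2l.
have [x xP] := choice (fun k => H (a k) (a01 k)).
pose t k j := K%:R * m%:R * ((x k 0 j - c 0 j + rho) / (2%:R * rho)).
have rho2 : 0 < 2%:R * rho by rewrite mulr_gt0.
have Km : 0 < K%:R * m%:R :> R by rewrite mulr_gt0.
have xc k j : - rho <= x k 0 j - c 0 j <= rho.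
  rewrite -ler_norml; have [h _] := xP k.
  by have := rV_coord_le (x k - c) j; rewrite !mxE => /le_trans; apply.
have t0 k j : 0 <= t k j.
  have := xc k j => /andP[h1 h2]; apply: mulr_ge0; first exact: ltW.
  by apply: divr_ge0; [lra|exact: ltW].
have t1 k j : (Num.truncn (t k j) < (K * m).+1)%N.
  have := xc k j => /andP[h1 h2]; rewrite truncn_lt_nat//.
  rewrite -natr1 natrM; apply: (@le_lt_trans _ _ (K%:R * m%:R)); last by rewrite ltrDl.
  rewrite /t -[X in _ <= X]mulr1 ler_pM2l//.
  by rewrite ler_pdivrMr// mul1r; lra.
pose cell k : {ffun 'I_n -> 'I_(K * m).+1} := [ffun j => Ordinal (t1 k j)].
have cell_inj : injective cell.
  move=> k k' ekk; apply/ffunP => l; apply/val_inj => /=.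
  have xx : `|x k - x k'| <= 2%:R * rho / (K%:R * m%:R).
    apply/rV_norm_leP => [|j]; first by rewrite divr_ge0 ?ltW.
    have := congr1 (fun z : {ffun 'I_n -> 'I_(K * m).+1} => val (z j)) ekk.
    rewrite !ffunE /= => /(truncn_eq_dist (t0 k j) (t0 k' j)).
    rewrite /t -mulrBr -mulrBl normrM gtr0_norm// mulrC normrM.
    rewrite [`|(2%:R * rho)^-1|]gtr0_norm ?invr_gt0// !mxE.
    rewrite (_ : x k 0 j - c 0 j + rho - _ = x k 0 j - x k' 0 j); last by ring.
    by rewrite -ler_pdivlMr// ler_pdivrMr// mul1r mulrC.
  have aa : `|a k l - a k' l| < eps / m%:R.
    have [h1 e1] := xP k; have [h2 e2] := xP k'; rewrite -e1 -e2.
    apply: (le_lt_trans (lipF _ _ _ h2 h1)).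
    apply: (@le_lt_trans _ _ (`|C| * (2%:R * rho / (K%:R * m%:R)))).
      apply: (@le_trans _ _ (`|C| * `|x k - x k'|)); last exact: ler_wpM2l.
      by apply: ler_wpM2r => //; exact: ler_norm.
    rewrite invfM !mulrA ltr_pM2r ?invr_gt0// ltr_pdivrMr//.
    by move: KP; lra.
  have : `|(k l)%:R - (k' l)%:R| < 1 :> R.
    move: aa; rewrite /a -mulrBl -mulrBr normrM normrM (gtr0_norm eps0).
    rewrite [`|m%:R^-1|]gtr0_norm ?invr_gt0// ltr_pM2r ?invr_gt0//.
    by rewrite -[X in _ < X]mulr1 ltr_pM2l.
  exact: natr_dist_lt1.
have := leq_card cell cell_inj; rewrite !card_ffun !card_ord leqNgt => /negP; apply.
apply: (@leq_ltn_trans ((K.+1 * m) ^ n)).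
  by elim: (X in (_ ^ X <= _ ^ X)%N) => // e IH; rewrite !expnS leq_mul// mulSn -addn1
      addnC leq_add2r.
by rewrite expnMn expnS ltn_pmul2r// expn_gt0.
Qed.
End Avoid.

Section Critical.
Context {R : realType} {n : nat} (M : manifold R n).
Local Notation A := (cinf M).
Local Notation L := (Dop M).
Implicit Types (f g h u : A) (p q : M) (X : L) (i : idx M).
Local Notation N := n.+1.

Lemma coord_field_coord i x (r : R) l m y : nice i x r -> `|y - x| < r ->
  coord_field i x r l (coord_fun i x r m) (param i y) = (m == l)%:R.
Proof.
move=> nr yx; rewrite coord_field_in//; last exact: ltW.
transitivity (partial l (fun z : 'rV[R]_n => z 0 m) y).
  have By : ball x r y by rewrite -ball_normE /ball_/= distrC.
  apply: near_eq_derive; apply: filterS (open_nbhs_nbhs (conj (ball_open x r) By)) => z.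
  by rewrite -ball_normE /ball_/= distrC => /ltW zx; rewrite /= coord_fun_in.
by rewrite /partial derive_coord mxE eqxx.
Qed.

Definition noncritical (fs : 'I_N -> A) p := exists c X, derivation X /\ X (fs c) p != 0.

Lemma noncritical_perturb (K : set M) fs u : compact K ->
  (forall p, K p -> noncritical fs p) -> exists2 e : R, 0 < e &
  forall a : 'I_N -> R, (forall c, 0 <= a c <= e) -> forall p, K p ->
    noncritical (fun c => fs c + a c *: u) p.
Proof.
move=> cK Kfs.
have near_all : \forall e \near (0 : R), K `<=` (fun p =>
    forall a : 'I_N -> R, (forall c, 0 <= a c <= e) -> noncritical (fun c => fs c + a c
        *: u) p).
  apply: (proj1 (compact_near_coveringP _) cK R (nbhs (0 : R)) _ (nbhs_filter _)).
  move=> p /Kfs[c [X [dX Xp]]].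
  have cv : (fun z : M * R => X (fs c) z.1 + z.2 * X u z.1) @ (p, (0 : R)) -->
      X (fs c) p + 0 * X u p.
    have cf (f : A) : (fun z : M * R => f z.1) @ (p, (0 : R)) --> f p.
      by apply: (@cvg_comp _ _ _ (@fst M R) (f : M -> R) _ (nbhs p) _ cvg_fst); exact:
          cinf_continuous.
    by apply: cvgD => //; apply: cvgM => //; exact: cvg_snd.
  rewrite mul0r addr0 in cv.
  have o0 : nbhs (X (fs c) p) [set y : R | y != 0].
    by apply: open_nbhs_nbhs; split; first exact: open_neq.
  have [[P Q] /= [nP nQ] PQ] := cv _ o0.
  have /nbhs_ballP[d /= d0 dQ] := nQ.
  have d2 : 0 < d / 2%:R by rewrite divr_gt0.
  exists (P, ball (0 : R) d); first by split=> //; apply: nbhsx_ballx.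
  move=> [q e] /= [Pq]; rewrite -ball_normE /ball_/= sub0r normrN => ed a ae.
  exists c, X; split=> //.
  have -> : X (fs c + a c *: u) q = X (fs c) q + a c * X u q.
    by rewrite linearD linearZ_LR.
  apply: (PQ (q, a c)); split=> //; apply: dQ.
  have /andP[a0 a1] := ae c; rewrite -ball_normE /ball_/= sub0r normrN ger0_norm//.
  by apply: le_lt_trans a1 _; apply: le_lt_trans (ler_norm _) ed.
have /nbhs_ballP[d /= d0 dK] := near_all.
have d2 : 0 < d / 2%:R by rewrite divr_gt0.
exists (d / 2%:R) => // a ad p Kp.
have := dK (d / 2%:R) _ p Kp a ad; apply.
rewrite -ball_normE /ball_/= sub0r normrN gtr0_norm//.
by rewrite ltr_pdivrMr// ltr_pMr// ltr1n.
Qed.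

Lemma bounded_on_compact (K : set 'rV[R]_n) (g : 'rV[R]_n -> R) : compact K ->
  (forall y, K y -> {for y, continuous g}) -> exists C : R, forall y, K y -> `|g y| <= C.
Proof.
move=> cK cg.
have near_all : \forall C \near pinfty_nbhs R, K `<=` (fun y => `|g y| <= C).
  apply: (proj1 (compact_near_coveringP _) cK R (pinfty_nbhs R) _ _).
  move=> y Ky; have /cvgrPdist_le/(_ 1 ltr01) ny := cg y Ky.
  near=> y' C => /=.
  have h : `|g y - g y'| <= 1 by near: y'.
  have -> : g y' = g y - (g y - g y') by ring.
  by apply: le_trans (ler_normB _ _) _; apply: (@le_trans _ _ (`|g y| + 1)); [rewrite
      lerD2l|near: C; exact: nbhs_pinfty_ge].
have [C [_ HC]] := near_all; exists (C + 1) => y Ky; apply: (HC (C + 1)) => //.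
by rewrite ltrDl.
Unshelve. all: by end_near. Qed.

(** The l-th partial derivatives of the new functions are those of [fs c] plus a c, so a has to
    avoid the image of F. This image is small because F is Lipschitz from dimension n to dimension n
    + 1: hence the number of functions. *)
Lemma noncritical_ball i x (r e : R) (l : 'I_n) fs : nice i x r -> 0 < e ->
  exists2 a : 'I_N -> R, forall c, 0 <= a c <= e & forall y, `|y - x| <= r / 2%:R ->
    noncritical (fun c => fs c + a c *: coord_fun i x r l) (param i y).
Proof.
move=> nr e0; have [r0 Hr] := nr.
have r2 : 0 < r / 2%:R by rewrite divr_gt0.
have r2r : r / 2%:R < r by rewrite ltr_pdivrMr// ltr_pMr// ltr1n.
have rr y : `|y - x| <= r / 2%:R -> rng i y.
  move=> yx; apply: Hr; apply: (le_trans yx); apply: (le_trans (ltW r2r)).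
  by rewrite ler_peMl ?ler1n// ltW.
pose F y c := - partial l (fs c \o param i) y.
have CF c m : exists C : R, forall y, `|y - x| <= r / 2%:R ->
    `|partial m (fun y => F y c) y| <= C.
  have sF : smooth_on (rng i) (partial m (fun y => F y c)).
    apply: smooth_partial => k; apply: CkN; first exact: rng_open.
    exact: (smooth_partial_cinf i l (fs c) k).
  have [|C HC] := @bounded_on_compact [set y | `|y - x| <= r / 2%:R] (partial m (fun y
      => F y c)) (@rV_cball_compact R n x (r / 2%:R)).
    by move=> y yx; apply: (sF 0%N); exact: rr.
  by exists C.
have {CF} [C CP] := choice (fun cm : 'I_N * 'I_n => CF cm.1 cm.2).
have lipF y z c : `|y - x| <= r / 2%:R -> `|z - x| <= r / 2%:R ->
    `|F z c - F y c| <= n%:R * (\sum_cm `|C cm|) * `|z - y|.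
  move=> yx zx; apply: (@lipschitz_ball R n (fun y => F y c) x (r / 2%:R)) => //.
    move=> w wx; have := smooth_differentiable (smooth_partial_cinf i l (fs c)) (rr w wx).
    exact: differentiableN.
  move=> m w wx; apply: le_trans (CP (c, m) w wx) _; apply: le_trans (ler_norm _) _.
  by rewrite (bigD1 (c, m))//= lerDl sumr_ge0.
have [a [a0 aF]] := avoid_image r2 e0 lipF.
exists a => // y yx; have [c Fc] := aF y yx.
exists c, (coord_field i x r l); split; first exact: derivation_coord_field.
have yr : `|y - x| < r by exact: le_lt_trans yx r2r.
have -> : coord_field i x r l (fs c + a c *: coord_fun i x r l) (param i y) =
  coord_field i x r l (fs c) (param i y) + a c * coord_field i x r l (coord_fun i x r
      l) (param i y).
  by rewrite linearD linearZ_LR.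
rewrite coord_field_coord// eqxx mulr1 coord_field_in ?ltW//.
by apply: contra Fc; rewrite addr_eq0 /F => /eqP->; rewrite opprK.
Qed.

(** Finitely many balls are treated one after the other; by [noncritical_perturb] a small enough
    perturbation for the next ball does not spoil the earlier ones. *)
Lemma noncritical_compact (l : 'I_n) (K : set M) : compact K ->
  exists fs, forall p, K p -> noncritical fs p.
Proof.
move=> cK.
have [z zP] : {z : M -> idx M * R & forall p, dom (z p).1 p /\ nice (z p).1 (chart (z
    p).1 p) (z p).2}.
  apply: (@choice _ _ (fun p z => dom z.1 p /\ nice z.1 (chart z.1 p) z.2)) => p; have
      [i dp] := dom_cover p.
  have [r nr _] := nice_exists (@rng_open R n M i) (fun x rx => rx) (chart_rng dp).
  by exists (i, r).
pose B p := [set y | `|y - chart (z p).1 p| <= (z p).2 / 2%:R].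
have rB p : B p `<=` rng (z p).1.
  have [_ [r0 H]] := zP p => y yB; apply: H; apply: (le_trans yB).
  by move: r0; lra.
pose Q p := param (z p).1 @` B p.
have cQ p : compact (Q p).
  by apply: param_compact; [exact: rV_cball_compact|exact: rB].
pose O p := dom (z p).1 `&` chart (z p).1 @^-1` ball (chart (z p).1 p) ((z p).2 / 2%:R).
have OQ p : O p `<=` Q p.
  move=> q [dq]; rewrite /= -ball_normE /ball_/= distrC => /ltW qp.
  by exists (chart (z p).1 q) => //; rewrite chartK.
have [p _|p Kp|s _ Ks] := @compact_subcover M K M setT O cK.
- by apply: preimage_chart_open; exact: ball_open.
- exists p => //; have [dp [r0 _]] := zP p.
  by split=> //=; apply: ballxx; rewrite divr_gt0.
suff [fs fsP] : exists fs, forall p, (\big[setU/set0]_(q <- s) Q q) p -> noncritical fs p.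
  exists fs => p /Ks[q qs /OQ Qp]; apply: fsP.
  by rewrite (big_rem q)//=; left.
have cs (t : seq M) : compact (\big[setU/set0]_(q <- t) Q q).
  elim: t => [|q t IH]; first by rewrite big_nil; exact: compact0.
  by rewrite big_cons; exact: compactU.
elim: s {Ks} => [|q s [fs fsP]]; first by exists (fun=> 0) => p; rewrite big_nil.
have [dq nq] := zP q.
have [e e0 eP] := noncritical_perturb (coord_fun (z q).1 (chart (z q).1 q) (z q).2 l)
    (cs s) fsP.
have [a ae aP] := noncritical_ball l fs nq e0.
exists (fun c => fs c + a c *: coord_fun (z q).1 (chart (z q).1 q) (z q).2 l) => p.
rewrite big_cons => -[[y yB <-]|sp]; first exact: aP.
exact: eP.
Qed.

Lemma derivation_diff_order X : derivation X -> diff_order 1 X.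
Proof.
move=> dX; split; first exact: dop_linear.
move=> i x rx.
have [r nr _] := nice_exists (@rng_open R n M i) (fun y ry => ry) rx.
have [r0 Hr] := nr.
have Br : ball x r `<=` rng i.
  move=> z; rewrite -ball_normE /ball_/= distrC => zx; apply: Hr.
  by apply: le_trans (ltW zx) _; rewrite ler_peMl ?ler1n// ltW.
exists (ball x r), [seq (X (coord_fun i x r l) \o param i, [:: l]) | l <- index_enum 'I_n].
split=> //; [exact: ball_open|exact: ballxx| |].
  move=> t /mapP[l _ ->]; split=> // k; apply: Ck_sub (cinfP _ i k); exact: Br.
move=> f y; rewrite -ball_normE /ball_/= distrC => yx.
by rewrite (frame_at f nr dX yx) /local_expr big_map.
Qed.

(** Finitely many X suffice over K; their sum weighted by X (fs c) takes a sum of squares as value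
    on [fs c]. The number of pairs is the same for all K, which makes the gluing below possible. *)
Lemma noncritical_pairs (l : 'I_n) (K : set M) : compact K ->
  exists (fs : 'I_N -> A) (Xs : 'I_N -> L), (forall c, derivation (Xs c)) /\
    forall p, K p -> exists c, Xs c (fs c) p != 0.
Proof.
move=> cK; have [fs fsP] := noncritical_compact l cK.
have [X _|p Kp|s sP Ks] := @compact_subcover M K L [set X | derivation X]
    (fun X => [set p | exists c, X (fs c) p != 0]) cK.
- have -> : [set p | exists c, X (fs c) p != 0] = \bigcup_c [set p | X (fs c) p != 0].
    by apply/seteqP; split=> p /= => [[c Xc]|[c _ Xc]]; exists c.
  apply: bigcup_open => c _.
  exact: (open_comp (f := X (fs c) : M -> R) (fun x _ => @cinf_continuous R n M _ x)
      (@open_neq R 0)).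
- by have [c [X [dX Xc]]] := fsP p Kp; exists X => //; exists c.
exists fs, (fun c => \sum_(X <- s) mulop (X (fs c)) * X); split=> [c|p /Ks[X Xs [c Xc]]].
  rewrite big_seq; elim/big_ind: _ => //; first exact: derivation0.
    by move=> X Y; exact: derivationD.
  by move=> X /sP dX; exact: derivation_mull.
exists c; rewrite dop_sum cinf_sum gt_eqF// (big_rem X)//=.
apply: ltr_pwDl; last by apply: sumr_ge0 => Y _; rewrite -expr2 sqr_ge0.
by rewrite -[X in _ < X]/(X (fs c) p * X (fs c) p) -expr2 lt_def sqr_ge0 expf_eq0 andbT.
Qed.

(** * Gluing over the shells of a proper function *)

Section Gluing.
Variable g : A.
Hypothesis g0 : forall p, 0 <= g p.

(** It is 1 for |g - j| <= 3/4 and 0 for |g - j| >= 3/2. Since 3/4 > 1/2, every point has a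
    neighborhood on which some shell is 1; since 3/4 + 3/2 < 3, the other shells with index
    congruent to j mod 3 vanish where |g - j| <= 3/4. *)
Definition shell_fun (j : nat) p : R := plateau (4%:R / 3%:R * (g p - j%:R)).

Lemma shell_subproof j : shell_fun j \in @cinf_pred R n M.
Proof.
apply/cinf_predP => i k; have oU := @preimage_param_open R n M i _ openT.
apply: (@Ck_comp_real R _ k _ setT (fun x => 4%:R / 3%:R * (g (param i x) - j%:R))
    plateau oU) => //.
  apply: (CkZ _ oU); apply: (CkB oU) => //; last exact: Ck_cst.
  exact: (smooth_fun_cinf g i k).
exact: smooth_plateau.
Qed.

Definition shell j : A := Cinf (shell_subproof j).

Lemma shell1 j p : `|g p - j%:R| <= 3%:R / 4%:R -> shell j p = 1.
Proof.
move=> gj; apply: plateau1; rewrite normrM gtr0_norm ?divr_gt0//.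
by rewrite mulrAC ler_pdivrMr//; move: gj; lra.
Qed.

Lemma shell0 j p : 3%:R / 2%:R <= `|g p - j%:R| -> shell j p = 0.
Proof.
move=> gj; apply: plateau0; rewrite normrM gtr0_norm ?divr_gt0//.
by rewrite mulrAC ler_pdivlMr//; move: gj; lra.
Qed.

Lemma shell_sumE (v : nat -> R) p k k' : g p + 2%:R <= k%:R -> g p + 2%:R <= k'%:R ->
  \sum_(j < k) shell j p * v j = \sum_(j < k') shell j p * v j.
Proof.
wlog kk' : k k' / (k <= k')%N => [H|gk _].
  by case: (leqP k k') => [/H|/ltnW/H h ? ?]; [exact|exact/esym/h].
rewrite -(subnKC kk') big_split_ord /= [X in _ = _ + X]big1 ?addr0// => j _.
have -> : shell_fun (k + j) p = 0; last by rewrite mul0r.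
apply: (@shell0 (k + j)); have := ler0n R j; have := g0 p => h1 h2.
by rewrite distrC natrD; apply: le_trans (ler_norm _); lra.
Qed.

(** More than g p + 3, so that g q + 2 stays below it for q near p. *)
Let N0 p := (Num.truncn (g p)).+4.

Lemma N0_ge p : g p + 2%:R <= (N0 p)%:R.
Proof.
have := truncnS_gt (g p); rewrite /N0 -addn3 natrD; lra.
Qed.

Lemma N0_near p : \forall q \near p, g q + 2%:R <= (N0 p)%:R.
Proof.
have := @cinf_continuous R n M g p => /cvgrPdist_le/(_ 1 ltr01); apply: filterS => q.
rewrite ler_norml => /andP[h1 h2].
have := truncnS_gt (g p); rewrite /N0 -addn3 natrD; lra.
Qed.

Lemma shell_glue_cinf (w : nat -> A) : exists f, forall p k, g p + 2%:R <= k%:R ->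
  f p = \sum_(j < k) shell j p * w j p.
Proof.
have SE k p : (\sum_(j < k) shell j * w j) p = \sum_(j < k) shell j p * w j p.
  by rewrite cinf_sum.
have [f fE] : exists f : A, forall p, f p = (\sum_(j < N0 p) shell j * w j) p.
  apply: (glue_cinf (F := fun p => \sum_(j < N0 p) shell j * w j)) => p.
  apply: filterS (N0_near p) => q gq; rewrite !SE.
  by apply: (@shell_sumE (fun j => w j q)) => //; exact: N0_ge.
exists f => p k gk; rewrite fE SE; apply: (@shell_sumE (fun j => w j p)) => //; exact:
    N0_ge.
Qed.

Lemma shell_glue_derivation (X : nat -> L) : (forall j, derivation (X j)) ->
  exists2 Y : L, derivation Y & forall f p k, g p + 2%:R <= k%:R ->
  Y f p = \sum_(j < k) shell j p * X j f p.
Proof.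
move=> dX; pose F p : L := \sum_(j < N0 p) mulop (shell j) * X j.
have dF p : derivation (F p).
  by apply: derivation_sum => j; exact: derivation_mull.
have SE f p q : F p f q = \sum_(j < N0 p) shell j q * X j f q.
  by rewrite /F dop_sum cinf_sum.
have [|Y YE] := @glue_dop R n M 1 F (fun p => derivation_diff_order (dF p)).
  move=> p; apply: filterS (N0_near p) => q gq f; rewrite !SE.
  by apply: (@shell_sumE (fun j => X j f q)) => //; exact: N0_ge.
exists Y => [f h|f p k gk].
  apply: cinf_ext => p; rewrite YE dF.
  by transitivity (F p f p * h p + f p * F p h p); [|rewrite -!YE].
rewrite YE SE; apply: (@shell_sumE (fun j => X j f p)) => //; exact: N0_ge.
Qed.

Lemma near_shell p : exists j : nat, \forall q \near p, `|g q - j%:R| <= 3%:R / 4%:R.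
Proof.
(* The integer nearest to g p, at distance at most 1/2; continuity takes up the remaining 1/4. *)
pose j := Num.truncn (g p + 2%:R^-1); exists j.
have gj : - 2%:R^-1 <= g p - j%:R <= 2%:R^-1.
  have /truncn_itv/andP[] : 0 <= g p + 2%:R^-1 by rewrite addr_ge0// invr_ge0.
  rewrite -[Num.truncn _]/j -[X in _ < X -> _](natr1 j); lra.
have e4 : 0 < 4%:R^-1 :> R by rewrite invr_gt0.
have := @cinf_continuous R n M g p => /cvgrPdist_le/(_ _ e4); apply: filterS => q.
by rewrite !ler_norml; move: gj; lra.
Qed.

End Gluing.

(** Exhausting M takes a sequence of families of n + 1 pairs. Those with index in one residue class
    mod 3 are glued into a single family, so 3 (n + 1) pairs suffice. *)
Lemma noncritical_family (l : 'I_n) : exists (I : finType) (fs : I -> A) (Xs : I -> L),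
  (forall c, derivation (Xs c)) /\ forall p, exists c, Xs c (fs c) p != 0.
Proof.
have [g [g0 gproper]] := proper_function M.
have [z zP] : {z : nat -> ('I_N -> A) * ('I_N -> L) & forall j,
    (forall c, derivation ((z j).2 c)) /\ forall p, g p <= j.+1%:R ->
      exists c, (z j).2 c ((z j).1 c) p != 0}.
  apply: (@choice _ _ (fun (j : nat) (z : ('I_N -> A) * ('I_N -> L)) => (forall c,
      derivation (z.2 c)) /\ forall p, g p <= j.+1%:R ->
      exists c, z.2 c (z.1 c) p != 0)) => j; have [K cK gK] := gproper j.+1%:R.
  have [fs [Xs [dX KX]]] := noncritical_pairs l cK; exists (fs, Xs); split=> // p /gK.
  exact: KX.
pose w (k : 'I_3) c j : A := if (j %% 3 == k)%N then (z j).1 c else 0.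
pose W (k : 'I_3) c j : L := if (j %% 3 == k)%N then (z j).2 c else 0.
have dW k c j : derivation (W k c j).
  by rewrite /W; case: ifP => _; [have [] := zP j|exact: derivation0].
have [fs fsE] := choice (fun kc : 'I_3 * 'I_N => shell_glue_cinf g0 (w kc.1 kc.2)).
have [Xs XsE] : {Xs : 'I_3 * 'I_N -> L & forall kc, derivation (Xs kc) /\
    forall f p k, g p + 2%:R <= k%:R ->
      Xs kc f p = \sum_(j < k) shell g j p * W kc.1 kc.2 j f p}.
  apply: (@choice _ _ (fun (kc : 'I_3 * 'I_N) (Y : L) => derivation Y /\ forall f p k,
      g p + 2%:R <= k%:R ->
      Y f p = \sum_(j < k) shell g j p * W kc.1 kc.2 j f p)) => kc; have [Y dY YE] :=
          shell_glue_derivation g0 (dW kc.1 kc.2).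
  by exists Y; split=> // f p k gk; exact: YE.
exists ('I_3 * 'I_N)%type, fs, Xs; split=> [c|p]; first by have [] := XsE c.
have [j nj] := near_shell g0 p.
have jp := nbhs_singleton nj.
have [_ zj] := zP j.
have [|c Xc] := zj p; first by move: jp; rewrite ler_norml -natr1; lra.
have j3 : (j %% 3 < 3)%N by rewrite ltn_mod.
pose k : 'I_3 := Ordinal j3.
(* In a fixed residue class mod 3 only the j-th shell is nonzero near p. *)
have key (v : nat -> R) q : `|g q - j%:R| <= 3%:R / 4%:R ->
    (forall j', (j' %% 3 != k)%N -> v j' = 0) ->
    \sum_(j' < j.+3.+1) shell g j' q * v j' = v j.
  move=> gj v0; have jj : (j < j.+3.+1)%N by rewrite !ltnS !leqW.
  have s1 : shell g (Ordinal jj) q * v (Ordinal jj) = v j by rewrite shell1 ?mul1r.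
  rewrite (bigD1 (Ordinal jj))// s1 big1 => [|j' nj']; first exact: addr0.
  have [e|/v0->] := eqVneq (j' %% 3)%N k; last by rewrite mulr0.
  rewrite shell0 ?mul0r//.
  have : (j' + 3 <= j)%N || (j + 3 <= j')%N.
    have : (nat_of_ord j' != j)%N by apply: contra nj' => /eqP e'; apply/eqP/val_inj.
    by move: e; rewrite /=; lia.
  rewrite -!(ler_nat R) !natrD => /orP[] h.
    by apply: le_trans (ler_norm _); move: gj; rewrite ler_norml; lra.
  by rewrite distrC; apply: le_trans (ler_norm _); move: gj; rewrite ler_norml; lra.
have gk q : `|g q - j%:R| <= 3%:R / 4%:R -> g q + 2%:R <= j.+3.+1%:R.
  have -> : j.+3.+1%:R = j%:R + 4%:R :> R by rewrite -natrD addn4.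
  by rewrite ler_norml; lra.
exists (k, c).
have -> : Xs (k, c) (fs (k, c)) p = Xs (k, c) ((z j).1 c) p.
  apply: dop_local; apply: filterS nj => q gj.
  rewrite (fsE (k, c) q _ (gk q gj)) (key (fun j' => w k c j' q))//.
    by rewrite /w eqxx.
  by move=> j' /negPf jk; rewrite /w jk.
rewrite ((XsE (k, c)).2 _ _ _ (gk p jp)) (key (fun j' => W k c j' ((z j).1 c) p))//.
  by rewrite /W eqxx.
by move=> j' /negPf jk; rewrite /W jk.
Qed.

Lemma manifold_full : (0 < n)%N -> full M.
Proof.
move=> n0 m P P0 PD PX h.
have [I [fs [Xs [dX XsP]]]] := noncritical_family (Ordinal n0).
pose a c := Xs c (fs c) ^+ m.
have [v vE] : exists v : A, (\sum_c a c ^+ 2) * v = 1.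
  apply: cinf_inv => p; have [c Xc] := XsP p.
  rewrite cinf_sum gt_eqF// (bigD1 c)//; apply: ltr_pwDl; last first.
    by apply: sumr_ge0 => d _; rewrite cinfX sqr_ge0.
  by rewrite cinfX lt_def sqr_ge0 andbT cinfX !expf_eq0 (negPf Xc) andbF.
have -> : h = \sum_c (h * v * a c) * Xs c (fs c) ^+ m.
  rewrite -[LHS]mulr1 -vE mulr_suml mulr_sumr; apply: eq_bigr => c _.
  by rewrite /a; ring.
by elim/big_ind: _ => // c _; exact: PX.
Qed.

End Critical.

(** * Closed forms and their exponentials *)

Section CV.
Context {R : realType} {n : nat}.

Lemma Ck_coordC (V : normedModType R) k (U : set V) (f : V -> 'cV[R]_n) l :
  open U -> Ck k U f -> Ck k U (fun x => f x l 0).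
Proof.
move=> oU; elim: k f => [|k IH] f.
  move=> cf x Ux; apply: (continuous_comp (g := fun M : 'cV[R]_n => M l 0)).
    exact: cf.
  exact: coord_continuous.
move=> [df Df]; split=> [x Ux|v].
  apply: (differentiable_comp (g := fun M : 'cV[R]_n => M l 0)); first exact: df.
  exact: differentiable_coord.
apply: Ck_ext (IH _ (Df v)) => // x Ux.
by rewrite derive_mx ?mxE//; apply: diff_derivable; exact: df.
Qed.

Lemma Ck_of_coordC (V : normedModType R) k (U : set V) (f : V -> 'cV[R]_n) :
  open U -> (forall l, Ck k U (fun x => f x l 0)) -> Ck k U f.
Proof.
move=> oU Cf.
have H (l : 'I_n) j (g : V -> R) : Ck j U g ->
    Ck j U (fun x => g x *: (delta_mx l 0 : 'cV[R]_n)).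
  elim: j g => [|j IH] g.
    by move=> cg x Ux; apply: continuousZl; exact: cg.
  move=> [dg Dg]; split=> [x Ux|v].
    by apply: differentiableZl; exact: dg.
  apply: Ck_ext (IH _ (Dg v)) => // x Ux.
  have dgx := dg _ Ux; rewrite [RHS]deriveE; last exact: differentiableZl.
  by rewrite diffZl//= -deriveE.
apply: (@Ck_ext _ _ _ _ _ (fun x => \sum_l f x l 0 *: delta_mx l 0)) => //.
  move=> x _; rewrite [RHS]matrix_sum_delta; apply: eq_bigr => l _.
  by rewrite big_ord1.
by apply: Ck_sum => // l; exact: H.
Qed.

Lemma jacobianE (f : 'rV[R]_n -> 'rV[R]_n) x l m : differentiable f x ->
  jacobian f x l m = partial l (fun y => f y 0 m) x.
Proof.
move=> df; rewrite /jacobian mxE /partial -deriveE//.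
by rewrite derive_mx ?mxE//; exact: diff_derivable.
Qed.

End CV.

Section Primitive.
Context {R : realType} {n : nat} (M : manifold R n).
Local Notation A := (cinf M).
Local Notation L := (Dop M).
Implicit Types (f g h u : A) (p q : M) (X : L) (i : idx M) (D : L).

Lemma germ_ext (U : set M) (g : M -> R) p : open U -> U p -> smooth_fun U g ->
  exists h : A, \forall q \near p, h q = g q.
Proof.
move=> oU Up sg; have [i dp] := dom_cover p.
have oB := @preimage_param_open R n M i _ oU.
have Br : rng i `&` param i @^-1` U `<=` rng i by move=> y [].
have [|r nr rB] := nice_exists oB Br (x := chart i p).
  by split; [exact: chart_rng|rewrite /= chartK].
have [r0 _] := nr.
have hE := cutoffE nr oB Br _ (sg i).
exists (cutoff i (chart i p) r (g \o param i)); rewrite hE; last first.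
  by move=> y yx; apply: rB; apply: (le_trans yx); rewrite ler_pM2r// ler_nat.
have := param_ball_nbhs nr; rewrite chartK//; apply: filterS => q [dq qp].
by rewrite chart_extE// bumpR1 ?mul1r ?ltW//= chartK.
Qed.

Lemma restrE D (g : M -> R) h p : (\forall q \near p, h q = g q) -> restr D g p = D h p.
Proof.
move=> hg; rewrite /restr; apply: dop_local.
have := @xgetPex _ 0 [set h : A | \forall q \near p, h q = g q] (ex_intro _ h hg).
by move=> Hx; apply: filterS2 Hx hg => q -> ->.
Qed.

(** A primitive in one chart, cut off to a global function; the chain rule and [form_compat] carry
    the identity over to the other charts. *)
Lemma primitive_exists (w : closed_form M) p :
  exists (F : A) (U : set M), [/\ open U, U p & is_primitive w U F].
Proof.
have [i dp] := dom_cover p; set x := chart i p.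
have [r nr _] := nice_exists (@rng_open R n M i) (fun x rx => rx) (chart_rng dp).
have [r0 Hr] := nr; rewrite -/x in nr Hr.
pose B := ball x (4%:R * r).
have r4 : 0 < 4%:R * r by rewrite mulr_gt0.
have Br : B `<=` rng i.
  by move=> z; rewrite /B -ball_normE /ball_/= distrC => /ltW/Hr.
have oB : open B by exact: ball_open.
have [||W sW WE] := @poincare R n x (4%:R * r) (fun l y => w i y l 0).
- move=> l k; apply: (Ck_coordC _ oB); apply: Ck_sub (form_smooth w i k); exact: Br.
- by move=> k l y /Br; exact: form_closed.
have FE := cutoffE nr oB Br _ sW.
have {}FE : cutoff i x r W = chart_ext i (fun y => bumpR x r y * W y) :> (M -> R).
  apply: FE => y yx; rewrite /B -ball_normE /ball_/= distrC; apply: le_lt_trans yx _.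
  by rewrite ltr_pM2r// ltr_nat.
have oU := @preimage_chart_open R n M i _ (ball_open x r).
exists (cutoff i x r W), (dom i `&` chart i @^-1` ball x r); split=> //.
  by split=> //; apply: ballxx.
move=> j y ry [dy By] l.
pose tau := transition i j; pose tau' := chart i \o param j.
have Wy : (rng j `&` param j @^-1` dom i) y by [].
have dtau : differentiable tau' y by exact: (smooth_differentiable (chart_compat j i) Wy).
rewrite (form_compat w ry dy) mxE.
have rt : rng i (tau' y) by exact: chart_rng.
have BW : ball x r `<=` B.
  by apply: le_ball; rewrite ler_peMl ?ler1n// ltW.
have -> : partial l (cutoff i x r W \o param j) y = partial l (fun z => W (tau' z)) y.
  have oV := @preimage_param_open R n M j _ oU.
  apply: near_eq_derive; apply: filterS (open_nbhs_nbhs (conj oV _)); last by split.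
  move=> z [rz [dz]]; rewrite /= -ball_normE /ball_/= distrC => zx.
  by rewrite FE chart_extE// bumpR1 ?mul1r// ltW.
have dW : differentiable W (tau' y) by exact: (smooth_differentiable sW (BW _ By)).
rewrite {1}/partial (derive_comp_partial _ dtau dW); apply: eq_bigr => m _.
by rewrite jacobianE// WE//; exact: BW.
Qed.

Lemma primitive_unique (w : closed_form M) U U' (f f' : A) p : open U -> open U' -> U p
    -> U' p ->
  is_primitive w U f -> is_primitive w U' f' ->
  \forall q \near p, f q = f' q + (f p - f' p).
Proof.
move=> oU oU' Up Up' pf pf'; have [i dp] := dom_cover p; set x := chart i p.
have oB := @preimage_param_open R n M i _ (openI oU oU').
have Br : rng i `&` param i @^-1` (U `&` U') `<=` rng i by move=> y [].
have [|r nr rB] := nice_exists oB Br (x := x).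
  by split; [exact: chart_rng|rewrite /= chartK].
have [r0 _] := nr; have := param_ball_nbhs nr; rewrite /x chartK//.
apply: filterS => q [dq qx].
have BB y : ball x r y -> (rng i `&` param i @^-1` (U `&` U')) y.
  rewrite -ball_normE /ball_/= distrC => /ltW yx; apply: rB.
  by apply: le_trans yx _; rewrite ler_peMl ?ler1n// ltW.
suff H : (f - f') q = (f - f') p.
  have e : f q - f' q = f p - f' p by exact: H.
  by rewrite -e addrC subrK.
rewrite -(chart_comp (f - f') dq) -(chart_comp (f - f') dp).
apply: (@partial0_constant R n _ x r).
- move=> y /BB[ry _]; exact: smooth_differentiable (cinfP (f - f') i) ry.
- move=> l y /BB[ry [Uy Uy']].
  have -> : f - f' = f + (-1) *: f' by rewrite scaleN1r.
  by rewrite partialD// partialZ// -(pf i y ry Uy l) -(pf' i y ry Uy' l) mulN1r subrr.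
- by rewrite -ball_normE /ball_/= distrC.
Qed.

Lemma lie_mulop_germ D (F F' : A) (c : R) g p :
  (\forall q \near p, F q = F' q + c) -> lie D (mulop F) g p = lie D (mulop F') g p.
Proof.
move=> FF'.
transitivity (D (F * g) p - F p * D g p); first by [].
transitivity (D (F' * g) p - F' p * D g p); last by [].
have -> : D (F * g) p = D (F' * g + c *: g) p.
  apply: dop_local; apply: filterS FF' => q e.
  transitivity (F q * g q); first by [].
  by rewrite e mulrDl.
have -> : D (F' * g + c *: g) p = D (F' * g) p + c * D g p by rewrite linearD linearZ_LR.
by rewrite (nbhs_singleton FF'); ring.
Qed.

Lemma diff_order_lieW k D h : diff_order k D -> diff_order k (lie D (mulop h)).
Proof.
move=> oD; apply: diff_order_lie; case: oD => lD hD; split=> // i x rx.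
have [U [T [oU Ux Ur tT eT]]] := hD i x rx; exists U, T; split=> //.
exact: local_terms_sub tT.
Qed.

(** Brackets with local primitives glue: two primitives differ by a constant near a common point,
    and constants do not change a bracket. *)
Lemma omega_bar_exists (w : closed_form M) D : exists E, is_omega_bar w D E.
Proof.
have [FU FUP] := choice (fun p => let: ex_intro F (ex_intro U H) := primitive_exists w p in
  ex_intro (fun FU : A * set M => [/\ open FU.2, FU.2 p & is_primitive w FU.2 FU.1])
      (F, U) H).
have [k oD] : exists k, diff_order k D by case: D => D /= /dop_predP.
have [|E HE] := @glue_dop R n M k (fun p => lie D (mulop (FU p).1)) (fun p =>
    diff_order_lieW _ oD).
  move=> p; have [oU Up pU] := FUP p.
  apply: filterS (open_nbhs_nbhs (conj oU Up)) => q Uq f.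
  have [oU' Uq' pU'] := FUP q.
  exact: lie_mulop_germ (primitive_unique oU' oU Uq' Uq pU' pU).
exists E => U f oU sf pf g p sg Up.
have [h hg] := germ_ext oU Up sg; have [k' kf] := germ_ext oU Up sf.
have kh : \forall q \near p, (k' * h) q = (f \* g) q.
  by apply: filterS2 hg kf => q h1 h2; transitivity (k' q * h q); [|rewrite h1 h2].
rewrite (restrE E hg) (restrE D hg) (restrE D kh) -(nbhs_singleton kf) HE.
have [oU' Up' pU'] := FUP p.
have [V [oV Vp] VP] := near_open kf.
have pk : is_primitive w (U `&` V) k'.
  move=> i x rx [Ux Vx] l; rewrite (pf i x rx Ux); apply: near_eq_derive.
  have oW := @preimage_param_open R n M i _ oV.
  by apply: filterS (open_nbhs_nbhs (conj oW (conj rx Vx))) => y [_ Vy]; rewrite /= VP.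
exact: lie_mulop_germ (primitive_unique oU' (openI oU oV) Up' (conj Up Vp) pU' pk).
Qed.

Lemma omega_bar_primitive (w : closed_form M) U (F : A) D g p : open U -> U p ->
  is_primitive w U F -> omega_bar w D g p = lie D (mulop F) g p.
Proof.
move=> oU Up pF; have [E HE] := omega_bar_exists w D.
have := @xgetPex _ 0 [set E | is_omega_bar w D E] (ex_intro _ E HE).
move=> /(_ U F oU (cinf_on F U) pF g p (cinf_on g U) Up).
have gg : \forall q \near p, g q = g q by apply: nearW.
have fg : \forall q \near p, (F * g) q = (F \* g) q by apply: nearW.
by rewrite (restrE _ gg) (restrE _ gg) (restrE _ fg).
Qed.

Lemma omega_bar_local (w : closed_form M) p : exists F : A,
  \forall q \near p, forall D g, omega_bar w D g q = lie D (mulop F) g q.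
Proof.
have [F [U [oU Up pF]]] := primitive_exists w p; exists F.
apply: filterS (open_nbhs_nbhs (conj oU Up)) => q Uq D g.
exact: omega_bar_primitive pF.
Qed.

End Primitive.

(** * The exponential is an automorphism *)

Section Exponential.
Context {R : realType} {n : nat} (M : manifold R n) (w : closed_form M).
Local Notation A := (cinf M).
Local Notation L := (Dop M).
Local Notation d := (omega_bar w).
Implicit Types (f g h u : A) (p q : M) (D E X : L).

(** At a given point one function F computes [omega_bar w] on all operators. The hypothesis concerns
    p alone; when another operator is applied afterwards, as in [omega_bar_mul], the equality near p
    from [omega_bar_local] is needed. *)
Lemma omega_bar_ext D D' : (forall p F g, (forall E h, d E h p = lie E (mulop F) h p) ->
  D g p = D' g p) -> D = D'.
Proof.
move=> H; apply: dop_ext => g; apply: cinf_ext => p.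
have [F HF] := omega_bar_local w p; apply: (H p F) => E h.
exact: (nbhs_singleton HF).
Qed.

Lemma omega_barD D E : d (D + E) = d D + d E.
Proof.
apply: omega_bar_ext => p F g H; transitivity (d D g p + d E g p); last by [].
by rewrite !H lieDl.
Qed.

Lemma omega_barZ (c : R) D : d (c *: D) = c *: d D.
Proof.
apply: omega_bar_ext => p F g H; transitivity (c * d D g p); last by [].
by rewrite !H lieZl.
Qed.

Lemma omega_bar_mul D E : d (D * E) = d D * E + D * d E.
Proof.
apply: dop_ext => g; apply: cinf_ext => p; have [F HF] := omega_bar_local w p.
have H D' g' := nbhs_singleton HF D' g'.
transitivity (d D (E g) p + D (d E g) p); last by [].
rewrite !H lie_mull.
have -> : D (d E g) p = D (lie E (mulop F) g) p.
  by apply: dop_local; apply: filterS HF => q; apply.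
transitivity (D (lie E (mulop F) g) p + lie D (mulop F) (E g) p); first by [].
exact: (@addrC R).
Qed.

Lemma omega_barN D : d (- D) = - d D.
Proof. by rewrite -scaleN1r omega_barZ scaleN1r. Qed.

Lemma omega_bar_lie D E : d (lie D E) = lie (d D) E + lie D (d E).
Proof.
rewrite /lie omega_barD omega_barN !omega_bar_mul opprD.
by rewrite [X in _ + X]addrC addrACA.
Qed.

Lemma omega_bar_mulop f : d (mulop f) = 0.
Proof.
by apply: omega_bar_ext => p F g H; rewrite H lie_mulop_comm.
Qed.

Lemma ordlt_omega_bar k D : ordlt k.+1 D -> ordlt k (d D).
Proof.
elim: k D => [|k IH] D oD; first by move/ordlt1P: oD => ->; exact: omega_bar_mulop.
move=> f; have -> : lie (d D) (mulop f) = d (lie D (mulop f)).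
  by rewrite omega_bar_lie omega_bar_mulop lie0r addr0.
by apply: IH; apply: oD.
Qed.

Lemma iter_omega_bar k j D : ordlt k D -> (k <= j)%N -> iter j d D = 0.
Proof.
have d0 : d 0 = 0 by have := omega_barZ 0 0; rewrite !scale0r.
elim: k j D => [|k IH] j D oD kj.
  by rewrite (oD : D = 0); elim: j {kj} => //= j ->.
case: j kj => // j kj; rewrite iterSr; apply: IH => //; exact: ordlt_omega_bar.
Qed.

Lemma exp_omega_barE K D : (forall j, (K <= j)%N -> iter j d D = 0) ->
  exp_omega_bar w D = \sum_(k < K) (k`!%:R^-1 : R) *: iter k d D.
Proof.
move=> HK; rewrite /exp_omega_bar [RHS](@fsbig_ord _ _ _ K (fun k => (k`!%:R^-1 : R) *:
    iter k d D)).
apply/esym/fsbig_widen => // k [_ /= kK]; rewrite HK ?scaler0//.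
by rewrite leqNgt; apply/negP.
Qed.

Lemma exp_omega_bar_ord k D : ordlt k D ->
  exp_omega_bar w D = \sum_(j < k) (j`!%:R^-1 : R) *: iter j d D.
Proof. by move=> oD; apply: exp_omega_barE => j; exact: iter_omega_bar. Qed.

Lemma exp_omega_bar_linear : linear (exp_omega_bar w).
Proof.
move=> c D E; have [k oD] := dop_ordlt D; have [l oE] := dop_ordlt E.
have oD' : ordlt (maxn k l) D by apply: ordltW oD; exact: leq_maxl.
have oE' : ordlt (maxn k l) E by apply: ordltW oE; exact: leq_maxr.
rewrite !(@exp_omega_bar_ord (maxn k l))//; last by apply: ordltD => //; exact: ordltZ.
rewrite scaler_sumr -big_split; apply: eq_bigr => j _.
have -> : iter j d (c *: D + E) = c *: iter j d D + iter j d E.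
  by elim: (nat_of_ord j) => //= i ->; rewrite omega_barD omega_barZ.
by rewrite scalerDr !scalerA [c * _]mulrC.
Qed.

(** Cauchy product of finite sums: the antidiagonals of index less than 2 K cover the square of side
    K. *)
Lemma big_triangle (V : nmodType) (a : nat -> nat -> V) K :
  (forall i j, (K <= i)%N || (K <= j)%N -> a i j = 0) ->
  \sum_(k < K + K) \sum_(i < k.+1) a i (k - i)%N = \sum_(i < K) \sum_(j < K) a i j.
Proof.
move=> a0.
transitivity (\sum_(k < K + K) \sum_(i < K + K | (i <= k)%N) a i (k - i)%N).
  apply: eq_bigr => k _; rewrite (big_ord_widen (K + K) (fun i => a i (k - i)%N))//.
transitivity (\sum_(i < K + K) \sum_(k < K + K | (i <= k)%N) a i (k - i)%N).
  by rewrite (exchange_big_dep xpredT).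
rewrite big_split_ord /= [X in _ + X]big1 ?addr0 => [|i _]; last first.
  by rewrite big1// => k _; rewrite a0//= leq_addr.
apply: eq_bigr => i _.
transitivity (\sum_(i <= k < K + K) a i (k - i)%N).
  by rewrite big_geq_mkord.
have iK : (i <= K)%N by exact: ltnW.
rewrite (@big_cat_nat _ _ _ (i + K)) /=; [|exact: leq_addr|by rewrite leq_add2r].
have -> : \sum_(i + K <= k < K + K) a i (k - i)%N = 0.
  rewrite big_nat_cond big1// => k /andP[/andP[h _] _]; rewrite a0//; apply/orP; right.
  by rewrite leq_subRL// (leq_trans _ h)// leq_addr.
rewrite addr0.
rewrite addnC -{1}[nat_of_ord i]add0n big_addn addnK big_mkord.
by apply: eq_bigr => j _; rewrite addnK.
Qed.

Lemma exp_omega_bar_lie D E :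
  exp_omega_bar w (lie D E) = lie (exp_omega_bar w D) (exp_omega_bar w E).
Proof.
have [k oD] := dop_ordlt D; have [l oE] := dop_ordlt E; pose K := (k + l)%N.
have oD' : ordlt K D by apply: ordltW oD; exact: leq_addr.
have oE' : ordlt K E by apply: ordltW oE; exact: leq_addl.
have z1 i : (K <= i)%N -> iter i d D = 0 by exact: iter_omega_bar.
have z2 i : (K <= i)%N -> iter i d E = 0 by exact: iter_omega_bar.
have oDE : ordlt (K + K) (lie D E).
  by apply: ordltW (ordlt_lie oD' oE'); lia.
rewrite (exp_omega_bar_ord oDE) (exp_omega_bar_ord oD') (exp_omega_bar_ord oE').
pose a i j : L := (i`!%:R^-1 * j`!%:R^-1 : R) *: lie (iter i d D) (iter j d E).
transitivity (\sum_(k < K + K) \sum_(i < k.+1) a i (k - i)%N).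
  apply: eq_bigr => r _; rewrite (iter_leibniz _ _ _ (@lieDl R n M) (fun x y z => lieDr
      x y z) omega_barD omega_bar_lie).
  rewrite scaler_sumr; apply: eq_bigr => i _; rewrite /a.
  have nZ (v : L) m : v *+ m = (m%:R : R) *: v by rewrite scaler_nat.
  rewrite nZ scalerA.
  congr (_ *: _); have ir : (i <= r)%N by rewrite -ltnS.
  have := bin_fact ir => /(congr1 (fun z : nat => z%:R : R)); rewrite !natrM => <-.
  have b0 : 'C(r, i)%:R != 0 :> R by rewrite pnatr_eq0 -lt0n bin_gt0.
  have i0 : i`!%:R != 0 :> R by rewrite pnatr_eq0 -lt0n fact_gt0.
  have r0 : (r - i)`!%:R != 0 :> R by rewrite pnatr_eq0 -lt0n fact_gt0.
  by field; rewrite b0 i0 r0.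
rewrite big_triangle => [|i j /orP[Ki|Kj]]; last 2 first.
- by rewrite /a z1// lie0l scaler0.
- by rewrite /a z2// lie0r scaler0.
have suml (s : seq nat) (G : nat -> L) H : lie (\sum_(i <- s) G i) H = \sum_(i <- s)
    lie (G i) H.
  by elim: s => [|i s IH]; rewrite ?big_nil ?lie0l// !big_cons lieDl IH.
have sumr (s : seq nat) (G : nat -> L) H : lie H (\sum_(i <- s) G i) = \sum_(i <- s)
    lie H (G i).
  by elim: s => [|i s IH]; rewrite ?big_nil ?lie0r// !big_cons lieDr IH.
rewrite -(big_mkord xpredT (fun i => (i`!%:R^-1 : R) *: iter i d D)).
rewrite suml big_mkord; apply: eq_bigr => i _.
rewrite -(big_mkord xpredT (fun i => (i`!%:R^-1 : R) *: iter i d E)) sumr big_mkord.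
apply: eq_bigr => j _.
by rewrite lieZl lieZr scalerA.
Qed.

Lemma exp_omega_bar_unipotent k D : ordlt k.+1 D -> ordlt k (exp_omega_bar w D - D).
Proof.
move=> oD; rewrite (exp_omega_bar_ord oD) big_ord_recl fact0 invr1 scale1r /=.
rewrite addrC addKr; apply: ordlt_sum => j; apply: ordltZ.
have oj i : ordlt k (iter i.+1 d D).
  elim: i => [|i IH]; first exact: ordlt_omega_bar.
  by rewrite iterS; apply: ordlt_omega_bar; exact: ordltS.
exact: oj.
Qed.

(** The map is unipotent for the filtration by order: an element of the kernel descends to order 0,
    and a preimage of D is D plus a preimage of a correction of lower order. *)
Lemma exp_omega_bar_bij : bijective (exp_omega_bar w).
Proof.
have expD D E : exp_omega_bar w (D + E) = exp_omega_bar w D + exp_omega_bar w E.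
  by have := exp_omega_bar_linear 1 D E; rewrite !scale1r.
have expN D : exp_omega_bar w (- D) = - exp_omega_bar w D.
  by have := exp_omega_bar_linear (-1) D 0; rewrite addr0 !scaleN1r (@exp_omega_bar_ord
      0 0)// big_ord0 addr0.
have inj : injective (exp_omega_bar w).
  suff inj0 D : exp_omega_bar w D = 0 -> D = 0.
    by move=> D E e; apply/eqP; rewrite -subr_eq0; apply/eqP/inj0; rewrite expD expN e
        subrr.
  move=> e; have [k] := dop_ordlt D; elim: k => // k IH oD; apply: IH.
  by have := ordltN (exp_omega_bar_unipotent oD); rewrite e sub0r opprK.
have surj D : exists E, exp_omega_bar w E = D.
  have [k] := dop_ordlt D; elim: k D => [|k IH] D oD.
    by exists 0; rewrite (@exp_omega_bar_ord 0 0)// big_ord0 (oD : D = 0).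
  have [E eE] := IH _ (ordltN (exp_omega_bar_unipotent oD)).
  by exists (D + E); rewrite expD eE opprB addrC subrK.
have [G HG] := choice surj.
by exists G => [D|D]; [apply: inj|]; rewrite HG.
Qed.

Lemma exp_omega_bar_lieaut : lieaut (exp_omega_bar w).
Proof. by split; [exact: exp_omega_bar_linear|exact: exp_omega_bar_bij|exact:
    exp_omega_bar_lie]. Qed.

Lemma exp_omega_bar_mulop f : exp_omega_bar w (mulop f) = mulop f.
Proof.
by rewrite (exp_omega_bar_ord (ordlt_mulop f)) big_ord1 fact0 invr1 scale1r.
Qed.

Lemma exp_omega_bar_derivation X : derivation X -> exp_omega_bar w X = X + d X.
Proof.
move=> dX; rewrite (exp_omega_bar_ord (ordlt_deriv dX)) !big_ord_recl big_ord0 addr0.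
by rewrite /bump /= !fact0 invr1 !scale1r.
Qed.

Lemma omega_bar_derivation X : derivation X -> d X = mulop (d X 1).
Proof. by move=> dX; apply/ordlt1P/ordlt_omega_bar/ordlt_deriv. Qed.

Lemma omega_bar_derivation1 X i x (r : R) y : derivation X -> nice i x r -> `|y - x| < r ->
  d X 1 (param i y) = \sum_l X (coord_fun i x r l) (param i y) * w i y l 0.
Proof.
move=> dX nr yx; have [F [U [oU Up pF]]] := primitive_exists w (param i y).
rewrite (omega_bar_primitive _ _ oU Up pF) lie_deriv//.
transitivity (X F (param i y)); first by rewrite dopE mulr1.
rewrite (frame_at F nr dX yx); apply: eq_bigr => l _; rewrite pF//.
by case: nr => r0; apply; apply: le_trans (ltW yx) _; rewrite ler_peMl ?ler1n// ltW.
Qed.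

End Exponential.

(** * The closed form of a cocycle *)

Lemma sum_delta (R : pzSemiRingType) n (l : 'I_n) (G : 'I_n -> R) :
  \sum_m (m == l)%:R * G m = G l.
Proof.
rewrite (bigD1 l)//= eqxx mul1r big1 ?addr0// => m /negPf->.
by rewrite mul0r.
Qed.

Section FormOfCocycle.
Context {R : realType} {n : nat} (M : manifold R n).
Local Notation A := (cinf M).
Local Notation L := (Dop M).
Implicit Types (f g h : A) (p q : M) (X Y : L) (i j : idx M).

Lemma partial_coord_fun i x (r : R) l m y : nice i x r -> `|y - x| < r ->
  partial l (coord_fun i x r m \o param i) y = (m == l)%:R.
Proof. by move=> nr yx; rewrite -(coord_field_in l _ nr (ltW yx)) coord_field_coord. Qed.

Variable c : L -> A.
Hypothesis cD : forall X Y, c (X + Y) = c X + c Y.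
Hypothesis cZ : forall f X, derivation X -> c (mulop f * X) = f * c X.
Hypothesis cL : forall X Y, derivation X -> derivation Y -> c (lie X Y) = X (c Y) - Y (c X).

Let c0 : c 0 = 0. Proof. by apply: (addrI (c 0)); rewrite -cD !addr0. Qed.
Let cN X : c (- X) = - c X.
Proof. by apply: (addrI (c X)); rewrite -cD !subrr c0. Qed.

(** A bump b at p supported where X vanishes gives b X = 0, hence b * c X = 0 by linearity. *)
Lemma cocycle_local X p : derivation X -> (\forall q \near p, forall f, X f q = 0) -> c
    X p = 0.
Proof.
move=> dX X0; have [W [oW Wp] WX] := near_open X0.
have [b [_ b1 [K [_ KW] b0]]] := bump_exists oW Wp.
have bX : mulop b * X = 0.
  apply: dop_ext => f; apply: cinf_ext => q.
  transitivity (b q * X f q); first by [].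
  have [Kq|/b0->] := pselect (K q); last by rewrite mul0r.
  by rewrite WX ?mulr0//; exact: KW.
have := cZ b dX; rewrite bX c0 => /(congr1 (fun f : A => f p)) e.
transitivity (b p * c X p); first by rewrite (nbhs_singleton b1) mul1r.
exact: esym e.
Qed.

Lemma cocycle_frame X i x (r : R) y : derivation X -> nice i x r -> `|y - x| < r ->
  c X (param i y) =
  \sum_l X (coord_fun i x r l) (param i y) * c (coord_field i x r l) (param i y).
Proof.
move=> dX nr yx.
pose S := \sum_l mulop (X (coord_fun i x r l)) * coord_field i x r l.
have dS : derivation S.
  by apply: derivation_sum => l; apply: derivation_mull; exact: derivation_coord_field.
have cS : c S = \sum_l X (coord_fun i x r l) * c (coord_field i x r l).
  rewrite /S; elim/big_rec2: _ => // l f D _ <-.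
  by rewrite cD cZ//; exact: derivation_coord_field.
transitivity (c S (param i y)); last by rewrite cS cinf_sum.
have ry : rng i y.
  by case: nr => r0; apply; apply: le_trans (ltW yx) _; rewrite ler_peMl ?ler1n// ltW.
have : c (X - S) (param i y) = 0.
  apply: cocycle_local; first by apply: derivationD => //; exact: derivationN.
  have oU := @preimage_chart_open R n M i _ (ball_open x r).
  apply: filterS (open_nbhs_nbhs (conj oU _)).
    move=> q [dq]; rewrite /= -ball_normE /ball_/= distrC => qx f.
    transitivity (X f q - S f q); first by [].
    rewrite -(chartK dq) (frame_at f nr dX qx) /S dop_sum cinf_sum -sumrB big1// => l _.
    rewrite -(coord_field_in l f nr (ltW qx)).
    exact: subrr.
  split; first exact: param_dom.
  by rewrite /= paramK// -ball_normE /ball_/= distrC.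
rewrite cD cN => e; apply: subr0_eq; exact: e.
Qed.

Lemma nice_radius : {rad : idx M -> 'rV[R]_n -> R & forall i x, rng i x -> nice i x
    (rad i x)}.
Proof.
have [z zP] : {z : idx M * 'rV[R]_n -> R & forall ix, rng ix.1 ix.2 -> nice ix.1 ix.2
    (z ix)}.
  apply: (@choice _ _ (fun ix r => rng ix.1 ix.2 -> nice ix.1 ix.2 r)) => -[i x].
  have [rx|nrx] := pselect (rng i x); last by exists 0.
  by have [r nr _] := nice_exists (@rng_open R n M i) (fun y ry => ry) rx; exists r.
by exists (fun i x => z (i, x)) => i x; exact: (zP (i, x)).
Qed.

Let rad := projT1 nice_radius.
Let radP i x : rng i x -> nice i x (rad i x) := projT2 nice_radius i x.

Definition cocycle_form (i : idx M) (x : 'rV[R]_n) : 'cV[R]_n :=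
  \col_l c (coord_field i x (rad i x) l) (param i x).

(** Each value of the form uses a field cut off around its own point; here one fixed field replaces
    them all near x, which gives smoothness and closedness. *)
Lemma cocycle_form_local i x (r : R) y l : nice i x r -> `|y - x| < r ->
  cocycle_form i y l 0 = c (coord_field i x r l) (param i y).
Proof.
move=> nr yx; rewrite mxE.
have ry : rng i y.
  by case: nr => r0; apply; apply: le_trans (ltW yx) _; rewrite ler_peMl ?ler1n// ltW.
have ny := radP ry; have yy : `|y - y| < rad i y by rewrite subrr normr0; case: ny.
rewrite [RHS](cocycle_frame (derivation_coord_field l nr) ny yy).
transitivity (\sum_m (m == l)%:R * c (coord_field i y (rad i y) m) (param i y)).
  by rewrite sum_delta.
apply: eq_bigr => m _; congr (_ * _).
by rewrite (coord_field_in l _ nr (ltW yx)) partial_coord_fun.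
Qed.

Lemma cocycle_form_smooth i : smooth_on (rng i) (cocycle_form i).
Proof.
move=> k; apply: Ck_local => x rx; have nr := radP rx; have [r0 Hr] := nr.
exists (ball x (rad i x)); first exact: ballxx.
have Br : ball x (rad i x) `<=` rng i.
  move=> z; rewrite -ball_normE /ball_/= distrC => zx; apply: Hr.
  by apply: le_trans (ltW zx) _; rewrite ler_peMl ?ler1n// ltW.
apply: Ck_of_coordC => [|l]; first exact: ball_open.
apply: (@Ck_ext _ _ _ _ _ (c (coord_field i x (rad i x) l) \o param i)); first exact:
    ball_open.
  move=> y; rewrite -ball_normE /ball_/= distrC => yx.
  by rewrite -(cocycle_form_local l nr yx).
by apply: Ck_sub (cinfP _ i k); exact: Br.
Qed.

Lemma cocycle_form_compat i j x : rng i x -> dom j (param i x) ->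
  cocycle_form i x = jacobian (transition i j) x *m cocycle_form j (transition i j x).
Proof.
move=> rx dj; apply/colP => l; have nx := radP rx.
have xx : `|x - x| < rad i x by rewrite subrr normr0; case: nx.
set y := transition i j x.
have ry : rng j y by exact: chart_rng.
have ny := radP ry; have yy : `|y - y| < rad j y by rewrite subrr normr0; case: ny.
have yp : param j y = param i x by rewrite /y /transition /= chartK.
have Wx : (rng i `&` param i @^-1` dom j) x by [].
have ds : differentiable (transition i j) x by exact: (smooth_differentiable
    (chart_compat i j) Wx).
rewrite (cocycle_form_local l nx xx) -yp.
rewrite (cocycle_frame (derivation_coord_field l nx) ny yy) [RHS]mxE.
apply: eq_bigr => m _; congr (_ * _); last by rewrite mxE.
rewrite yp (coord_field_in l _ nx (ltW xx)) jacobianE//.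
have oV := @preimage_param_open R n M i _ (@preimage_chart_open R n M j _ (ball_open y
    (rad j y))).
apply: near_eq_derive; apply: filterS (open_nbhs_nbhs (conj oV _)).
  move=> z [rz [dz]]; rewrite /= -ball_normE /ball_/= distrC => zy.
  by rewrite /= -{1}(chartK dz) coord_fun_in// ltW.
by split=> //; split=> //=; apply: ballxx; case: ny.
Qed.

Lemma cocycle_form_closed i k l x : rng i x ->
  partial k (fun y => cocycle_form i y l 0) x = partial l (fun y => cocycle_form i y k 0) x.
Proof.
move=> rx; have nr := radP rx; have [r0 _] := nr; set r := rad i x in nr r0.
have xx : `|x - x| < r by rewrite subrr normr0.
have dY m := derivation_coord_field m nr.
have E k' l' : partial k' (fun y => cocycle_form i y l' 0) x =
    coord_field i x r k' (c (coord_field i x r l')) (param i x).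
  rewrite coord_field_in ?ltW//; apply: near_eq_derive.
  apply: filterS (open_nbhs_nbhs (conj (ball_open x r) (ballxx x r0))) => y.
  by rewrite -ball_normE /ball_/= distrC => yx; rewrite (cocycle_form_local l' nr yx).
rewrite !E.
(* By [cocycle_frame] only the values of the bracket on the coordinates count, and each field takes
   constant values on the coordinates near x. *)
have : c (lie (coord_field i x r k) (coord_field i x r l)) (param i x) = 0.
  rewrite (cocycle_frame (derivation_lie (dY k) (dY l)) nr xx) big1// => m _.
  have Z k' l' : coord_field i x r k' (coord_field i x r l' (coord_fun i x r m)) (param
      i x) = 0.
    have -> : coord_field i x r k' (coord_field i x r l' (coord_fun i x r m)) (param i x) =
        coord_field i x r k' ((m == l')%:R *: (1 : A)) (param i x).
      apply: dop_local; apply: filterS (param_ball_nbhs nr) => q [dq qx].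
      by rewrite -(chartK dq) coord_field_coord// !cinfE mulr1.
    by rewrite linearZ_LR /= derivation1// scaler0.
  transitivity ((0 - 0) * c (coord_field i x r m) (param i x)); last by rewrite subrr mul0r.
  by congr (_ * _); rewrite -{1}(Z k l) -(Z l k).
have e := congr1 (fun f : A => f (param i x)) (cL (dY k) (dY l)).
by move=> e0; apply: subr0_eq; rewrite -[RHS]e0; exact: esym e.
Qed.

Lemma closed_form_of_cocycle : exists w : closed_form M,
  forall X, derivation X -> omega_bar w X 1 = c X.
Proof.
pose w := ClosedForm cocycle_form_smooth cocycle_form_compat cocycle_form_closed.
exists w => X dX; apply: cinf_ext => p; have [i dp] := dom_cover p.
have nr := radP (chart_rng dp).
have xx : `|chart i p - chart i p| < rad i (chart i p) by rewrite subrr normr0; case: nr.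
rewrite -(chartK dp) (omega_bar_derivation1 w dX nr xx) (cocycle_frame dX nr xx).
by apply: eq_bigr => l _; rewrite -(cocycle_form_local l nr xx).
Qed.

End FormOfCocycle.

(** * Structure of automorphisms *)

Section Push.
Context {R : realType} {n : nat} (M : manifold R n).
Local Notation A := (cinf M).
Local Notation L := (Dop M).
Implicit Types (phi : diffeo M) (f : A) (D : L).

Lemma precompK phi : cancel (precomp phi) (precomp (diffeo_inv phi)).
Proof. by move=> f; apply: cinf_ext => p; rewrite /= dinvK. Qed.

Lemma precompVK phi : cancel (precomp (diffeo_inv phi)) (precomp phi).
Proof. by move=> f; apply: cinf_ext => p; rewrite /= dfunK. Qed.

Lemma pushK phi : cancel (push phi) (push (diffeo_inv phi)).
Proof.
move=> D; apply: dop_ext => f.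
transitivity (precomp phi (precomp (diffeo_inv phi) (D (precomp phi (precomp
    (diffeo_inv phi) f))))).
  by apply: cinf_ext => p.
by rewrite !precompVK.
Qed.

Lemma pushVK phi : cancel (push (diffeo_inv phi)) (push phi).
Proof.
move=> D; apply: dop_ext => f.
transitivity (precomp (diffeo_inv phi) (precomp phi (D (precomp (diffeo_inv phi)
    (precomp phi f))))).
  by apply: cinf_ext => p.
by rewrite !precompK.
Qed.

Lemma pushM phi D E : push phi (D * E) = push phi D * push phi E.
Proof. by apply: dop_ext => f; rewrite /= precompVK. Qed.

Lemma push_linear phi : linear (push phi).
Proof. by move=> a D E; apply: dop_ext => f; apply: cinf_ext. Qed.

Lemma push_lieaut phi : lieaut (push phi).
Proof.
split; first exact: push_linear.
  by exists (push (diffeo_inv phi)); [exact: pushK|exact: pushVK].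
move=> D E; have pB D' E' : push phi (D' - E') = push phi D' - push phi E'.
  by have := push_linear phi (-1) E' D'; rewrite !scaleN1r ![- _ + _]addrC.
by rewrite /lie pB !pushM.
Qed.

Lemma push_mulop phi f : push phi (mulop f) = mulop (precomp (diffeo_inv phi) f).
Proof.
apply: dop_ext => g; apply: cinf_ext => p.
transitivity (f (Defs.dinv phi p) * g (phi (Defs.dinv phi p))); first by [].
by rewrite dinvK.
Qed.

End Push.

(** * Decomposition of automorphisms and its uniqueness *)

Section Automorphisms.
Context {R : realType} {n : nat} (M : manifold R n).
Local Notation A := (cinf M).
Local Notation L := (Dop M).
Hypothesis (n0 : (0 < n)%N) (p0 : M) (cM : connected [set: M]).
Implicit Types (f g : A) (D E X : L).

Let Mfull : full M := @manifold_full R n M n0.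
Let Mconst f (f0 : forall X, derivation X -> X f = 0) := manifold_const p0 cM f0.

Lemma lieaut_diffeo (F : L -> L) : lieaut F -> exists (phi : diffeo M) (k : R), k != 0 /\
  forall f, F (mulop f) = push phi (mulop (k *: f)).
Proof.
move=> aF; have [_ [G FG GF] _] := aF; have aG := lieaut_inv aF FG GF.
have Ffun f := on_functionsE (@dop_ordlt R n M) (@manifold_sqr R n M) f aF.
have Gfun f := on_functionsE (@dop_ordlt R n M) (@manifold_sqr R n M) f aG.
have [k k0 [U1 UM]] := on_functions_mul Mfull (@dop_ordlt R n M) (@manifold_sqr R n M)
    Mconst p0 aF.
set U := on_functions F in Ffun U1 UM; set V := on_functions G in Gfun.
have UV f : U (V f) = f by apply: mulop_inj; rewrite -Ffun -Gfun GF.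
have VU f : V (U f) = f by apply: mulop_inj; rewrite -Gfun -Ffun FG.
have UD f g : U (f + g) = U f + U g.
  by apply: mulop_inj; rewrite -Ffun !mulopD -!Ffun (lieautD aF).
have UZ a f : U (a *: f) = a *: U f.
  by apply: mulop_inj; rewrite -Ffun !mulopZ -!Ffun (lieautZ aF).
have VD f g : V (f + g) = V f + V g.
  by apply: mulop_inj; rewrite -Gfun !mulopD -!Gfun (lieautD aG).
have VZ a f : V (a *: f) = a *: V f.
  by apply: mulop_inj; rewrite -Gfun !mulopZ -!Gfun (lieautZ aG).
pose al f := k^-1 *: U f; pose be f := V (k *: f).
have ab : cancel al be by move=> f; rewrite /al /be scalerA mulfV// scale1r.
have ba : cancel be al by move=> f; rewrite /al /be UV scalerA mulVf// scale1r.
have al1 : al 1 = 1 by rewrite /al U1 scalerA mulVf// scale1r.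
have alM f g : al (f * g) = al f * al g.
  rewrite /al scaler_mull scaler_mulr -UM !scalerA; congr (_ *: _).
  by rewrite divfK.
have be1 : be 1 = 1 by rewrite -al1 ab.
have beM f g : be (f * g) = be f * be g by rewrite -{1}(ba f) -{1}(ba g) -alM ab.
have [phi phiE] : {phi : M -> M & forall q f, al f q = f (phi q)}.
  apply: (@choice _ _ (fun q p => forall f, al f q = f p)) => q.
  apply: (@character_point R n M (fun f => al f q)) => [|f g|a f|f g].
  - by rewrite al1.
  - by rewrite /al UD scalerDr.
  - by rewrite /al UZ scalerA mulrC -scalerA.
  - by rewrite alM.
have [psi psiE] : {psi : M -> M & forall q f, be f q = f (psi q)}.
  apply: (@choice _ _ (fun q p => forall f, be f q = f p)) => q.
  apply: (@character_point R n M (fun f => be f q)) => [|f g|a f|f g].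
  - by rewrite be1.
  - by rewrite /be scalerDr VD.
  - by rewrite /be scalerA mulrC -scalerA VZ.
  - by rewrite beM.
have [D DE] := pullback_diffeo ab ba (fun f q => phiE q f) (fun f q => psiE q f).
exists D, k; split=> // f; rewrite Ffun push_mulop; congr mulop.
apply: cinf_ext => q; transitivity (k * f (Defs.dinv D q)); last by [].
rewrite -DE /al; transitivity (k * (k^-1 * U f q)); last by [].
by rewrite mulrA mulfV// mul1r.
Qed.

Lemma lieaut_exp (F : L -> L) : lieaut F -> (forall f, F (mulop f) = mulop f) ->
  exists w : closed_form M, forall D, F D = exp_omega_bar w D.
Proof.
move=> aF Ff.
have F1 f : F (mulop f) = mulop (1 *: f) by rewrite scale1r.
pose c := cocycle_part F.
have FE X : derivation X -> F X = X + mulop (c X).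
  exact: (cocycle_partE aF (oner_neq0 R) F1).
have [|||w wE] := @closed_form_of_cocycle R n M c.
- exact: cocycle_partD aF.
- move=> f X dX; rewrite /c (cocycle_partZ Mfull aF (oner_neq0 R) F1)//.
  by rewrite subrr mul0r scale0r addr0.
- move=> X Y dX dY; apply: mulop_inj; apply: (addrI (lie X Y)).
  rewrite -FE; last exact: derivation_lie.
  rewrite (lieaut_lie aF) FE// FE// lieDl !lieDr lie_mulop_comm addr0 lie_deriv//.
  by rewrite (lieC (mulop _)) lie_deriv// mulopB addrA.
exists w => D.
have [_ [G eG Ge] _] := exp_omega_bar_lieaut w.
have aG := lieaut_inv (exp_omega_bar_lieaut w) eG Ge.
have GF E : G (F E) = E.
  apply: (@fix_all R n M (G \o F) Mfull (@manifold_framed R n M) (@dop_ordlt R n M)).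
  - exact: lieaut_comp.
  - by move=> f /=; rewrite Ff -[X in G X](exp_omega_bar_mulop w) eG.
  - move=> X dX /=; rewrite FE// -wE// -omega_bar_derivation//.
    by rewrite -exp_omega_bar_derivation.
by rewrite -[RHS]/(exp_omega_bar w D) -{2}(GF D) Ge.
Qed.

Variable C : L -> L.
Hypothesis aC : lieaut C.
Hypothesis Cf : forall f, C (mulop f) = - mulop f.

Lemma iter_conj_mulop (a : bool) f : iter a C (mulop f) = mulop ((-1) ^+ a *: f).
Proof. by case: a => /=; rewrite ?Cf ?expr0 ?expr1 ?scale1r// scaleN1r mulopN. Qed.

Lemma iter_conj_lieaut (a : bool) : lieaut (iter a C).
Proof. by case: a => //=; split=> //; exists id. Qed.

Lemma lieaut_decomp (F : L -> L) : lieaut F -> exists (phi : diffeo M) (a : bool) (w :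
    closed_form M),
  forall D, F D = push phi (iter a C (exp_omega_bar w D)).
Proof.
move=> aF; have [phi [k [k0 Fk]]] := lieaut_diffeo aF.
pose F1 := push (diffeo_inv phi) \o F.
have aF1 : lieaut F1 by apply: lieaut_comp => //; exact: push_lieaut.
have F1k f : F1 (mulop f) = mulop (k *: f) by rewrite /F1 /= Fk pushK.
have [a ka] : exists a : bool, k = (-1) ^+ a.
  have := kappa_square Mfull aF1 k0 F1k p0 => /eqP; rewrite sqrf_eq1 => /orP[]/eqP->.
    by exists false.
  by exists true.
have aCa := iter_conj_lieaut a; have [_ [H CH HC] _] := aCa.
have aH := lieaut_inv aCa CH HC.
have [w wE] : exists w : closed_form M, forall D, H (F1 D) = exp_omega_bar w D.
  apply: lieaut_exp; first exact: lieaut_comp.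
  by move=> f; rewrite /= F1k ka -iter_conj_mulop CH.
exists phi, a, w => D; rewrite -wE HC /F1 /=.
by rewrite pushVK.
Qed.

(** The exponentials fix functions, so the function 1 gives a and the others give phi, as functions
    separate points. Then the two exponentials agree, and their values on coordinate fields give the
    coefficients of the forms. *)
Lemma decomp_unique (phi phi' : diffeo M) (a a' : bool) (w w' : closed_form M) :
  (forall D, push phi (iter a C (exp_omega_bar w D)) =
             push phi' (iter a' C (exp_omega_bar w' D))) ->
  [/\ phi =1 phi', a = a' & form_eq w w'].
Proof.
move=> H.
have Hf f p : (-1) ^+ a * f (Defs.dinv phi p) = (-1) ^+ a' * f (Defs.dinv phi' p).
  have := H (mulop f); rewrite !exp_omega_bar_mulop !iter_conj_mulop !push_mulop.
  by move=> /mulop_inj/(congr1 (fun g : A => g p)).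
have aa : a = a'.
  have := Hf 1 p0; rewrite !(cinfE _) !mulr1.
  case: a a' {H Hf} => [] [] //=; rewrite expr0 expr1 => /eqP; rewrite -subr_eq0.
    by rewrite -opprD oppr_eq0 -mulr2n pnatr_eq0.
  by rewrite opprK -mulr2n pnatr_eq0.
subst a'.
have pp p : Defs.dinv phi p = Defs.dinv phi' p.
  apply: cinf_separates => f; have := Hf f p; apply: mulfI.
  by rewrite signr_eq0.
have phiE : phi =1 phi' by move=> p; rewrite -[RHS](dinvK phi) pp dfunK.
split=> //.
have pushE D : push phi D = push phi' D.
  apply: dop_ext => f; apply: cinf_ext => p /=; rewrite pp.
  by congr (D _ _); apply: cinf_ext => q /=; rewrite phiE.
have expE D : exp_omega_bar w D = exp_omega_bar w' D.
  have := H D; rewrite -pushE => /(lieaut_inj (push_lieaut phi)).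
  exact: (lieaut_inj (iter_conj_lieaut a)).
move=> i x rx; apply/colP => l.
have [r nr _] := nice_exists (@rng_open R n M i) (fun y ry => ry) rx.
have xx : `|x - x| < r by rewrite subrr normr0; case: nr.
have dX := derivation_coord_field l nr.
have key v : omega_bar v (coord_field i x r l) 1 (param i x) = v i x l 0.
  rewrite (omega_bar_derivation1 v dX nr xx) -[RHS](sum_delta l (fun m => v i x m 0)).
  by apply: eq_bigr => m _; rewrite coord_field_coord.
rewrite -!key; have := expE (coord_field i x r l).
by rewrite !exp_omega_bar_derivation// => /addrI->.
Qed.

End Automorphisms.

Theorem theorem10 (R : realType) (n : nat) (M : manifold R n)
    (M_dim : (0 < n)%N) (M_nonempty : [set: M] !=set0)
    (M_connected : connected [set: M])
    (div : vect M -> cinf M) (div_divergence : divergence div)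
    (C : {linear Dop M -> Dop M}) (C_conjugation : conjugation div C)
    (Phi : {linear Dop M -> Dop M}) :
  (lie_automorphism Phi <->
   exists (phi : diffeo M) (a : bool) (w : closed_form M),
     forall D, Phi D = push phi (iter a C (exp_omega_bar w D))) /\
  (forall (phi phi' : diffeo M) (a a' : bool) (w w' : closed_form M),
     (forall D, Phi D = push phi (iter a C (exp_omega_bar w D))) ->
     (forall D, Phi D = push phi' (iter a' C (exp_omega_bar w' D))) ->
     [/\ phi =1 phi', a = a' & form_eq w w']).
Proof.
have [p0 _] := M_nonempty; have [[bC lC] Cf _ _ _] := C_conjugation.
have aC : lieaut C by split=> //; exact: linearP.
split; last first.
  move=> phi phi' a a' w w' H H'; apply: (decomp_unique p0 aC Cf) => D.
  by rewrite -H -H'.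
split=> [[bPhi lPhi]|[phi [a [w PhiE]]]].
  apply: (lieaut_decomp M_dim p0 M_connected aC Cf).
  by split=> //; exact: linearP.
have : lieaut (push phi \o (iter a C \o exp_omega_bar w)).
  apply: lieaut_comp; first exact: push_lieaut.
  by apply: lieaut_comp; [exact: iter_conj_lieaut|exact: exp_omega_bar_lieaut].
have -> : push phi \o (iter a C \o exp_omega_bar w) = Phi by apply/funext => D /=;
    rewrite PhiE.
by case.
Qed.
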